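(* Let $(S,\mathcal{A},\mu)$ be a complete measure space, $E$ a Köthe function space over $(S,\mathcal{A},\mu)$ and $X$ a Banach space. If $\mu$ is a $\sigma$-finite measure and $E$ is wuacs, reflexive and has the Kadets-Klee property, then $E(X)$ is wuacs whenever $X$ is wuacs.
   Context: All Banach spaces are real. For a Banach space $X$, $X^*$ denotes its dual, $B_X$ its closed unit ball and $S_X$ its unit sphere. A Banach space $X$ is called wuacs (weakly uniformly alternatively convex or smooth) if for any two sequences $(x_n)$, $(y_n)$ in $S_X$ and every $x^*\in S_{X^*}$: $\|x_n+y_n\|\to2$ and $x^*(x_n)\to1$ imply $x^*(y_n)\to1$. A Banach space $X$ has the Kadets-Klee property if for every sequence $(x_n)$ in $X$ and each $x\in X$: $x_n\to x$ weakly and $\|x_n\|\to\|x\|$ imply $\|x_n-x\|\to0$. A Köthe function space over a complete, $\sigma$-finite measure space $(S,\mathcal{A},\mu)$ is a Banach space $(E,\|\cdot\|_E)$ of real-valued measurable functions on $S$ modulo equality $\mu$-a.e. such that: (i) $\chi_A\in E$ for every $A\in\mathcal{A}$ with $\mu(A)<\infty$; (ii) every $f\in E$ is $\mu$-integrable over every $A\in\mathcal{A}$ with $\mu(A)<\infty$; (iii) if $g$ is measurable and $f\in E$ with $|g(t)|\le|f(t)|$ $\mu$-a.e., then $g\in E$ and $\|g\|_E\le\|f\|_E$. For a Köthe function space $E$ and a Banach space $X$, the Köthe-Bochner space $E(X)$ is the Banach space of all Bochner-measurable functions $f:S\to X$ (modulo equality a.e.) with $\|f(\cdot)\|\in E$,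 normed by $\|f\|_{E(X)}=\|\,\|f(\cdot)\|\,\|_E$; Bochner-measurable means being the $\mu$-a.e. norm limit of a sequence of simple functions. *)

(* Defs.v *)
From HB Require Import structures.
From mathcomp Require Import all_boot all_order all_algebra.
From mathcomp Require Import ring lra.
From mathcomp Require Import all_classical all_reals all_analysis.
From mathcomp Require Import measurable_realfun.

Set Implicit Arguments.
Unset Strict Implicit.
Unset Printing Implicit Defensive.

Import Order.TTheory GRing.Theory Num.Theory.
Import numFieldNormedType.Exports.
Local Open Scope classical_set_scope.
Local Open Scope ring_scope.

Section dual_space.
Context (R : realType) (V : normedModType R).

Definition is_dual : {pred V -> R} :=
  [pred phi : V -> R | `[< scalar phi /\ continuous phi >]].

Record dual_space := DualSpace { dual_fun :> V -> R ; _ : is_dual dual_fun }.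

HB.instance Definition _ := [isSub for dual_fun].
HB.instance Definition _ := [Choice of dual_space by <:].

Lemma is_dualP (phi : V -> R) :
  reflect (scalar phi /\ continuous phi) (phi \in is_dual).
Proof. exact: asboolP. Qed.

Lemma is_dual_submod_closed : submod_closed is_dual.
Proof.
split.
  apply/is_dualP; split; last by move=> x; exact: cvg_cst.
  by move=> a x y; rewrite mulr0 addr0.
move=> a phi psi /is_dualP[lphi cphi] /is_dualP[lpsi cpsi].
apply/is_dualP; split.
  move=> b x y; rewrite !fctE lphi lpsi /GRing.scale/=; ring.
move=> x; apply: (@cvgD _ _ _ _ _ (a \*: phi) psi); last exact: cpsi.
by apply: cvgZr; exact: cphi.
Qed.

HB.instance Definition _ :=
  GRing.isSubmodClosed.Build R (V -> R) is_dual is_dual_submod_closed.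
HB.instance Definition _ := [SubChoice_isSubLmodule of dual_space by <:].

Definition dual_norm (phi : dual_space) : R :=
  sup [set `|phi x| | x in [set x : V | `|x| <= 1]].

Lemma dual_bounded (phi : dual_space) :
  exists M, forall x, `|x| <= 1 -> `|phi x| <= M.
Proof.
case: phi => phi /asboolP[lphi cphi] /=.
pose f : {linear V -> R} := HB.pack phi (GRing.isLinear.Build R V R *%R phi lphi).
have /bounded_funP := (linear_bounded_continuous f).2 cphi.
by move=> /(_ 1).
Qed.

Lemma dual_linear (phi : dual_space) : scalar phi.
Proof. by case: phi => phi /= /asboolP[]. Qed.

Lemma dual_continuous (phi : dual_space) : continuous phi.
Proof. by case: phi => phi /= /asboolP[]. Qed.

Lemma dual0 (phi : dual_space) : phi 0 = 0.
Proof. by have := dual_linear phi (-1) 0 0; rewrite scaler0 addr0; lra. Qed.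

Lemma dualZ (phi : dual_space) a x : phi (a *: x) = a * phi x.
Proof. by rewrite -[a *: x]addr0 dual_linear dual0 addr0. Qed.

Let nonempty_dual_set (phi : dual_space) :
  [set `|phi x| | x in [set x : V | `|x| <= 1]] !=set0.
Proof. by exists `|phi 0|, 0 => //=; rewrite normr0. Qed.

Let has_sup_dual (phi : dual_space) :
  has_sup [set `|phi x| | x in [set x : V | `|x| <= 1]].
Proof.
split; first exact: nonempty_dual_set.
by have [M phiM] := dual_bounded phi; exists M => _ [x /= x1 <-]; exact: phiM.
Qed.

Lemma dual_norm_ge (phi : dual_space) x : `|x| <= 1 -> `|phi x| <= dual_norm phi.
Proof. by move=> x1; apply: sup_upper_bound => //; exists x. Qed.

Lemma dual_norm_le (phi : dual_space) M :
  (forall x, `|x| <= 1 -> `|phi x| <= M) -> dual_norm phi <= M.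
Proof.
move=> phiM; apply: ge_sup; first exact: nonempty_dual_set.
by move=> _ [x /= x1 <-]; exact: phiM.
Qed.

Lemma dual_normD (phi psi : dual_space) :
  dual_norm (phi + psi) <= dual_norm phi + dual_norm psi.
Proof.
apply: dual_norm_le => x x1.
by apply: le_trans (ler_normD _ _) _; apply: lerD; exact: dual_norm_ge.
Qed.

Lemma dual_normZ (a : R) (phi : dual_space) :
  dual_norm (a *: phi) = `|a| * dual_norm phi.
Proof.
have le_normZ (b : R) (psi : dual_space) : dual_norm (b *: psi) <= `|b| * dual_norm psi.
  apply: dual_norm_le => x x1.
  rewrite [X in `|X|](_ : _ = b * psi x)// normrM.
  by rewrite ler_wpM2l// dual_norm_ge.
apply/eqP; rewrite eq_le le_normZ/=.
have [->|a0] := eqVneq a 0.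
  by rewrite normr0 mul0r; apply: le_trans (@dual_norm_ge _ 0 _); rewrite ?normr0.
rewrite -ler_pdivlMl ?normr_gt0// -normfV.
by apply: le_trans (le_normZ _ _); rewrite scalerA mulVf// scale1r.
Qed.

Lemma dual_norm_eq0 (phi : dual_space) : dual_norm phi = 0 -> phi = 0.
Proof.
move=> phi0; apply/val_inj/funext => x /=.
have phi0' y : `|y| <= 1 -> phi y = 0.
  by move=> /(dual_norm_ge phi); rewrite phi0 normr_le0 => /eqP.
have [->|x0] := eqVneq x 0; first by rewrite dual0.
have := phi0' (`|x|^-1 *: x); rewrite dualZ normrZ normfV normr_id.
rewrite mulVf ?normr_eq0// => /(_ (lexx _))/eqP.
by rewrite mulf_eq0 invr_eq0 normr_eq0 (negbTE x0) => /eqP.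
Qed.

HB.instance Definition _ :=
  Lmodule_isNormed.Build R dual_space dual_normD dual_normZ dual_norm_eq0.

Lemma dual_normE (phi : dual_space) :
  `|phi| = sup [set `|phi x| | x in [set x : V | `|x| <= 1]].
Proof. by []. Qed.

End dual_space.

Section geometry.
Context (R : realType) (V : normedModType R).

Definition wuacs := forall (x y : V ^nat) (phi : dual_space V),
  (forall n, `|x n| = 1) -> (forall n, `|y n| = 1) -> `|phi| = 1 ->
  `|x n + y n| @[n --> \oo] --> (2 : R) ->
  phi (x n) @[n --> \oo] --> (1 : R) ->
  phi (y n) @[n --> \oo] --> (1 : R).

Definition reflexive_space := forall Phi : dual_space (dual_space V),
  exists x : V, forall phi : dual_space V, Phi phi = phi x.

Definition weakly_cvg (u : V ^nat) (x : V) :=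
  forall phi : dual_space V, phi (u n) @[n --> \oo] --> phi x.

Definition kadets_klee := forall (u : V ^nat) (x : V),
  weakly_cvg u x -> `|u n| @[n --> \oo] --> `|x| ->
  `|u n - x| @[n --> \oo] --> (0 : R).
End geometry.

Section complete.
Context (R : realType) (V : normedModType R).

(* Completeness reduces to convergence of the sequences u with
   |u_(n+1) - u_n| <= 2^-n. *)
Lemma complete_geo :
  (forall u : V ^nat, (forall n, `|u n.+1 - u n| <= 2 ^- n) -> cvgn u) ->
  forall F : set_system V, ProperFilter F -> cauchy F -> cvg F.
Proof.
move=> Vc F FF Fc.
have e0 n : 0 < (2 ^- n.+2 : R) by rewrite invr_gt0 exprn_gt0.
have /choice[u uF] (n : nat) : exists x, F (ball x (2 ^- n.+2 : R)).
  exact: (cauchyP F).1 Fc _ (e0 n).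
have udist n : `|u n.+1 - u n| <= 2 ^- n.
  have [z [zn zSn]] := filter_ex (filterI (uF n) (uF n.+1)).
  move: zn zSn; rewrite -!ball_normE/= => zn zSn.
  rewrite -[u n.+1](subrK z) -addrA; apply: le_trans (ler_normD _ _) _.
  rewrite (distrC z); apply: le_trans (lerD (ltW zSn) (ltW zn)) _.
  rewrite !exprS !invfM; have := e0 n; rewrite !exprS !invfM.
  lra.
have /cvg_ex[l ul] := Vc u udist.
apply/cvg_ex; exists l; apply/cvgrPdist_lt => e egt0.
have e2 : 0 < e / 2 by rewrite divr_gt0.
near \oo => n.
have ln : `|l - u n| < e / 2 by near: n; exact: cvgr_dist_lt.
have en : 2 ^- n.+2 < e / 2.
  apply: (@le_lt_trans _ _ (1 / 2 ^+ n)).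
    by rewrite div1r lef_pV2 ?posrE ?exprn_gt0// ler_weXn2l ?leqW// ler1n.
  by near: n; exact: (near_infty_natSinv_expn_lt (PosNum e2)).
apply: filterS (uF n) => x; rewrite -ball_normE/= => xn.
rewrite -[l](subrK (u n)) -addrA; apply: le_lt_trans (ler_normD _ _) _.
by rewrite (splitr e); apply: ltrD => //; exact: lt_trans en.
Unshelve. all: by end_near. Qed.
End complete.

Section fun_space.
Context d (T : measurableType d) (R : realType) (mu : {measure set T -> \bar R}).

(* A vector space of functions T -> Y with a seminorm that vanishes exactly on
   the functions that are null mu-a.e.; fs_norm is only relevant on fs_mem. Its
   quotient ae_quot by mu-a.e. equality is a normed space. *)
Record fun_space (Y : normedModType R) := FunSpace {
  fs_mem : set (T -> Y) ;
  fs_norm : (T -> Y) -> R ;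
  fs_mem0 : fs_mem 0 ;
  fs_memL : forall a f g, fs_mem f -> fs_mem g -> fs_mem (a *: f + g) ;
  fs_normD : forall f g, fs_mem f -> fs_mem g ->
    fs_norm (f + g) <= fs_norm f + fs_norm g ;
  fs_normZ : forall a f, fs_mem f -> fs_norm (a *: f) = `|a| * fs_norm f ;
  fs_norm_ae : forall f g, fs_mem f -> fs_mem g ->
    {ae mu, forall t, f t = g t} -> fs_norm f = fs_norm g ;
  fs_norm_eq0 : forall f, fs_mem f -> fs_norm f = 0 ->
    {ae mu, forall t, f t = 0} }.

Context (Y : normedModType R) (F : fun_space Y).

Definition fs_pred : {pred T -> Y} := [pred f : T -> Y | `[< fs_mem F f >]].
Record fs_elt := FsElt { fs_fun :> T -> Y ; _ : fs_pred fs_fun }.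

HB.instance Definition _ := [isSub for fs_fun].
HB.instance Definition _ := [Choice of fs_elt by <:].

Lemma fs_pred_submod_closed : submod_closed fs_pred.
Proof.
split; first exact/asboolP/fs_mem0.
by move=> a f g /asboolP Ff /asboolP Fg; exact/asboolP/fs_memL.
Qed.

HB.instance Definition _ :=
  GRing.isSubmodClosed.Build R (T -> Y) fs_pred fs_pred_submod_closed.
HB.instance Definition _ := [SubChoice_isSubLmodule of fs_elt by <:].

Lemma fs_elt_mem (f : fs_elt) : fs_mem F f.
Proof. by case: f => f /= /asboolP. Qed.

Definition ae_eqb (f g : fs_elt) : bool := `[< {ae mu, forall t, f t = g t} >].

Let ae_eqb_refl : reflexive ae_eqb.
Proof. by move=> f; apply/asboolP; exact: aeW. Qed.

Let ae_eqb_sym : symmetric ae_eqb.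
Proof.
by move=> f g; apply/asboolP/asboolP; apply: filterS => t ->.
Qed.

Let ae_eqb_trans : transitive ae_eqb.
Proof.
move=> f g h /asboolP gf /asboolP fh; apply/asboolP.
by apply: filterS2 gf fh => t -> ->.
Qed.

Canonical ae_eqb_equiv := EquivRel ae_eqb ae_eqb_refl ae_eqb_sym ae_eqb_trans.

Definition ae_quot : Type := {eq_quot ae_eqb}%qT.
HB.instance Definition _ := Choice.on ae_quot.
HB.instance Definition _ := EqQuotient.on ae_quot.

Definition ae_class (f : fs_elt) : ae_quot := (\pi_ae_quot f)%qT.

Lemma ae_class_eq (f g : fs_elt) :
  ae_class f = ae_class g <-> {ae mu, forall t, f t = g t}.
Proof.
split=> [/eqP|fg]; first by rewrite eqmodE => /asboolP.
by apply/eqP; rewrite eqmodE; apply/asboolP.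
Qed.

Lemma ae_class_repr (x : ae_quot) : ae_class (repr x) = x.
Proof. exact: reprK. Qed.

Lemma repr_ae_class (f : fs_elt) : {ae mu, forall t, repr (ae_class f) t = f t}.
Proof. by apply/ae_class_eq; rewrite ae_class_repr. Qed.

Let zeroq : ae_quot := ae_class 0.
Let addq (x y : ae_quot) := ae_class (repr x + repr y).
Let oppq (x : ae_quot) := ae_class (- repr x).
Let scaleq (a : R) (x : ae_quot) := ae_class (a *: repr x).

Let pi_addq f g : addq (ae_class f) (ae_class g) = ae_class (f + g).
Proof.
apply/ae_class_eq; apply: filterS2 (repr_ae_class f) (repr_ae_class g).
by move=> t /= + +; rewrite !fctE => -> ->.
Qed.

Let pi_oppq f : oppq (ae_class f) = ae_class (- f).
Proof.
by apply/ae_class_eq; apply: filterS (repr_ae_class f) => t /=; rewrite !fctE => ->.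
Qed.

Let pi_scaleq a f : scaleq a (ae_class f) = ae_class (a *: f).
Proof.
by apply/ae_class_eq; apply: filterS (repr_ae_class f) => t /=; rewrite !fctE => ->.
Qed.

Let addqA : associative addq.
Proof.
move=> x y z; rewrite -(ae_class_repr x) -(ae_class_repr y) -(ae_class_repr z).
by rewrite !pi_addq addrA.
Qed.

Let addqC : commutative addq.
Proof. by move=> x y; rewrite /addq addrC. Qed.

Let add0q : left_id zeroq addq.
Proof. by move=> x; rewrite -(ae_class_repr x) pi_addq add0r. Qed.

Let addNq : left_inverse zeroq oppq addq.
Proof. by move=> x; rewrite -(ae_class_repr x) pi_oppq pi_addq addNr. Qed.

HB.instance Definition _ := GRing.isZmodule.Build ae_quot addqA addqC add0q addNq.

Lemma ae_classD f g : ae_class (f + g) = ae_class f + ae_class g.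
Proof. by rewrite -pi_addq. Qed.

Lemma ae_classN f : ae_class (- f) = - ae_class f.
Proof. by rewrite -pi_oppq. Qed.

Lemma ae_class0 : ae_class 0 = 0.
Proof. by []. Qed.

Let scaleqA a b x : scaleq a (scaleq b x) = scaleq (a * b) x.
Proof. by rewrite -(ae_class_repr x) !pi_scaleq scalerA. Qed.

Let scale1q : left_id 1 scaleq.
Proof. by move=> x; rewrite -(ae_class_repr x) pi_scaleq scale1r. Qed.

Let scaleqDr : right_distributive scaleq +%R.
Proof.
move=> a x y; rewrite -(ae_class_repr x) -(ae_class_repr y).
by rewrite -ae_classD !pi_scaleq scalerDr ae_classD.
Qed.

Let scaleqDl x : {morph scaleq^~ x : a b / a + b}.
Proof.
by move=> a b; rewrite -(ae_class_repr x) !pi_scaleq scalerDl ae_classD.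
Qed.

HB.instance Definition _ := GRing.Zmodule_isLmodule.Build R ae_quot
  scaleqA scale1q scaleqDr scaleqDl.

Lemma ae_classZ a f : ae_class (a *: f) = a *: ae_class f.
Proof. by rewrite -pi_scaleq. Qed.

Let normq (x : ae_quot) : R := fs_norm F (repr x).

Let pi_normq f : normq (ae_class f) = fs_norm F f.
Proof.
by apply: fs_norm_ae; [exact: fs_elt_mem|exact: fs_elt_mem|exact: repr_ae_class].
Qed.

Let normqD x y : normq (x + y) <= normq x + normq y.
Proof.
rewrite -(ae_class_repr x) -(ae_class_repr y) -ae_classD !pi_normq.
by apply: fs_normD; exact: fs_elt_mem.
Qed.

Let normqZ a x : normq (a *: x) = `|a| * normq x.
Proof.
rewrite -(ae_class_repr x) -ae_classZ !pi_normq.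
by apply: fs_normZ; exact: fs_elt_mem.
Qed.

Let normq_eq0 x : normq x = 0 -> x = 0.
Proof.
rewrite -(ae_class_repr x) pi_normq => /fs_norm_eq0 x0.
by apply/ae_class_eq; apply: x0; exact: fs_elt_mem.
Qed.

HB.instance Definition _ :=
  Lmodule_isNormed.Build R ae_quot normqD normqZ normq_eq0.

Lemma norm_ae_class f : `|ae_class f| = fs_norm F f.
Proof. exact: pi_normq. Qed.

Lemma norm_ae_quot (x : ae_quot) : `|x| = fs_norm F (repr x).
Proof. by []. Qed.

Lemma ae_quot_complete :
  (forall u : nat -> T -> Y, (forall n, fs_mem F (u n)) ->
    (forall n, fs_norm F (u n.+1 - u n) <= 2 ^- n) ->
    exists2 f, fs_mem F f & fs_norm F (u n - f) @[n --> \oo] --> (0 : R)) ->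
  forall G : set_system ae_quot, ProperFilter G -> cauchy G -> cvg G.
Proof.
move=> Fc; apply: complete_geo => u uc.
have [||f Ff uf] := Fc (fun n => repr (u n)).
- by move=> n; exact: fs_elt_mem.
- move=> n; apply: le_trans (uc n).
  rewrite -(ae_class_repr (u n.+1)) -(ae_class_repr (u n)) -ae_classN -ae_classD.
  by rewrite norm_ae_class !ae_class_repr.
have fP : fs_pred f by apply/asboolP.
apply/cvg_ex; exists (ae_class (FsElt fP)).
apply/cvgrPdist_lt => e e0.
move/cvgrPdist_lt : uf => /(_ e e0) uf.
apply: filterS uf => n.
rewrite sub0r normrN => /(le_lt_trans (ler_norm _)).
rewrite distrC -[X in `|X - _|](ae_class_repr (u n)).
by rewrite -ae_classN -ae_classD norm_ae_class.
Qed.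
End fun_space.

Section koethe.
Context d (T : measurableType d) (R : realType) (mu : {measure set T -> \bar R}).

(* The space is given by the set koethe_mem of all representatives of its
   elements, so that its elements are the a.e. classes of such functions
   (type koethe below). koethe_norm is only relevant on koethe_mem.
   No field uses cmu, but E(X) does: without completeness of mu, |f| is only
   a.e. equal to a measurable function when f is Bochner-measurable. *)
Record koethe_space (cmu : measure_is_complete mu) := KoetheSpace {
  koethe_mem : set (T -> R) ;
  koethe_norm : (T -> R) -> R ;
  koethe_measurable : forall f, koethe_mem f -> measurable_fun setT f ;
  koethe_memL : forall a f g, koethe_mem f -> koethe_mem g ->
    koethe_mem (a *: f + g) ;
  koethe_normD : forall f g, koethe_mem f -> koethe_mem g ->
    koethe_norm (f + g) <= koethe_norm f + koethe_norm g ;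
  koethe_normZ : forall a f, koethe_mem f ->
    koethe_norm (a *: f) = `|a| * koethe_norm f ;
  koethe_norm_eq0 : forall f, koethe_mem f -> koethe_norm f = 0 ->
    {ae mu, forall t, f t = 0} ;
  koethe_complete : forall u : nat -> T -> R, (forall n, koethe_mem (u n)) ->
    (forall e : R, 0 < e -> exists N, forall m n, (N <= m)%N -> (N <= n)%N ->
      koethe_norm (u m - u n) < e) ->
    exists2 f, koethe_mem f & koethe_norm (u n - f) @[n --> \oo] --> (0 : R) ;
  koethe_indic : forall A : set T, measurable A -> (mu A < +oo)%E ->
    koethe_mem (\1_A) ;
  koethe_integrable : forall (f : T -> R) (A : set T), koethe_mem f -> measurable A ->
    (mu A < +oo)%E -> mu.-integrable A (EFin \o f) ;
  koethe_ideal : forall f g : T -> R, koethe_mem f -> measurable_fun setT g ->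
    {ae mu, forall t, `|g t| <= `|f t|} ->
    koethe_mem g /\ koethe_norm g <= koethe_norm f }.

Context (cmu : measure_is_complete mu) (E : koethe_space cmu).

Lemma koethe_mem0 : koethe_mem E 0.
Proof.
rewrite (_ : 0 = \1_set0); last by apply/funext => t; rewrite indicE in_set0.
by apply: koethe_indic => //; rewrite measure0 ltry.
Qed.

Lemma koethe_norm_ae f g : koethe_mem E f -> koethe_mem E g ->
  {ae mu, forall t, f t = g t} -> koethe_norm E f = koethe_norm E g.
Proof.
move=> Ef Eg fg; apply/eqP; rewrite eq_le; apply/andP; split.
  apply: (koethe_ideal Eg (koethe_measurable Ef) _).2.
  by apply: filterS fg => t ->.
apply: (koethe_ideal Ef (koethe_measurable Eg) _).2.
by apply: filterS fg => t ->.
Qed.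

Definition koethe_fun_space : fun_space mu R := {|
  fs_mem0 := koethe_mem0 ;
  fs_memL := @koethe_memL _ E ;
  fs_normD := @koethe_normD _ E ;
  fs_normZ := @koethe_normZ _ E ;
  fs_norm_ae := koethe_norm_ae ;
  fs_norm_eq0 := @koethe_norm_eq0 _ E |}.

Definition koethe : Type := ae_quot koethe_fun_space.
HB.instance Definition _ := NormedModule.on koethe.

Lemma koethe_norm_ge0 f : koethe_mem E f -> 0 <= koethe_norm E f.
Proof.
move=> Ef; have ENf : koethe_mem E (- f).
  by rewrite -scaleN1r -[_ *: _]addr0; exact: koethe_memL koethe_mem0.
have := koethe_normD Ef ENf; rewrite subrr -(scale0r 0) koethe_normZ; last first.
  exact: koethe_mem0.
by rewrite normr0 mul0r -scaleN1r koethe_normZ// normrN1 mul1r; lra.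
Qed.

Lemma koethe_complete_geo (u : nat -> T -> R) : (forall n, koethe_mem E (u n)) ->
  (forall n, koethe_norm E (u n.+1 - u n) <= 2 ^- n) ->
  exists2 f, koethe_mem E f & koethe_norm E (u n - f) @[n --> \oo] --> (0 : R).
Proof.
move=> Eu uc; apply: koethe_complete => // e e0.
have EB m n : koethe_mem E (u m - u n).
  by rewrite addrC -scaleN1r; exact: koethe_memL.
have Nsym m n : koethe_norm E (u m - u n) = koethe_norm E (u n - u m).
  by rewrite -opprB -scaleN1r koethe_normZ// normrN1 mul1r.
have geo n k : koethe_norm E (u (n + k)%N - u n) <= 2 * 2 ^- n - 2 * 2 ^- (n + k).
  elim: k => [|k IH].
    rewrite addn0 !subrr -(scale0r 0) koethe_normZ ?normr0 ?mul0r//.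
    exact: koethe_mem0.
  rewrite (_ : _ - _ = (u (n + k).+1 - u (n + k)%N) + (u (n + k)%N - u n)); last first.
    by rewrite addrA subrK addnS.
  apply: le_trans (koethe_normD (EB _ _) (EB _ _)) _.
  apply: le_trans (lerD (uc _) IH) _.
  by rewrite addnS exprS invfM mulrA mulfV// mul1r; lra.
have e2 : 0 < e / 2 by rewrite divr_gt0.
have [N _ Ne] := near_infty_natSinv_expn_lt (PosNum e2).
exists N => m n; wlog mn : m n / (n <= m)%N.
  move=> wlg Nm Nn; have [nm|/ltnW mn] := leqP n m; first exact: wlg nm Nm Nn.
  by rewrite Nsym; exact: wlg mn Nn Nm.
move=> _ Nn; rewrite -(subnKC mn); apply: le_lt_trans (geo _ _) _.
apply: (@le_lt_trans _ _ (2 * 2 ^- n)).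
  by rewrite gerBl mulr_ge0// invr_ge0 exprn_ge0.
have := Ne n Nn; rewrite /= div1r; lra.
Qed.

Let koethe_cauchy_cvg :
  forall G : set_system koethe, ProperFilter G -> cauchy G -> cvg G.
Proof. by apply: ae_quot_complete; exact: koethe_complete_geo. Qed.

HB.instance Definition _ := Uniform_isComplete.Build koethe koethe_cauchy_cvg.

End koethe.

Section bochner_measurable.
Context d (T : measurableType d) (R : realType) (mu : {measure set T -> \bar R}).

Definition simple_function (Z : Type) (s : T -> Z) :=
  finite_set (range s) /\ forall z, measurable (s @^-1` [set z]).

Lemma simple_function_preimage (Z : Type) (s : T -> Z) (B : set Z) :
  simple_function s -> measurable (s @^-1` B).
Proof.
move=> [fs ms].
rewrite (_ : _ @^-1` _ = \bigcup_(z in range s `&` B) (s @^-1` [set z])).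
  by apply: fin_bigcup_measurable => // ; exact: finite_setIl.
apply/seteqP; split=> [t Bt|t [z [_ Bz] /= ->]//].
by exists (s t) => //; split => //; exists t.
Qed.

Lemma simple_function_comp2 (Z1 Z2 Z3 : Type) (h : Z1 -> Z2 -> Z3) s1 s2 :
  simple_function s1 -> simple_function s2 ->
  simple_function (fun t => h (s1 t) (s2 t)).
Proof.
move=> [fs1 ms1] [fs2 ms2].
have f12 := finite_setX fs1 fs2; split.
  apply: sub_finite_set (finite_image (fun z => h z.1 z.2) f12).
  by move=> _ [t _ <-] /=; exists (s1 t, s2 t) => //=; split; exists t.
move=> z; rewrite (_ : _ @^-1` _ = \bigcup_(p in
    (range s1 `*` range s2) `&` [set p | h p.1 p.2 = z])
    (s1 @^-1` [set p.1] `&` s2 @^-1` [set p.2])).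
  apply: fin_bigcup_measurable; first exact: finite_setIl.
  by move=> p _; exact: measurableI.
apply/seteqP; split=> [t /= hz|t [p [_ /= <-]] /= [-> ->]//].
by exists (s1 t, s2 t) => //; split => //; split; exists t.
Qed.

Lemma simple_function_cst (Z : Type) (z : Z) : simple_function (fun _ : T => z).
Proof.
split; first by apply: sub_finite_set (finite_set1 z) => _ [t _ <-].
move=> z'; have [->|zz'] := pselect (z = z').
  by rewrite (_ : _ @^-1` _ = setT)//; apply/seteqP.
by rewrite (_ : _ @^-1` _ = set0)//; apply/seteqP; split.
Qed.

Lemma simple_function_bool (A : set T) : measurable A ->
  simple_function (fun t => t \in A).
Proof.
move=> mA; split; first exact: finite_finset.
case.
  rewrite (_ : _ @^-1` _ = A)//; apply/seteqP; split=> t /=; first by move/set_mem.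
  by move/mem_set.
rewrite (_ : _ @^-1` _ = ~` A); first exact: measurableC.
apply/seteqP; split=> t /=; first by move/negbT; rewrite notin_setE.
by move=> nA; apply/negbTE; rewrite notin_setE.
Qed.

(* The simple functions need not be supported on sets of finite measure; this
   makes no difference when mu is sigma-finite, see
   bochner_measurable_sigma_finite. *)
Definition bochner_measurable (X : normedModType R) (f : T -> X) :=
  exists s : nat -> T -> X, (forall n, simple_function (s n)) /\
    {ae mu, forall t, s n t @[n --> \oo] --> f t}.

Context (X : normedModType R).
Implicit Types f g : T -> X.

Lemma simple_bochner_measurable f : simple_function f -> bochner_measurable f.
Proof.
by move=> sf; exists (fun _ => f); split => //; apply: aeW => t; exact: cvg_cst.
Qed.

Lemma bochner_measurableL a f g :
  bochner_measurable f -> bochner_measurable g -> bochner_measurable (a *: f + g).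
Proof.
move=> [s [ss sf]] [r [sr rg]]; exists (fun n => a *: s n + r n); split.
  move=> n.
  exact: (simple_function_comp2 (fun x y => a *: x + y) (ss n) (sr n)).
apply: filterS2 sf rg => t st rt; apply: cvgD => //.
exact: cvgZr.
Qed.

Lemma bochner_measurable_ae f g : {ae mu, forall t, f t = g t} ->
  bochner_measurable f -> bochner_measurable g.
Proof.
move=> fg [s [ss sf]]; exists s; split => //.
by apply: filterS2 fg sf => t ->.
Qed.

Context (cmu : measure_is_complete mu).

Lemma ae_cvg_measurable (u : nat -> T -> R) (v : T -> R) :
  (forall n, measurable_fun setT (u n)) ->
  {ae mu, forall t, u n t @[n --> \oo] --> v t} ->
  measurable_fun setT v.
Proof.
move=> mu_ uv; apply/measurable_EFinP.
apply: (ae_measurable_fun cmu (f := fun t => limn_esup (fun n => (u n t)%:E))).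
  apply: filterS uv => t uvt _.
  have /cvg_limn_einf_sup[_ ->//] : (u n t)%:E @[n --> \oo] --> (v t)%:E.
  by apply: cvg_EFin => //; exact: nearW.
by apply: measurable_fun_limn_esup => n; exact/measurable_EFinP.
Qed.

Lemma bochner_measurable_norm f : bochner_measurable f ->
  measurable_fun setT (fun t => `|f t|).
Proof.
move=> [s [ss sf]]; apply: (ae_cvg_measurable (u := fun n t => `|s n t|)).
  move=> n _ B mB; rewrite setTI.
  exact: (simple_function_preimage (Num.norm @^-1` B) (ss n)).
by apply: filterS sf => t; exact: cvg_norm.
Qed.

Lemma bochner_measurable_cvg (u : nat -> T -> X) f :
  (forall n, bochner_measurable (u n)) ->
  {ae mu, forall t, u n t @[n --> \oo] --> f t} -> bochner_measurable f.
Proof.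
move=> bu uf; have /choice[s /all_and2[ss su]] := bu.
pose D := \bigcup_n \bigcup_k range (s n k).
have cD : countable D.
  apply: bigcup_countable => // n _; apply: bigcup_countable => // k _.
  by apply: finite_set_countable; exact: (ss n k).1.
have [x Dx] : exists x : nat -> X, D `<=` range x.
  have /countable_injP[i iD] := cD.
  exists (fun m => xget 0 [set z | D z /\ i z = m]) => z Dz.
  exists (i z) => //; case: xgetP => [y _ [Dy iy]|/(_ z)[]//].
  by apply: iD; rewrite ?inE.
have mfx z : measurable_fun setT (fun t => `|f t - z|).
  apply: (ae_cvg_measurable (u := fun n t => `|u n t - z|)).
    move=> n; apply: (@bochner_measurable_norm (u n - cst z)).
    rewrite addrC -scaleN1r; apply: bochner_measurableL => //.
    exact/simple_bochner_measurable/simple_function_cst.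
  by apply: filterS uf => t ut; apply: cvg_norm; apply: cvgB => //; exact: cvg_cst.
pose p := fix p N : T -> X := if N is M.+1 then
  fun t => if t \in [set t | `|f t - x N| < `|f t - p M t|] then x N else p M t
  else fun=> x 0%N.
have pE N t : p N.+1 t = if `|f t - x N.+1| < `|f t - p N t| then x N.+1 else p N t.
  by rewrite /=; congr (if _ then _ else _); apply/idP/idP => [/set_mem|/mem_set].
have sp N : simple_function (p N) /\ measurable_fun setT (fun t => `|f t - p N t|).
  elim: N => [|N [sN mN]]; first by split; [exact: simple_function_cst|exact: mfx].
  have mA : measurable [set t | `|f t - x N.+1| < `|f t - p N t|].
    by rewrite -[X in measurable X]setTI; exact: measurable_fun_ltr.
  split.
    exact: (simple_function_comp2 (fun b z => if b then x N.+1 else z)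
      (simple_function_bool mA) sN).
  rewrite (_ : (fun t => _) =
      (fun t => `|f t - x N.+1|) \min (fun t => `|f t - p N t|)).
    exact: measurable_minr.
  by apply/funext => t; rewrite pE /= /Order.min; case: ifP.
have pS N t : `|f t - p N.+1 t| <= `|f t - p N t| /\ `|f t - p N.+1 t| <= `|f t - x N.+1|.
  rewrite pE; case: ltP => // h; split => //; exact: ltW.
have px N t k : (k <= N)%N -> `|f t - p N t| <= `|f t - x k|.
  elim: N => [|N IH]; first by rewrite leqn0 => /eqP ->.
  rewrite leq_eqVlt ltnS => /orP[/eqP ->|/IH]; first exact: (pS N t).2.
  exact: le_trans (pS N t).1.
exists p; split; first by move=> n; exact: (sp n).1.
apply: filterS2 uf (ae_foralln su) => t ut st.
apply/cvgrPdist_lt => e e0.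
have e2 : 0 < e / 2 by rewrite divr_gt0.
have /cvgrPdist_lt/(_ _ e2)/filter_ex[n /= un] := ut.
have /cvgrPdist_lt/(_ _ e2)/filter_ex[k /= sn] := st n.
have [j _ xj] : range x (s n k t) by apply: Dx; exists n => //; exists k => //; exists t.
near=> N; apply: le_lt_trans (px N t j _) _; first by near: N; exact: nbhs_infty_ge.
rewrite xj -[f t](subrK (u n t)) -addrA; apply: le_lt_trans (ler_normD _ _) _.
by rewrite (splitr e) ltrD.
Unshelve. all: by end_near. Qed.

Lemma bochner_measurable_sigma_finite f : sigma_finite setT mu ->
  bochner_measurable f <-> exists s : nat -> T -> X,
    (forall n, simple_function (s n) /\ (mu [set t | s n t <> 0%R] < +oo)%E) /\
    {ae mu, forall t, s n t @[n --> \oo] --> f t}.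
Proof.
move=> [F FT mF]; split=> [[s [ss sf]]|[s [ss sf]]]; last first.
  by exists s; split => // n; exact: (ss n).1.
pose A n := \big[setU/set0]_(i < n.+1) F i.
have mA n : measurable (A n) by apply: bigsetU_measurable => i _; exact: (mF i).1.
exists (fun n t => if t \in A n then s n t else 0); split.
  move=> n; have sAn : simple_function (fun t => if t \in A n then s n t else 0).
    exact: (simple_function_comp2 (fun b z => if b then z else 0)
      (simple_function_bool (mA n)) (ss n)).
  split => //; apply: (@le_lt_trans _ _ (mu (A n))).
    apply: le_measure; rewrite ?inE//.
      exact: (simple_function_preimage [set z | z <> 0] sAn).
    by move=> t /=; case: ifPn => // /set_mem.
  rewrite /A; elim: n.+1 => [|k IH]; first by rewrite big_ord0 measure0 ltry.
  rewrite big_ord_recr/=; apply: le_lt_trans (measureU2 _ _ _) _.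
  - by apply: bigsetU_measurable => i _; exact: (mF i).1.
  - exact: (mF k).1.
  - by rewrite lte_add_pinfty//; exact: (mF k).2.
apply: filterS sf => t st.
have [k _ Fkt] : (\bigcup_i F i) t by rewrite -FT.
apply: cvg_trans st; apply: near_eq_cvg; near=> n.
rewrite ifT//; apply/mem_set; rewrite /A -bigcup_mkord; exists k => //=.
by rewrite ltnS; near: n; exact: nbhs_infty_ge.
Unshelve. all: by end_near. Qed.

End bochner_measurable.

Section koethe_bochner.
Context d (T : measurableType d) (R : realType) (mu : {measure set T -> \bar R}).
Context (cmu : measure_is_complete mu) (E : koethe_space cmu).

Section normed.
Context (X : normedModType R).
Implicit Types f g : T -> X.

Definition kb_mem : set (T -> X) :=
  [set f | bochner_measurable mu f /\ koethe_mem E (fun t => `|f t|)].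

Definition kb_norm f : R := koethe_norm E (fun t => `|f t|).

Lemma kb_mem0 : kb_mem 0.
Proof.
split; first exact/simple_bochner_measurable/simple_function_cst.
rewrite (_ : (fun _ => _) = 0); first exact: koethe_mem0.
by apply/funext => t /=; rewrite normr0.
Qed.

Lemma kb_dominated f (g : T -> R) : bochner_measurable mu f -> koethe_mem E g ->
  {ae mu, forall t, `|f t| <= g t} -> kb_mem f /\ kb_norm f <= koethe_norm E g.
Proof.
move=> mf Eg fg.
have [|? ?] := koethe_ideal Eg (bochner_measurable_norm cmu mf); last by split.
by apply: filterS fg => t; rewrite normr_id => /le_trans; apply; exact: ler_norm.
Qed.

Let normL a f g t : `|(a *: f + g) t| <= (`|a| *: (fun t => `|f t|) + (fun t => `|g t|)) t.
Proof. by rewrite !fctE; apply: le_trans (ler_normD _ _) _; rewrite normrZ. Qed.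

Lemma kb_memL a f g : kb_mem f -> kb_mem g -> kb_mem (a *: f + g).
Proof.
move=> [mf Ef] [mg Eg].
apply: (kb_dominated (bochner_measurableL _ mf mg) (koethe_memL `|a| Ef Eg) _).1.
by apply: aeW => t; exact: normL.
Qed.

Lemma kb_normD f g : kb_mem f -> kb_mem g -> kb_norm (f + g) <= kb_norm f + kb_norm g.
Proof.
move=> [mf Ef] [mg Eg]; rewrite -[f]scale1r.
have := bochner_measurableL 1 mf mg => mfg.
apply: le_trans (kb_dominated mfg (koethe_memL `|1| Ef Eg) _).2 _.
  by apply: aeW => t; exact: normL.
by rewrite normr1 !scale1r koethe_normD.
Qed.

Lemma kb_normZ a f : kb_mem f -> kb_norm (a *: f) = `|a| * kb_norm f.
Proof.
move=> [mf Ef]; rewrite -[in RHS](normr_id a) -koethe_normZ//.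
by congr koethe_norm; apply/funext => t; rewrite /= !fctE normrZ.
Qed.

Lemma kb_norm_ae f g : kb_mem f -> kb_mem g -> {ae mu, forall t, f t = g t} ->
  kb_norm f = kb_norm g.
Proof.
move=> [mf Ef] [mg Eg] fg; apply: koethe_norm_ae => //.
by apply: filterS fg => t ->.
Qed.

Lemma kb_norm_eq0 f : kb_mem f -> kb_norm f = 0 -> {ae mu, forall t, f t = 0}.
Proof.
move=> [_ Ef] /(koethe_norm_eq0 Ef).
by apply: filterS => t /eqP; rewrite normr_eq0 => /eqP.
Qed.

Definition kb_fun_space : fun_space mu X := {|
  fs_mem0 := kb_mem0 ;
  fs_memL := kb_memL ;
  fs_normD := kb_normD ;
  fs_normZ := kb_normZ ;
  fs_norm_ae := kb_norm_ae ;
  fs_norm_eq0 := kb_norm_eq0 |}.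

Definition koethe_bochner : Type := ae_quot kb_fun_space.
HB.instance Definition _ := NormedModule.on koethe_bochner.

End normed.

Section complete.
Context (X : completeNormedModType R).

Let kb_cauchy_cvg : forall G : set_system (koethe_bochner X),
  ProperFilter G -> cauchy G -> cvg G.
Proof.
apply: ae_quot_complete => u Eu uc.
have {}Eu n : kb_mem (u n) by exact: Eu.
have {}uc n : kb_norm (u n.+1 - u n) <= 2 ^- n by exact: uc.
pose h n : T -> R := fun t => `|u n.+1 t - u n t|.
have Eh n : koethe_mem E (h n).
  have [] : kb_mem (u n.+1 - u n) by rewrite addrC -scaleN1r; exact: kb_memL.
  by [].
pose s : nat -> T -> R := fix s n := if n is m.+1 then h m + s m else 0.
have Es n : koethe_mem E (s n).
  elim: n => [|n IH]; first exact: koethe_mem0.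
  by rewrite /= -[h n]scale1r; exact: koethe_memL.
have s_ndec t : {homo (fun n => s n t) : m n / (m <= n)%N >-> m <= n}.
  apply: homo_leq => [x|y x z|n]; [exact: lexx|exact: le_trans|].
  by rewrite /= !fctE lerDr normr_ge0.
have su t m n : (m <= n)%N -> `|u n t - u m t| <= s n t - s m t.
  elim: n => [|n IH]; first by rewrite leqn0 => /eqP ->; rewrite !subrr normr0.
  rewrite leq_eqVlt ltnS => /orP[/eqP ->|/IH {}IH]; first by rewrite !subrr normr0.
  rewrite -[u n.+1 t](subrK (u n t)) -addrA; apply: le_trans (ler_normD _ _) _.
  by rewrite /= !fctE -addrA lerD.
have [|g Eg sg] := koethe_complete_geo Es.
  by move=> n; rewrite /= addrK; exact: uc.
have Esg n : koethe_mem E (s n - g).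
  by rewrite addrC -scaleN1r; exact: koethe_memL.
have sle : {ae mu, forall t, forall n, s n t <= g t}.
  apply: ae_foralln => n.
  pose w : T -> R := fun t => Num.max 0 (s n t - g t).
  have wle m : (n <= m)%N -> koethe_mem E w /\ koethe_norm E w <= koethe_norm E (s m - g).
    move=> nm; apply: koethe_ideal => //.
      apply: measurable_maxr => //; apply: measurable_funB.
        exact: koethe_measurable (Es n).
      exact: koethe_measurable Eg.
    apply: aeW => t; rewrite ger0_norm ?le_max ?lexx// ge_max normr_ge0/=.
    by apply: le_trans (ler_norm _); rewrite lerD2r s_ndec.
  have [Ew _] := wle n (leqnn n).
  have w0 : koethe_norm E w = 0.
    apply/eqP; rewrite eq_le koethe_norm_ge0// andbT.
    apply: (cvgr_to_ge sg); near=> m.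
    by apply: (wle m _).2; near: m; exact: nbhs_infty_ge.
  apply: filterS (koethe_norm_eq0 Ew w0) => t.
  by rewrite /w -subr_le0 => <-; rewrite le_max lexx orbT.
have ucvg : {ae mu, forall t, u n t @[n --> \oo] --> lim (u n t @[n --> \oo])}.
  apply: filterS sle => t sg_t.
  have scvg : cvgn (fun n => s n t).
    apply: nondecreasing_is_cvgn; first exact: s_ndec.
    by exists (g t) => _ [n _ <-].
  apply: cauchy_cvg; apply: (@cauchy_exP R X) => e e0.
  have /cvgrPdist_lt/(_ _ e0)/filter_ex[n /= sn] := scvg.
  exists (u n t); exists n => // m /= nm; rewrite -ball_normE/= distrC.
  apply: le_lt_trans (su _ _ _ nm) _; apply: le_lt_trans sn.
  apply: le_trans (ler_norm _); rewrite lerD2r.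
  exact: (nondecreasing_cvgn_le (s_ndec t) scvg).
pose f : T -> X := fun t => lim (u n t @[n --> \oo]).
have mf : bochner_measurable mu f.
  by apply: bochner_measurable_cvg ucvg => // n; exact: (Eu n).1.
have ufle n : {ae mu, forall t, `|(u n - f) t| <= (g - s n) t}.
  apply: filterS2 sle ucvg => t sg_t ut; rewrite !fctE.
  apply: (@cvgr_to_le _ \oo _ R (fun m => `|u n t - u m t|)).
    by apply: cvg_norm; apply: cvgB; [exact: cvg_cst|exact: ut].
  near=> m; rewrite distrC; apply: le_trans (su t n m _) _.
    by near: m; exact: nbhs_infty_ge.
  by rewrite lerD2r.
have muf n : bochner_measurable mu (u n - f).
  rewrite addrC -scaleN1r; apply: bochner_measurableL => //.
  exact: (Eu n).1.
have Egs n : koethe_mem E (g - s n) by rewrite addrC -scaleN1r; exact: koethe_memL.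
have Nle n : kb_mem (u n - f) /\ kb_norm (u n - f) <= koethe_norm E (s n - g).
  have [? le] := kb_dominated (muf n) (Egs n) (ufle n); split => //.
  rewrite (_ : koethe_norm E (s n - g) = koethe_norm E (g - s n))//.
  by rewrite -opprB -scaleN1r koethe_normZ// normrN1 mul1r.
exists f.
  rewrite -[f](subKr (u 0%N)) addrC -scaleN1r; apply: kb_memL; last exact: Eu.
  exact: (Nle 0%N).1.
apply: (squeeze_cvgr _ (cvg_cst 0) sg); apply: nearW => n.
by rewrite (Nle n).2 andbT; apply: koethe_norm_ge0; exact: (Nle n).1.2.
Unshelve. all: by end_near. Qed.

HB.instance Definition _ :=
  Uniform_isComplete.Build (koethe_bochner X) kb_cauchy_cvg.
End complete.
End koethe_bochner.

(* Main.v *)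
Require Import Defs.
From HB Require Import structures.
From mathcomp Require Import all_boot all_order all_algebra.
From mathcomp Require Import ring lra.
From mathcomp Require Import all_classical all_reals all_analysis.
From mathcomp Require Import measurable_realfun.

Set Implicit Arguments.
Unset Strict Implicit.
Unset Printing Implicit Defensive.

Import Order.TTheory GRing.Theory Num.Theory.
Import numFieldNormedType.Exports.
Local Open Scope classical_set_scope.
Local Open Scope ring_scope.

(** Let [phi] be a functional of norm one on [E(X)], and let [f_n] and [g_n] be unit
    vectors with [|f_n + g_n| -> 2] and [phi f_n -> 1].

    The first step represents [phi] by an integral. A reflexive Koethe space has an
    order continuous norm ([koethe_decreasing_cvg0]): otherwise a positive functional
    would stay away from zero along a decreasing null sequence, hence at its weak
    limit, which order forces to be nonpositive. Fix a strictly positive [u] in [E].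
    By order continuity the variation [lam] of [phi] over the functions dominated by
    [u] is a finite measure, and for each [x] the set function
    [A |-> phi (1_A u x)] is a charge with a density. For countably many vectors
    these densities are values of functionals [F t] of norm at most one, by Helly's
    condition, so that [phi f = \int F t (f t) / u t] for countably many prescribed
    functions [f] ([kb_functional_representation]). Moreover
    [Lam a = \int a / u] is a functional of norm at most one on [E]
    ([koethe_integrable_variation], [exists_weighted_dual]).

    From [phi f_n <= Lam |f_n| <= 1] and the wuacs property of [E] it follows that
    [Lam |g_n| -> 1] and [Lam |f_n + g_n| -> 2] ([koethe_wuacs_sum]), where the norms
    are taken pointwise. Weak compactness and the Kadets-Klee property give a
    subsequence along which [|f_n| -> A] and [|g_n| -> B] in the norm of [E]
    ([kadets_klee_subseq]). The nonnegative functions [|f_n| + |g_n| - |f_n + g_n|]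
    and [|f_n| - F (f_n)], divided by [u], have integrals tending to zero, so along
    a further subsequence, at almost every [t], [|f_n t| -> A t], [|g_n t| -> B t],
    [|f_n t + g_n t| -> A t + B t] and [F t (f_n t) -> A t]. If [A t > 0], the
    wuacs property of [X], freed from the normalization of the vectors
    ([wuacs_cvg]), yields [F t (g_n t) -> B t]. If [A t = 0], the same limit holds
    because [B t = 0]: reversing the sign of [Lam] where [A] is zero does not
    change its value at [A], so by the wuacs property of [E] it does not change its
    value at [B] either. Dominated convergence gives [phi g_n -> Lam B = 1]
    ([kb_wuacs_subseq]), and since this works inside every subsequence, the whole
    sequence converges. *)

(** * Sublinear functionals and the Mazur-Orlicz theorem *)

Section sublinear.
Context (R : realType) (V : lmodType R).
Implicit Types p q : V -> R.

Definition sublinear p :=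
  (forall x y, p (x + y) <= p x + p y) /\
  (forall a x, 0 <= a -> p (a *: x) = a * p x).

Lemma weight_sum_ge0 (I : Type) (c : seq (R * I)) :
  all (fun ai => 0 <= ai.1) c -> 0 <= \sum_(ai <- c) ai.1.
Proof.
elim: c => [|ai c IH] /=; first by rewrite big_nil.
by rewrite big_cons => /andP[ai0 /IH c0]; rewrite addr_ge0.
Qed.

Lemma sublinear0 p : sublinear p -> p 0 = 0.
Proof. by move=> [_ /(_ 0 0 (lexx _))]; rewrite scale0r mul0r. Qed.

Lemma sublinear_ge p x : sublinear p -> - p (- x) <= p x.
Proof.
by move=> sp; have := sp.1 x (- x); rewrite subrr sublinear0//; lra.
Qed.

(** Covers both the infima of chains in Zorn's lemma and the infimal
    construction of [sublinear_below]: in the closure conditions the index [k]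
    may depend on the points, and [b] keeps the infima finite. *)
Lemma sublinear_inf (J : Type) (S : set J) (q : J -> V -> R) (b : V -> R) :
  S !=set0 -> 0 <= b 0 -> (forall j x, S j -> b x <= q j x) ->
  (forall i j x y, S i -> S j -> exists2 k, S k & q k (x + y) <= q i x + q j y) ->
  (forall a j x, 0 < a -> S j -> exists2 k, S k & q k (a *: x) <= a * q j x) ->
  sublinear (fun x => inf [set q j x | j in S]) /\
  (forall j x, S j -> inf [set q j x | j in S] <= q j x).
Proof.
move=> [j0 Sj0] b0 bq qD qZ; pose m x := inf [set q j x | j in S].
have lbm x : has_lbound [set q j x | j in S].
  by exists (b x) => _ [j Sj <-]; exact: bq.
have mq j x : S j -> m x <= q j x by move=> Sj; apply: ge_inf => //; exists j.
have mne x : [set q j x | j in S] !=set0 by exists (q j0 x), j0.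
have mlt x e : 0 < e -> exists2 j, S j & q j x < m x + e.
  by move=> /inf_adherent/(_ (conj (mne x) (lbm x)))[_ [j Sj <-]]; exists j.
have mZ a x : 0 < a -> m (a *: x) <= a * m x.
  move=> a0; apply/ler_addgt0Pr => e e0.
  have [j Sj qm] := mlt x (e / a) (divr_gt0 e0 a0).
  have [k Sk qk] := qZ a j x a0 Sj.
  apply: le_trans (mq k _ Sk) (le_trans qk _).
  by rewrite -(@ler_pdivlMl _ a)// mulrDr mulrA mulVf ?gt_eqF// mul1r mulrC ltW.
split; last by [].
split=> [x y|a x].
  apply/ler_addgt0Pr => e e0; have e2 : 0 < e / 2 by rewrite divr_gt0.
  have [i Si qi] := mlt x _ e2; have [j Sj qj] := mlt y _ e2.
  have [k Sk qk] := qD i j x y Si Sj.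
  by have := mq k (x + y) Sk; rewrite /m in qi qj *; lra.
rewrite le_eqVlt => /orP[/eqP <-|a0].
  rewrite scale0r mul0r; apply/eqP; rewrite eq_le; apply/andP; split.
    by have := mZ 2^-1 0; rewrite scaler0 invr_gt0 => /(_ ltac:(lra)); rewrite /m; lra.
  apply: lb_le_inf => // _ [j Sj <-]; exact: le_trans (bq j 0 Sj).
apply/eqP; rewrite eq_le mZ//=.
have := mZ a^-1 (a *: x); rewrite invr_gt0 => /(_ a0).
by rewrite scalerA mulVf ?gt_eqF// scale1r ler_pdivlMl.
Qed.

(** Zorn's lemma: the members of a chain below [p] all stay above
    [x |-> - p (- x)], so their infimum is finite, and it is subadditive because
    the chain is totally ordered. *)
Lemma exists_minimal_sublinear p : sublinear p ->
  exists m, [/\ sublinear m, forall x, m x <= p x &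
    forall q, sublinear q -> (forall x, q x <= m x) -> q = m].
Proof.
move=> sp; pose S := {q : V -> R | sublinear q /\ forall x, q x <= p x}.
pose le (s t : S) := `[< forall x, sval t x <= sval s x >].
have [| | |A totA|[m [sm mp]] mmin] := @Zorn S le.
- by move=> s; apply/asboolP.
- move=> r s t /asboolP rs /asboolP st; apply/asboolP => x.
  exact: le_trans (rs x).
- move=> [s Ps] [t Pt] /asboolP /= st /asboolP /= ts; apply/eq_exist/funext => x.
  by apply/eqP; rewrite eq_le st ts.
- have [/eqP A0|/set0P A0] := boolP (A == set0).
    by exists (exist _ p (conj sp (fun x => lexx _))) => s; rewrite A0.
  have [| | | |sm mle] := @sublinear_inf S A (fun s => sval s) (fun x => - p (- x)) A0.
  + by rewrite oppr0 sublinear0 ?oppr0.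
  + move=> [q [sq qp]] x _ /=; apply: le_trans (sublinear_ge x sq).
    by rewrite lerN2.
  + move=> s t x y As At; have [/asboolP st|/asboolP ts] := totA s t As At.
      exists t => //; apply: le_trans ((svalP t).1.1 _ _) _; exact: lerD.
    exists s => //; apply: le_trans ((svalP s).1.1 _ _) _; exact: lerD.
  + by move=> a s x a0 As; exists s => //; rewrite (svalP s).1.2// ltW.
  set m := (fun x => inf _) in sm mle.
  have mp x : m x <= p x.
    by have [s As] := A0; apply: le_trans (mle s x As) _; exact: (svalP s).2.
  by exists (exist _ m (conj sm mp)) => s As; apply/asboolP => x; exact: mle.
exists m; split => // q sq qm.
have qp x : q x <= p x by exact: le_trans (mp x).
have /mmin : le (exist _ m (conj sm mp)) (exist _ q (conj sq qp)).
  exact/asboolP.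
by move=> [].
Qed.

(** Take for [q x] the infimum of [p (x + \sum c_i d_i) - \sum c_i r_i] over
    nonnegative coefficients [c]; the hypothesis on [p], [d] and [r] says that it
    is at least [- p (- x)]. *)
Lemma sublinear_below (I : Type) (p : V -> R) (d : I -> V) (r : I -> R) :
  sublinear p ->
  (forall c : seq (R * I), all (fun ai => 0 <= ai.1) c ->
    \sum_(ai <- c) ai.1 * r ai.2 <= p (\sum_(ai <- c) ai.1 *: d ai.2)) ->
  exists q, [/\ sublinear q, forall x, q x <= p x & forall i, q (- d i) <= - r i].
Proof.
move=> sp H.
have [| | | | |sm mle] := @sublinear_inf (seq (R * I)) [set c | all (fun ai => 0 <= ai.1) c]
  (fun c x => p (x + \sum_(ai <- c) ai.1 *: d ai.2) - \sum_(ai <- c) ai.1 * r ai.2)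
  (fun x => - p (- x)).
- by exists [::].
- by rewrite oppr0 sublinear0 ?oppr0.
- move=> c x /= c0; have := H _ c0.
  have := sp.1 (- x) (x + \sum_(ai <- c) ai.1 *: d ai.2).
  by rewrite addrA addNr add0r; lra.
- move=> c e x y c0 e0; exists (c ++ e); first by rewrite /= all_cat; apply/andP.
  rewrite !big_cat/= opprD addrACA; apply: le_trans (lerD (sp.1 _ _) (lexx _)) _.
  by lra.
- move=> a c x a0 c0; exists [seq (a * ai.1, ai.2) | ai <- c].
    by rewrite /= all_map; apply: sub_all c0 => ai /= ?; rewrite mulr_ge0// ltW.
  rewrite !big_map/=; under eq_bigr do rewrite -scalerA.
  under [X in _ - X <= _]eq_bigr do rewrite -mulrA.
  rewrite -scaler_sumr -mulr_sumr -scalerDr sp.2; last exact: ltW.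
  by rewrite mulrBr.
exists (fun x => inf [set p (x + \sum_(ai <- c) ai.1 *: d ai.2) - \sum_(ai <- c) ai.1 * r ai.2
  | c in [set c : seq (R * I) | all (fun ai => 0 <= ai.1) c]]).
split => //.
  by move=> x; apply: le_trans (mle [::] x isT) _; rewrite !big_nil addr0 subr0.
move=> i; have := mle [:: (1, i)] (- d i); rewrite /= ler01 => /(_ isT).
by rewrite !big_seq1/= scale1r mul1r addNr sublinear0// add0r.
Qed.

(** A minimal sublinear functional [m] is linear: by [sublinear_below] with the
    single constraint given by [x] and [m x], some sublinear functional below [m]
    takes a value at most [- m x] at [- x], and minimality identifies it with [m].
    Every use of the Hahn-Banach theorem below is an instance of this result. *)
Lemma mazur_orlicz (I : Type) (p : V -> R) (d : I -> V) (r : I -> R) :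
  sublinear p ->
  (forall c : seq (R * I), all (fun ai => 0 <= ai.1) c ->
    \sum_(ai <- c) ai.1 * r ai.2 <= p (\sum_(ai <- c) ai.1 *: d ai.2)) ->
  exists l : V -> R, [/\ scalar l, forall x, l x <= p x & forall i, r i <= l (d i)].
Proof.
move=> sp /(sublinear_below sp)[q [sq qp qr]].
have [m [sm mq mmin]] := exists_minimal_sublinear sq.
have mN x : m (- x) = - m x.
  have [|q' [sq' q'm]] := @sublinear_below unit m (fun=> x) (fun=> m x) sm.
    move=> c c0; rewrite -scaler_suml -mulr_suml sm.2//.
    exact: weight_sum_ge0.
  rewrite (mmin _ sq' q'm) => /(_ tt) mNx.
  by have := sublinear_ge x sm; lra.
exists m; split.
- move=> a x y.
  have mD u v : m (u + v) = m u + m v.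
    have := sm.1 u v; have := sm.1 (- u) (- v).
    by rewrite -opprD !mN; lra.
  rewrite mD; congr (_ + _); have [a0|a0] := lerP 0 a; first exact: sm.2.
  by rewrite -[a]opprK scaleNr mN sm.2 ?mulNr//; lra.
- by move=> x; exact: le_trans (qp x).
- by move=> i; have := mq (- d i); have := qr i; rewrite mN; lra.
Qed.
End sublinear.

(** * Subsequences, functionals, and the wuacs property for non-normalized sequences *)

Section subsequences.
Context (R : realType).

(** Subsequences are encoded by maps [k] with [n <= k n]: this suffices to
    pass to the limit and is stable under composition. *)
Lemma cvg_subseq (Y : topologicalType) (u : nat -> Y) (k : nat -> nat) (F : set_system Y) :
  (forall n, (n <= k n)%N) -> u @ \oo --> F -> (u \o k) @ \oo --> F.
Proof.
move=> kn; apply: cvg_comp => A [N _ NA]; exists N => // n /= Nn.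
by apply: NA => /=; exact: leq_trans (kn n).
Qed.

Lemma not_cvg_subseq (u : nat -> R) (l : R) : ~ (u @ \oo --> l) ->
  exists (e : R) (k : nat -> nat),
    [/\ 0 < e, forall n, (n <= k n)%N & forall n, e <= `|u (k n) - l|].
Proof.
move=> nu; have /existsNP[e /not_implyP[e0 ne]] :
    ~ forall e, 0 < e -> \forall n \near \oo, `|u n - l| < e.
  by apply: contra_not nu => H; apply/cvgrPdist_lt => e /H; apply: filterS => n; rewrite distrC.
have /choice[k kP] (n : nat) : exists m, (n <= m)%N /\ e <= `|u m - l|.
  apply: contra_notP ne => /forallNP H; exists n => // m /= nm.
  by rewrite ltNge; apply/negP => em; exact: (H m).
by exists e, k; split => // n; have [] := kP n.
Qed.

Lemma cvg_subseqP (u : nat -> R) (l : R) :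
  (forall k, (forall n, (n <= k n)%N) ->
    exists2 j, (forall n, (n <= j n)%N) & (u \o k \o j) @ \oo --> l) ->
  u @ \oo --> l.
Proof.
move=> H; apply: contrapT => /not_cvg_subseq[e [k [e0 kn ke]]].
have [j _ /cvgrPdist_lt/(_ e e0)/filter_ex[n /=]] := H k kn.
by rewrite distrC ltNge ke.
Qed.

End subsequences.

Section dual_functionals.
Context (R : realType) (V : normedModType R).
Implicit Types phi : dual_space V.

Lemma dual_ler phi x : `|phi x| <= `|phi| * `|x|.
Proof.
have [->|x0] := eqVneq x 0; first by rewrite dual0 !normr0 mulr0.
have nx : 0 < `|x| by rewrite normr_gt0.
have := dual_norm_ge phi (x := `|x|^-1 *: x).
rewrite dualZ normrZ normrM normfV normr_id mulVf ?gt_eqF// => /(_ (lexx _)).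
by rewrite mulrC ler_pdivrMr.
Qed.

Lemma dual_ler1 phi x : `|phi| <= 1 -> `|phi x| <= `|x|.
Proof.
by move=> p1; apply: le_trans (dual_ler _ _) _; rewrite -[leRHS]mul1r ler_wpM2r.
Qed.

Lemma dualD phi x y : phi (x + y) = phi x + phi y.
Proof. by rewrite -[x]scale1r dual_linear scale1r mul1r. Qed.

Lemma dualN phi x : phi (- x) = - phi x.
Proof. by rewrite -scaleN1r dualZ mulN1r. Qed.

Lemma dualB phi x y : phi (x - y) = phi x - phi y.
Proof. by rewrite dualD dualN. Qed.

Lemma exists_dual (l : V -> R) M : 0 <= M -> scalar l ->
  (forall x, l x <= M * `|x|) ->
  exists phi, (forall x, phi x = l x) /\ `|phi| <= M.
Proof.
move=> M0 sl lM.
pose f : {linear V -> R} := HB.pack l (GRing.isLinear.Build R V R *%R l sl).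
have lM' x : `|l x| <= M * `|x|.
  rewrite ler_norml lM andbT lerNl.
  have lN : l (- x) = - l x := linearN f x.
  by have := lM (- x); rewrite lN normrN.
have cl : continuous l.
  apply: (@bounded_linear_continuous R V R f); apply/bounded_funP => r.
  exists (M * r) => x xr; apply: le_trans (lM' x) _.
  exact: ler_wpM2l.
have lP : is_dual l by apply/asboolP.
exists (DualSpace lP); split => //.
apply: dual_norm_le => x x1; apply: le_trans (lM' x) _.
by rewrite -[leRHS]mulr1 ler_wpM2l.
Qed.

Lemma normed_sublinear : sublinear (fun x : V => `|x|).
Proof.
by split=> [x y|a x a0]; [exact: ler_normD|rewrite normrZ ger0_norm].
Qed.

(** Helly's condition for prescribing the values of a functional of norm at
    most one. An equality is a pair of opposite inequalities, which the boolean
    added to the index tells apart. *)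
Lemma exists_dual_interpolation (I : Type) (d : I -> V) (r : I -> R) :
  (forall c : seq (R * I),
    \sum_(ai <- c) ai.1 * r ai.2 <= `|\sum_(ai <- c) ai.1 *: d ai.2|) ->
  exists phi, `|phi| <= 1 /\ forall i, phi (d i) = r i.
Proof.
move=> H; pose sg (b : bool) : R := if b then 1 else -1.
have [|l [sl ln lr]] := @mazur_orlicz R V (I * bool) (fun x => `|x|)
    (fun ib => sg ib.2 *: d ib.1) (fun ib => sg ib.2 * r ib.1) normed_sublinear.
  move=> c _; have := H [seq (ai.1 * sg ai.2.2, ai.2.1) | ai <- c].
  rewrite !big_map/=; under eq_bigr do rewrite -mulrA.
  by under [X in _ <= `|X| -> _]eq_bigr do rewrite -scalerA.
have [x|phi [phil phi1]] := exists_dual ler01 sl; first by rewrite mul1r.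
exists phi; split => // i; rewrite phil.
have lN : l (- d i) = - l (d i) by rewrite -!phil dualN.
have := lr (i, true); have := lr (i, false); rewrite /= /sg !scaleN1r !scale1r lN.
by move=> ? ?; apply/eqP; rewrite eq_le; lra.
Qed.

Lemma exists_norming_dual x : exists phi, `|phi| <= 1 /\ phi x = `|x|.
Proof.
have [c|phi [phi1 /(_ tt) phix]] :=
    @exists_dual_interpolation unit (fun=> x) (fun=> `|x|).
  by rewrite -scaler_suml -mulr_suml normrZ ler_wpM2r// ler_norm.
by exists phi.
Qed.

(** By density, a family of norm inequalities indexed by real coefficients
    reduces to countably many of them. *)
Lemma rational_combination (I : Type) (d : I -> V) (c : seq (R * I)) (e : R) :
  0 < e -> exists q : seq (rat * I),
  `|\sum_(ai <- c) ai.1 *: d ai.2 - \sum_(ai <- q) ratr ai.1 *: d ai.2| < e.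
Proof.
elim: c e => [|[a i] c IH] e e0.
  by exists [::]; rewrite !big_nil subrr normr0.
have e2 : 0 < e / 2 by rewrite divr_gt0.
have [q qc] := IH _ e2.
have d1 : 0 < `|d i| + 1 by rewrite ltr_wpDl.
have [b /andP[ab ba]] : exists b : rat, a < ratr b < a + e / 2 / (`|d i| + 1).
  have aa : a < a + e / 2 / (`|d i| + 1) by rewrite ltrDl divr_gt0.
  by have [b] := rat_in_itvoo aa; rewrite in_itv; exists b.
exists ((b, i) :: q); rewrite !big_cons/= opprD addrACA -scalerBl.
apply: le_lt_trans (ler_normD _ _) _; rewrite (splitr e).
apply: ler_ltD => //; rewrite normrZ distrC gtr0_norm ?subr_gt0//.
have : ratr b - a <= e / 2 / (`|d i| + 1) by lra.
rewrite ler_pdivlMr// => ?; apply: le_trans (ler_wpM2l _ _) _; last by eassumption.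
  by rewrite subr_ge0 ltW.
by rewrite lerDl.
Qed.

End dual_functionals.

Section wuacs_general.
Context (R : realType) (V : normedModType R).
Implicit Types phi : dual_space V.

(** If [|x| <= |y|] and [z] is the sum of the normalized vectors, then
    [x + y = |x| z + (|y| - |x|) (y / |y|)]; bounding the norm of the right-hand
    side gives the estimate. *)
Lemma normalized_sum_ge (x y : V) : x != 0 -> y != 0 ->
  2 - (`|x| + `|y| - `|x + y|) * (`|x|^-1 + `|y|^-1) <=
  `| `|x|^-1 *: x + `|y|^-1 *: y |.
Proof.
wlog xy : x y / `|x| <= `|y|.
  move=> W x0 y0; have [|/ltW] := leP `|x| `|y|; first by move=> ?; exact: W.
  by move=> ?; rewrite (addrC x) (addrC `|x|) (addrC `|x|^-1) (addrC (_ *: x)); exact: W.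
move=> x0 y0; have px : 0 < `|x| by rewrite normr_gt0.
have py : 0 < `|y| by rewrite normr_gt0.
set z := (X in _ <= `|X|).
have xyE : x + y = `|x| *: z + (`|y| - `|x|) *: (`|y|^-1 *: y).
  rewrite /z scalerDr scalerBl !scalerA !mulfV ?gt_eqF// !scale1r.
  by rewrite -addrA; congr (_ + _); rewrite addrCA subrr addr0.
have H : `|x + y| <= `|x| * `|z| + (`|y| - `|x|).
  rewrite xyE; apply: le_trans (ler_normD _ _) _.
  rewrite !normrZ normfV !normr_id mulVf ?gt_eqF// mulr1.
  by rewrite (@ger0_norm _ (_ - _)) ?subr_ge0.
have s0 : 0 <= `|x| + `|y| - `|x + y| by rewrite subr_ge0 ler_normD.
apply: (@le_trans _ _ (2 - (`|x| + `|y| - `|x + y|) * `|x|^-1)).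
  by rewrite lerD2l lerN2 ler_wpM2l// lerDl invr_ge0.
rewrite -(ler_pM2l px) mulrBr mulrCA mulfV ?gt_eqF//.
by lra.
Qed.

Lemma cvg_normalized_sum (x y : V ^nat) (a b : R) : 0 < a -> 0 < b ->
  `|x n| @[n --> \oo] --> a -> `|y n| @[n --> \oo] --> b ->
  `|x n + y n| @[n --> \oo] --> a + b ->
  `| `|x n|^-1 *: x n + `|y n|^-1 *: y n| @[n --> \oo] --> (2 : R).
Proof.
move=> a0 b0 xa yb xyab.
have xn0 : \forall n \near \oo, 0 < `|x n| by exact: (cvgr_gt _ xa).
have yn0 : \forall n \near \oo, 0 < `|y n| by exact: (cvgr_gt _ yb).
pose w n := 2 - (`|x n| + `|y n| - `|x n + y n|) * (`|x n|^-1 + `|y n|^-1).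
have w2 : w n @[n --> \oo] --> (2 : R).
  rewrite -[X in _ --> X]subr0 -[X in _ - X](mul0r (a^-1 + b^-1)) -(subrr (a + b)).
  apply: cvgB; first exact: cvg_cst.
  apply: cvgM; first by apply: cvgB => //; exact: cvgD.
  by apply: cvgD; apply: cvgV => //; rewrite gt_eqF.
apply: (squeeze_cvgr _ w2 (h := fun=> 2)); last exact: cvg_cst.
near=> n.
have nx : 0 < `|x n| by near: n.
have ny : 0 < `|y n| by near: n.
rewrite normalized_sum_ge ?(normr_gt0 _, andbT) -?normr_gt0//=.
apply: le_trans (ler_normD _ _) _.
by rewrite !normrZ !normfV !normr_id !mulVf ?gt_eqF.
Unshelve. all: by end_near. Qed.

(** Normalization reduces convergent norms to unit vectors, by
    [cvg_normalized_sum]; a limit norm [b = 0] is settled by [|phi (y n)| <= |y n|]. *)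
Lemma wuacs_cvg (x y : V ^nat) phi (a b : R) : wuacs V -> 0 < a -> 0 <= b ->
  `|phi| <= 1 ->
  `|x n| @[n --> \oo] --> a -> `|y n| @[n --> \oo] --> b ->
  `|x n + y n| @[n --> \oo] --> a + b ->
  phi (x n) @[n --> \oo] --> a -> phi (y n) @[n --> \oo] --> b.
Proof.
move=> WV a0; rewrite le_eqVlt => /orP[/eqP <-|b0] phi1 xa yb xyab phia.
  apply/norm_cvg0P; apply: (squeeze_cvgr _ (cvg_cst 0) yb).
  by apply: nearW => n; rewrite normr_ge0 dual_ler1.
have xn0 : \forall n \near \oo, 0 < `|x n| by exact: (cvgr_gt _ xa).
have yn0 : \forall n \near \oo, 0 < `|y n| by exact: (cvgr_gt _ yb).
have [n0 /= xn00] := filter_ex xn0.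
(* Any unit vector may replace the normalization of zero. *)
pose nz (z : V) : V := if z == 0 then `|x n0|^-1 *: x n0 else `|z|^-1 *: z.
have nz1 (z : V) : `|nz z| = 1.
  rewrite /nz; case: eqVneq => [_|z0]; rewrite normrZ normfV normr_id mulVf//.
    by rewrite gt_eqF.
  by rewrite normr_eq0.
have nzE (z : V) : 0 < `|z| -> nz z = `|z|^-1 *: z.
  by rewrite normr_gt0 /nz => /negbTE ->.
have pc (z : V ^nat) (l : R) : 0 < l -> `|z n| @[n --> \oo] --> l ->
    phi (z n) @[n --> \oo] --> l -> phi (nz (z n)) @[n --> \oo] --> (1 : R).
  move=> l0 zl pl.
  have zn0 : \forall n \near \oo, 0 < `|z n| by exact: (cvgr_gt _ zl).
  have : `|z n|^-1 * phi (z n) @[n --> \oo] --> l^-1 * l.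
    by apply: cvgM => //; apply: cvgV => //; rewrite gt_eqF.
  rewrite mulVf ?gt_eqF//; apply: cvg_trans; apply: near_eq_cvg.
  by apply: filterS zn0 => n zn; rewrite nzE// dualZ.
have phix := pc _ _ a0 xa phia.
have phi1' : `|phi| = 1.
  apply/eqP; rewrite eq_le phi1/=.
  apply: (cvgr_to_le phix); apply: nearW => n.
  by apply: le_trans (ler_norm _) _; apply: le_trans (dual_ler _ _) _; rewrite nz1 mulr1.
have := WV (nz \o x) (nz \o y) phi (fun n => nz1 _) (fun n => nz1 _) phi1'.
have xy2 : `|nz (x n) + nz (y n)| @[n --> \oo] --> (2 : R).
  have := cvg_normalized_sum a0 b0 xa yb xyab.
  apply: cvg_trans; apply: near_eq_cvg.
  by apply: filterS2 xn0 yn0 => n xn yn; rewrite !nzE.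
move=> /(_ xy2 phix) phiy.
have : `|y n| * phi (nz (y n)) @[n --> \oo] --> b * 1 by exact: cvgM.
rewrite mulr1; apply: cvg_trans; apply: near_eq_cvg.
apply: filterS yn0 => n yn; rewrite nzE// dualZ mulrA mulfV ?gt_eqF//.
by rewrite mul1r.
Qed.

End wuacs_general.

(** * Weak sequential compactness in reflexive spaces *)

Section weak_compactness.
Context (R : realType).

Lemma ultra_cvg_bounded (U : set_system nat) (u : nat -> R) (M : R) :
  UltraFilter U -> (forall n, `|u n| <= M) -> exists l : R, u @ U --> l.
Proof.
move=> UU uM.
have [|l [_ cl]] := @segment_compact R (- M) M (u @ U) _.
  by apply: (@filterE _ U) => n; rewrite /= in_itv/= -ler_norml.
exists l => B Bl; have [//|UnB] := in_ultra_setVsetC (u @^-1` B) UU.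
by have [z [/= nBz Bz]] := cl (~` B) B UnB Bl.
Qed.

(** The limits of [phi (x n)] along an ultrafilter define a bounded functional
    of [phi], which reflexivity represents by a vector [z]. *)
Lemma reflexive_cluster (V : normedModType R) (x : V ^nat) (M : R) :
  reflexive_space V -> (forall n, `|x n| <= M) ->
  exists (U : set_system nat) (z : V), [/\ ProperFilter U, \oo `<=` U &
    forall phi : dual_space V, phi (x n) @[n --> U] --> phi z].
Proof.
move=> refV xM; have M0 : 0 <= M by exact: le_trans (xM 0%N).
have [U [UU ooU]] := @ultraFilterLemma nat \oo _.
have FU : ProperFilter U := @ultra_proper _ _ UU.
have /choice[L LP] (phi : dual_space V) : exists l : R, phi (x n) @[n --> U] --> l.
  apply: (@ultra_cvg_bounded _ _ (`|phi| * M)) => n.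
  by apply: le_trans (dual_ler _ _) _; rewrite ler_wpM2l.
have sL : scalar L.
  move=> a phi psi.
  apply: (cvg_unique (@Rhausdorff R) (LP _)).
  by apply: cvgD; [apply: cvgMr|]; exact: LP.
have LM phi : L phi <= M * `|phi|.
  apply: (cvgr_to_le (LP phi)); apply: filterE => n.
  apply: le_trans (ler_norm _) _; apply: le_trans (dual_ler _ _) _.
  by rewrite mulrC ler_wpM2r.
have [Phi [PhiL _]] := exists_dual M0 sL LM.
have [z zP] := refV Phi.
by exists U, z; split => // phi; rewrite -zP PhiL.
Qed.

(** Isolates the total coefficient of [z], indexed by [None], so that a
    combination can be compared with the distance of [z] to the span of [d]. *)
Lemma combination_split (V : lmodType R) (I : Type) (z : V) (d : I -> V) (e : R)
    (c : seq (R * option I)) : exists (a : R) (c' : seq (R * I)),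
  \sum_(ai <- c) ai.1 *: oapp d z ai.2 = a *: z + \sum_(ai <- c') ai.1 *: d ai.2 /\
  \sum_(ai <- c) ai.1 * oapp (fun=> 0) e ai.2 = a * e.
Proof.
elim: c => [|[b [i|]] c [a [c' [IH1 IH2]]]].
- by exists 0, [::]; rewrite !big_nil scale0r mul0r addr0.
- exists a, ((b, i) :: c'); rewrite !big_cons/= IH1 IH2 mulr0 add0r.
  by rewrite addrCA.
- exists (b + a), c'; rewrite !big_cons/= IH1 IH2 scalerDl mulrDl.
  by rewrite addrA.
Qed.

(** If [z] were at positive distance from the span of the [x n], Helly's
    condition would give a functional vanishing on all of them but not at [z]. *)
Lemma weak_cluster_span (V : normedModType R) (x : V ^nat) (z : V) (U : set_system nat) :
  ProperFilter U -> (forall phi : dual_space V, phi (x n) @[n --> U] --> phi z) ->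
  forall e : R, 0 < e -> exists q : seq (rat * nat),
    `|z - \sum_(ai <- q) ratr ai.1 *: x ai.2| < e.
Proof.
move=> FU xz e e0; apply: contrapT => /forallNP H.
have e2 : 0 < e / 2 by rewrite divr_gt0.
have far (c : seq (R * nat)) : e / 2 <= `|z - \sum_(ai <- c) ai.1 *: x ai.2|.
  have [q qc] := rational_combination x c e2.
  have := H q; move/negP; rewrite -leNgt => /le_trans.
  move=> /(_ _ (ler_distD (\sum_(ai <- c) ai.1 *: x ai.2) _ _)).
  by lra.
have [c|phi [phi1 phiE]] := @exists_dual_interpolation R V (option nat)
    (oapp x z) (oapp (fun=> 0) (e / 2)).
  have [a [c' [-> ->]]] := combination_split z x (e / 2) c.
  have [a0|a0] := leP a 0.
    by apply: le_trans (normr_ge0 _); rewrite mulr_le0_ge0// ltW.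
  have E (w : V) : a *: z + w = a *: (z + a^-1 *: w).
    by rewrite scalerDr scalerA mulfV ?lt0r_neq0// scale1r.
  rewrite E normrZ gtr0_norm// ler_pM2l//.
  have := far [seq (- (a^-1 * ai.1), ai.2) | ai <- c'].
  rewrite big_map/=; under eq_bigr do rewrite scaleNr -scalerA.
  by rewrite sumrN opprK -scaler_sumr.
have := phiE None; rewrite /=.
suff -> : phi z = 0 by lra.
apply: (cvg_unique (@Rhausdorff R) (xz phi)).
rewrite (_ : (fun n => _) = fun=> 0); first exact: cvg_cst.
by apply/funext => n; exact: (phiE (Some n)).
Qed.

(** The Eberlein-Smulian theorem for sequences. Take a weak cluster point [z]
    and make countably many functionals, norming for the rational span of the
    [x n], converge to their values at [z] along a subsequence. A weak cluster
    point of a further subsequence differs from [z] by a vector of the closed span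
    at which all these functionals vanish, hence equals [z]. *)
Lemma reflexive_weak_subseq (V : normedModType R) (x : V ^nat) (M : R) :
  reflexive_space V -> (forall n, `|x n| <= M) ->
  exists (k : nat -> nat) (z : V), (forall n, (n <= k n)%N) /\ weakly_cvg (x \o k) z.
Proof.
move=> refV xM; have [U [z [FU ooU xz]]] := reflexive_cluster refV xM.
pose comb (q : seq (rat * nat)) : V := \sum_(ai <- q) ratr ai.1 *: x ai.2.
have /choice[psi psiP] (q : seq (rat * nat)) : exists phi : dual_space V,
  `|phi| <= 1 /\ phi (comb q) = `|comb q| := exists_norming_dual (comb q).
(* An enumeration of the norming functionals. *)
pose psi' m : dual_space V := oapp psi 0 (unpickle m).
have /choice[k /all_and2[kn kpsi]] (n : nat) : exists j, (n <= j)%N /\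
    forall m, (m < n)%N -> `|psi' m (x j) - psi' m z| < n.+1%:R^-1.
  suff : U [set j | (n <= j)%N /\
      forall m, (m < n)%N -> `|psi' m (x j) - psi' m z| < n.+1%:R^-1].
    by move=> /filter_ex.
  apply: filterI; first by apply: ooU; exact: nbhs_infty_ge.
  have key m : U [set j | `|psi' m (x j) - psi' m z| < n.+1%:R^-1].
    have /cvgrPdist_lt/(_ n.+1%:R^-1) := xz (psi' m).
    rewrite invr_gt0 ltr0n => /(_ isT); apply: filterS => j /=.
    by rewrite distrC.
  elim: {1}n => [|N IH]; first by apply: filterE.
  apply: filterS2 IH (key N) => j /= Hj HN m; rewrite ltnS leq_eqVlt.
  by move=> /orP[/eqP ->|/Hj].
have psiz m : psi' m (x (k n)) @[n --> \oo] --> psi' m z.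
  apply/cvgrPdist_lt => e e0; near=> n.
  rewrite distrC; apply: lt_trans (kpsi n m _) _.
    by near: n; exact: nbhs_infty_gt.
  by near: n; exact: (near_infty_natSinv_lt (PosNum e0)).
exists k, z; split => // phi; apply: contrapT => /not_cvg_subseq[e [j [e0 jn je]]].
have [W [y [FW ooW xy]]] := @reflexive_cluster V (x \o k \o j) M refV (fun n => xM _).
have psiy m : psi' m y = psi' m z.
  apply: (cvg_unique (@Rhausdorff R) (xy (psi' m))).
  have := cvg_subseq jn (psiz m); apply: cvg_trans.
  exact: cvg_app.
have yspan := @weak_cluster_span V x y ((k \o j) @ W) (fmap_proper_filter _ FW) xy.
(* [y - z] is close to some rational combination [comb q], whose norm is the value
   of a functional that vanishes at [y - z]. *)
have yz : y = z.
  apply/eqP; rewrite -subr_eq0 -normr_le0; apply/ler_addgt0Pr => d d0.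
  have d4 : 0 < d / 4 by rewrite divr_gt0.
  have [q1 q1y] := yspan _ d4; have [q2 q2z] := weak_cluster_span FU xz d4.
  pose q := q1 ++ [seq (- ai.1, ai.2) | ai <- q2].
  have qE : comb q = comb q1 - comb q2.
    rewrite /comb /q big_cat big_map /=; congr (_ + _).
    by rewrite -sumrN; apply: eq_bigr => ai _; rewrite rmorphN scaleNr.
  have near_q : `|y - z - comb q| < d / 2.
    rewrite qE opprD opprK addrACA (_ : - z + comb q2 = - (z - comb q2)).
      by apply: le_lt_trans (ler_normB _ _) _; rewrite /comb; lra.
    by rewrite opprB addrC.
  have [psi1 psiq] := psiP q.
  have psi0 : psi q (y - z) = 0.
    have := psiy (pickle q); rewrite /psi' pickleK/= dualB => ->.
    by rewrite subrr.
  have : `|comb q| <= `|y - z - comb q|.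
    rewrite -psiq -[psi q (comb q)]opprK -dualN -[X in - X]add0r -psi0 -dualD.
    by apply: le_trans (ler_norm _) _; rewrite normrN; exact: dual_ler1.
  have := ler_normD (y - z - comb q) (comb q); rewrite subrK.
  by rewrite add0r; lra.
have /cvgrPdist_lt/(_ e e0) := xy phi.
move=> /filter_ex[n /=]; rewrite yz distrC ltNge.
by rewrite (je n).
Unshelve. all: by end_near. Qed.

(** A weak limit [z] of a subsequence satisfies [phi z = 1], which forces
    [|z| = 1], so the Kadets-Klee property turns weak into norm convergence. *)
Lemma kadets_klee_subseq (V : normedModType R) (x : V ^nat) (phi : dual_space V) :
  reflexive_space V -> kadets_klee V ->
  (forall n, `|x n| = 1) -> `|phi| <= 1 -> phi (x n) @[n --> \oo] --> (1 : R) ->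
  exists (k : nat -> nat) (z : V), [/\ forall n, (n <= k n)%N,
    `|x (k n) - z| @[n --> \oo] --> (0 : R) & phi z = 1].
Proof.
move=> refV kkV x1 phi1 phix.
have [|k [z [kn xz]]] := @reflexive_weak_subseq V x 1 refV.
  by move=> n; rewrite x1.
have phiz : phi z = 1.
  apply: (cvg_unique (@Rhausdorff R) (xz phi)).
  exact: (cvg_subseq kn phix).
have z1 : `|z| = 1.
  apply/eqP; rewrite eq_le; apply/andP; split; last first.
    by rewrite -phiz; apply: le_trans (ler_norm _) _; exact: dual_ler1.
  have [psi [psi1 <-]] := exists_norming_dual z.
  apply: (cvgr_to_le (xz psi)); apply: nearW => n /=.
  by rewrite -(x1 (k n)); apply: le_trans (ler_norm _) _; exact: dual_ler1.
exists k, z; split => //; apply: (kkV _ _ xz).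
rewrite z1 (_ : (fun n => _) = fun=> 1); first exact: cvg_cst.
by apply/funext => n /=; rewrite x1.
Qed.
End weak_compactness.

(** * Functionals and order on spaces of functions modulo almost everywhere equality *)

Section fun_space_classes.
Context d (T : measurableType d) (R : realType) (mu : {measure set T -> \bar R}).
Context (Y : normedModType R) (F : fun_space mu Y).
Implicit Types f g h : T -> Y.

Definition fclass f (Ff : fs_mem F f) : ae_quot F := ae_class (FsElt (asboolT Ff)).

Lemma fclass_lin a f g h (Ff : fs_mem F f) (Fg : fs_mem F g) (Fh : fs_mem F h) :
  {ae mu, forall t, h t = a *: f t + g t} ->
  fclass Fh = a *: fclass Ff + fclass Fg.
Proof.
move=> hE; rewrite /fclass -ae_classZ -ae_classD; apply/ae_class_eq.
by apply: filterS hE => t /=; rewrite !fctE.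
Qed.

Lemma fclass0 f (Ff : fs_mem F f) : {ae mu, forall t, f t = 0} -> fclass Ff = 0.
Proof. by move=> f0; rewrite -ae_class0; apply/ae_class_eq. Qed.

Lemma fclassD f g h (Ff : fs_mem F f) (Fg : fs_mem F g) (Fh : fs_mem F h) :
  {ae mu, forall t, h t = f t + g t} -> fclass Fh = fclass Ff + fclass Fg.
Proof.
move=> hE; rewrite -[fclass Ff]scale1r; apply: fclass_lin.
by apply: filterS hE => t; rewrite scale1r.
Qed.

Lemma fclassB f g h (Ff : fs_mem F f) (Fg : fs_mem F g) (Fh : fs_mem F h) :
  {ae mu, forall t, h t = f t - g t} -> fclass Fh = fclass Ff - fclass Fg.
Proof.
move=> hE; rewrite -scaleN1r addrC; apply: fclass_lin.
by apply: filterS hE => t; rewrite scaleN1r addrC.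
Qed.

Lemma norm_fclass f (Ff : fs_mem F f) : `|fclass Ff| = fs_norm F f.
Proof. exact: norm_ae_class. Qed.

Lemma repr_fclass f (Ff : fs_mem F f) : {ae mu, forall t, repr (fclass Ff) t = f t}.
Proof. exact: repr_ae_class. Qed.

Lemma fclass_repr (x : ae_quot F) : fclass (fs_elt_mem (repr x)) = x.
Proof.
rewrite -[RHS]ae_class_repr; apply/ae_class_eq.
exact: aeW.
Qed.

Lemma fs_memB f g : fs_mem F f -> fs_mem F g -> fs_mem F (f - g).
Proof. by move=> Ff Fg; rewrite addrC -scaleN1r; exact: fs_memL. Qed.

(** A linear form bounded by the seminorm vanishes on null functions, so it
    descends to the quotient. *)
Lemma exists_fun_space_dual (L : (T -> Y) -> R) (M : R) : 0 <= M ->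
  (forall a f g, fs_mem F f -> fs_mem F g -> L (a *: f + g) = a * L f + L g) ->
  (forall f, fs_mem F f -> L f <= M * fs_norm F f) ->
  exists phi : dual_space (ae_quot F), `|phi| <= M /\
    forall f (Ff : fs_mem F f), phi (fclass Ff) = L f.
Proof.
move=> M0 Llin LM.
have L0 f : fs_mem F f -> {ae mu, forall t, f t = 0} -> L f <= 0.
  move=> Ff f0; apply: le_trans (LM _ Ff) _.
  rewrite (fs_norm_ae Ff (fs_mem0 F) f0) -(scale0r 0) fs_normZ ?normr0 ?mul0r ?mulr0//.
  exact: fs_mem0.
have LB f g : fs_mem F f -> fs_mem F g -> L (f - g) = L f - L g.
  by move=> Ff Fg; rewrite addrC -scaleN1r Llin// mulN1r addrC.
have Lle f g : fs_mem F f -> fs_mem F g -> {ae mu, forall t, f t = g t} -> L f <= L g.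
  move=> Ff Fg fg; rewrite -subr_le0 -LB//; apply: L0; first exact: fs_memB.
  by apply: filterS fg => t; rewrite !fctE => ->; rewrite subrr.
have Lae f g : fs_mem F f -> fs_mem F g -> {ae mu, forall t, f t = g t} -> L f = L g.
  move=> Ff Fg fg; apply/eqP; rewrite eq_le !Lle//.
  by apply: filterS fg => t ->.
have sl : scalar (fun x : ae_quot F => L (repr x)).
  move=> a x y /=; rewrite -Llin; try exact: fs_elt_mem.
  apply: Lae; first exact: fs_elt_mem.
    by apply: fs_memL; exact: fs_elt_mem.
  have := ae_class_repr (a *: x + y).
  rewrite -[in RHS](ae_class_repr x) -[in RHS](ae_class_repr y) -ae_classZ -ae_classD.
  by move=> /ae_class_eq.
have [x|phi [phiL phi1]] := exists_dual M0 sl.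
  by rewrite norm_ae_quot; apply: LM; exact: fs_elt_mem.
exists phi; split => // f Ff; rewrite phiL; apply: Lae => //.
  exact: fs_elt_mem.
exact: repr_fclass.
Qed.

End fun_space_classes.

Section koethe_lattice.
Context d (T : measurableType d) (R : realType) (mu : {measure set T -> \bar R}).
Context (cmu : measure_is_complete mu) (E : koethe_space cmu).
Implicit Types f g h : T -> R.

Lemma koethe_memD f g : koethe_mem E f -> koethe_mem E g -> koethe_mem E (f + g).
Proof. by move=> Ef Eg; rewrite -[f]scale1r; exact: koethe_memL. Qed.

Lemma koethe_memB f g : koethe_mem E f -> koethe_mem E g -> koethe_mem E (f - g).
Proof. by move=> Ef Eg; rewrite addrC -scaleN1r; exact: koethe_memL. Qed.

Lemma koethe_memZ a f : koethe_mem E f -> koethe_mem E (a *: f).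
Proof. by move=> Ef; rewrite -[_ *: _]addr0; exact: koethe_memL Ef (koethe_mem0 E). Qed.

Lemma koethe_norm0 f : koethe_mem E f -> {ae mu, forall t, f t = 0} -> koethe_norm E f = 0.
Proof.
move=> Ef f0; rewrite (koethe_norm_ae Ef (koethe_mem0 E) f0) -(scale0r 0).
by rewrite koethe_normZ ?normr0 ?mul0r//; exact: koethe_mem0.
Qed.

Lemma koethe_mem_norm f : koethe_mem E f -> koethe_mem E (fun t => `|f t|).
Proof.
move=> Ef; apply: (koethe_ideal Ef _ _).1.
  by apply: measurableT_comp => //; exact: koethe_measurable Ef.
by apply: aeW => t; rewrite normr_id.
Qed.

Lemma koethe_mem_max f g : koethe_mem E f -> koethe_mem E g ->
  koethe_mem E (fun t => Num.max (f t) (g t)).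
Proof.
move=> Ef Eg; apply: (koethe_ideal (koethe_memD (koethe_mem_norm Ef) (koethe_mem_norm Eg)) _ _).1.
  by apply: measurable_maxr; [exact: koethe_measurable Ef|exact: koethe_measurable Eg].
apply: aeW => t; rewrite !fctE (@ger0_norm _ (_ + _)) ?addr_ge0//.
by rewrite maxEle; case: ifP => _; rewrite ?lerDl ?lerDr.
Qed.

Lemma koethe_mem_pos f : koethe_mem E f -> koethe_mem E (fun t => Num.max 0 (f t)).
Proof. by move=> Ef; exact: (koethe_mem_max (koethe_mem0 E) Ef). Qed.

Lemma koethe_mem_indic f A : koethe_mem E f -> measurable A ->
  koethe_mem E (fun t => f t * \1_A t).
Proof.
move=> Ef mA; apply: (koethe_ideal Ef _ _).1.
  by apply: measurable_funM => //; exact: koethe_measurable Ef.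
apply: aeW => t; rewrite normrM indicE -[leRHS]mulr1 ler_wpM2l//.
by case: (_ \in _); rewrite ?normr1 ?normr0.
Qed.

(** The norm of the positive part: linear functionals below it are positive,
    which makes the order of [E] visible to weak limits. *)
Definition koethe_pos_norm (x : koethe E) : R :=
  koethe_norm E (fun t => Num.max 0 (repr x t)).

Lemma koethe_pos_norm_fclass f (Ef : koethe_mem E f) :
  koethe_pos_norm (fclass (F := koethe_fun_space E) Ef) =
  koethe_norm E (fun t => Num.max 0 (f t)).
Proof.
apply: koethe_norm_ae.
- by apply: koethe_mem_pos; exact: fs_elt_mem (repr (fclass _)).
- exact: koethe_mem_pos.
- by apply: filterS (repr_fclass (F := koethe_fun_space E) Ef) => t ->.
Qed.

Lemma koethe_pos_norm_le (x : koethe E) : koethe_pos_norm x <= `|x|.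
Proof.
have Ex : koethe_mem E (repr x) by exact: fs_elt_mem.
apply: (koethe_ideal Ex _ _).2.
  exact: koethe_measurable (koethe_mem_pos Ex).
apply: aeW => t; rewrite ger0_norm ?le_max ?lexx//.
by rewrite ge_max normr_ge0 ler_norm.
Qed.

Lemma koethe_pos_norm_sublinear : sublinear koethe_pos_norm.
Proof.
have Ef (x : koethe E) : koethe_mem E (repr x) by exact: fs_elt_mem.
have Em (x : koethe E) : koethe_mem E (fun t => Num.max 0 (repr x t)).
  exact: koethe_mem_pos.
have Er a (x y : koethe E) : {ae mu, forall t, repr (a *: x + y) t = a * repr x t + repr y t}.
  have := ae_class_repr (a *: x + y).
  rewrite -[in RHS](ae_class_repr x) -[in RHS](ae_class_repr y) -ae_classZ -ae_classD.
  by move=> /ae_class_eq.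
split=> [x y|a x a0].
  apply: le_trans (koethe_normD (Em x) (Em y)).
  apply: (koethe_ideal (koethe_memD (Em x) (Em y)) _ _).2.
    exact: koethe_measurable (Em _).
  apply: filterS (Er 1 x y) => t; rewrite scale1r mul1r => ->.
  rewrite !fctE !ger0_norm ?addr_ge0 ?le_max ?lexx//.
  by rewrite ge_max addr_ge0 ?le_max ?lexx// lerD// le_max lexx orbT.
rewrite /koethe_pos_norm -[in RHS](ger0_norm a0) -koethe_normZ//.
apply: koethe_norm_ae => //; first exact: koethe_memZ.
apply: filterS2 (Er a x 0) (repr_ae_class (0 : fs_elt (koethe_fun_space E))) => t.
rewrite addr0 ae_class0 => -> ->; rewrite !fctE addr0.
by rewrite /GRing.scale/= maxr_pMr// mulr0.
Qed.

(** For large [n] the positive part of [f - g] is dominated by [|v n - g|], so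
    its norm is zero. *)
Lemma koethe_cvg_ge f g (v : nat -> T -> R) : koethe_mem E f -> koethe_mem E g ->
  (forall n, koethe_mem E (v n)) -> koethe_norm E (v n - g) @[n --> \oo] --> (0 : R) ->
  (\forall n \near \oo, {ae mu, forall t, f t <= v n t}) ->
  {ae mu, forall t, f t <= g t}.
Proof.
move=> Ef Eg Ev vg fv.
pose w t := Num.max 0 (f t - g t).
have Ew : koethe_mem E w.
  exact: koethe_mem_pos (koethe_memB Ef Eg).
have w0 : koethe_norm E w = 0.
  apply/eqP; rewrite eq_le koethe_norm_ge0// andbT.
  apply: (cvgr_to_ge vg); apply: filterS fv => n fvn.
  apply: (koethe_ideal (koethe_memB (Ev n) Eg) (koethe_measurable Ew) _).2.
  apply: filterS fvn => t ft; rewrite ger0_norm ?le_max ?lexx// ge_max normr_ge0/=.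
  by apply: le_trans (ler_norm _); rewrite !fctE lerD2r.
apply: filterS (koethe_norm_eq0 Ew w0) => t.
by rewrite /w -subr_le0 => <-; rewrite le_max lexx orbT.
Qed.

(** A geometrically weighted sum of normalized indicator functions of a
    countable cover by sets of finite measure. *)
Lemma exists_koethe_pos : sigma_finite [set: T] mu ->
  exists2 u : T -> R, koethe_mem E u & forall t, 0 < u t.
Proof.
move=> [F FT mF].
have EF n : koethe_mem E (\1_(F n)) by apply: koethe_indic; have [] := mF n.
pose c n : R := (1 + koethe_norm E (\1_(F n)))^-1.
have c0 n : 0 < c n by rewrite invr_gt0 ltr_pwDl// koethe_norm_ge0.
pose s := fix s n : T -> R := if n is m.+1 then (2 ^- m * c m) *: \1_(F m) + s m else 0.
have Es n : koethe_mem E (s n).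
  elim: n => [|n IH]; first exact: koethe_mem0.
  exact: koethe_memL.
have e0 n : 0 < (2 ^- n : R) by rewrite invr_gt0 exprn_gt0.
have [|u Eu su] := koethe_complete_geo Es.
  move=> n; rewrite /= addrK koethe_normZ// gtr0_norm ?mulr_gt0//.
  rewrite -mulrA -[leRHS]mulr1 ler_wpM2l//.
  by rewrite /c mulrC ler_pdivrMr ?mul1r ?lerDr// ltr_pwDl// koethe_norm_ge0.
have s_ndec t : {homo (fun n => s n t) : m n / (m <= n)%N >-> m <= n}.
  apply: homo_leq => [x|y x z|n]; [exact: lexx|exact: le_trans|].
  rewrite /= !fctE lerDr mulr_ge0//; first by rewrite mulr_ge0 ?ltW.
have ge_s : {ae mu, forall t, forall n, s n t <= u t}.
  apply: ae_foralln => n; apply: (koethe_cvg_ge (Es n) Eu Es su).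
  by near=> m; apply: aeW => t; apply: s_ndec; near: m; exact: nbhs_infty_ge.
have u0 : {ae mu, forall t, 0 < u t}.
  apply: filterS ge_s => t st.
  have [n _ Fnt] : (\bigcup_i F i) t by rewrite -FT.
  apply: lt_le_trans (st n.+1); rewrite /= !fctE indicE mem_set//=.
  rewrite ltr_pwDl//; first by rewrite /GRing.scale/= mulr1 mulr_gt0.
  by rewrite -[0](_ : s 0%N t = _)// s_ndec.
exists (fun t => if 0 < u t then u t else 1); last by move=> t; case: ifP.
apply: (koethe_ideal Eu _ _).1; last by apply: filterS u0 => t ->.
apply: measurable_fun_ifT => //; last exact: koethe_measurable Eu.
apply: measurable_fun_ltr => //; exact: koethe_measurable Eu.
Unshelve. all: by end_near. Qed.

End koethe_lattice.

(** * Order continuity of the norm of a reflexive Koethe space *)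

Section koethe_order_continuity.
Context d (T : measurableType d) (R : realType) (mu : {measure set T -> \bar R}).
Context (cmu : measure_is_complete mu) (E : koethe_space cmu).

Notation kclass Ef := (fclass (F := koethe_fun_space E) Ef : koethe E).

(** Nonnegative combinations of a decreasing sequence dominate a multiple of
    one of its terms; this verifies the hypothesis of [mazur_orlicz] in the next
    proof. *)
Lemma koethe_combination_ge (a : nat -> T -> R) (Ea : forall n, koethe_mem E (a n))
    (c : seq (R * nat)) :
  (forall n t, 0 <= a n t) ->
  (forall t, {homo (fun n => a n t) : m n / (m <= n)%N >-> n <= m}) ->
  all (fun ai => 0 <= ai.1) c ->
  exists (m : nat) (f : T -> R) (Ef : koethe_mem E f),
    \sum_(ai <- c) ai.1 *: kclass (Ea ai.2) = kclass Ef /\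
    forall t, (\sum_(ai <- c) ai.1) * a m t <= f t.
Proof.
move=> a0 adec; elim: c => [|[b i] c IH] /=.
  move=> _; exists 0%N, 0, (koethe_mem0 E); rewrite !big_nil.
  split => [|t]; last by rewrite mul0r.
  by apply/esym/fclass0; exact: aeW.
move=> /andP[b0 c0]; have [m [f [Ef [cE cf]]]] := IH c0.
have s0 := weight_sum_ge0 c0.
exists (maxn m i), (b *: a i + f), (koethe_memL b (Ea i) Ef).
rewrite !big_cons/= cE; split.
  by apply/esym/fclass_lin; exact: aeW.
move=> t; rewrite mulrDl !fctE lerD//.
  by rewrite /GRing.scale/= ler_wpM2l// adec// leq_maxr.
by apply: le_trans (cf t); rewrite ler_wpM2l// adec// leq_maxl.
Qed.

Hypothesis E_reflexive : reflexive_space (koethe E).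

(** If the norms of the [a n] stay above [e], [mazur_orlicz] provides a positive
    functional which is at least [e] on all of them, hence also at the weak limit
    [z] of a subsequence; so the positive part of [z] is not null. As the [a m]
    decrease to zero, [z] cannot be below all of them, and a positive functional
    detecting the positive part of some [z - x m] contradicts weak convergence. *)
Lemma koethe_decreasing_cvg0 (a : nat -> T -> R) :
  (forall n, koethe_mem E (a n)) -> (forall n t, 0 <= a n t) ->
  (forall t, {homo (fun n => a n t) : m n / (m <= n)%N >-> n <= m}) ->
  {ae mu, forall t, a n t @[n --> \oo] --> (0 : R)} ->
  koethe_norm E (a n) @[n --> \oo] --> (0 : R).
Proof.
move=> Ea a0 adec acvg; apply: contrapT => /not_cvg_subseq[e [k [e0 kn ke]]].
have {k kn ke}ae n : e <= koethe_norm E (a n).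
  apply: le_trans (ke n) _; rewrite subr0 ger0_norm ?koethe_norm_ge0//.
  apply: (koethe_ideal (Ea n) (koethe_measurable (Ea _)) _).2.
  by apply: aeW => t; rewrite !ger0_norm// adec.
pose x n : koethe E := kclass (Ea n).
pose p := koethe_pos_norm (E := E); have sp : sublinear p := koethe_pos_norm_sublinear E.
have p1 y : p y <= 1 * `|y| by rewrite mul1r; exact: koethe_pos_norm_le.
have [c c0|psi [spsi psip psix]] := @mazur_orlicz R (koethe E) nat p x (fun=> e) sp.
  have [m [f [Ef [-> cf]]]] := koethe_combination_ge Ea a0 adec c0.
  have s0 := weight_sum_ge0 c0.
  rewrite /p koethe_pos_norm_fclass -mulr_suml.
  apply: (@le_trans _ _ (koethe_norm E ((\sum_(ai <- c) ai.1) *: a m))).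
    by rewrite koethe_normZ// ger0_norm// ler_wpM2l.
  apply: (koethe_ideal (koethe_mem_pos Ef) _ _).2.
    exact: koethe_measurable (koethe_memZ _ (Ea m)).
  apply: aeW => t; rewrite !ger0_norm ?mulr_ge0 ?le_max ?lexx//.
  by rewrite cf orbT.
have psi1 y : psi y <= 1 * `|y| by exact: le_trans (p1 y).
have [phi [phiE _]] := exists_dual ler01 spsi psi1.
have [|k [z [kn xz]]] := @reflexive_weak_subseq R (koethe E) x (koethe_norm E (a 0%N)) E_reflexive.
  move=> n; rewrite /x norm_fclass.
  apply: (koethe_ideal (Ea 0%N) (koethe_measurable (Ea n)) _).2.
  by apply: aeW => t; rewrite !ger0_norm// adec.
have ez : e <= p z.
  apply: le_trans (psip z); rewrite -phiE.
  apply: (cvgr_to_ge (xz phi)); apply: nearW => n /=.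
  by rewrite phiE.
have Ez : koethe_mem E (repr z) by exact: fs_elt_mem.
have zE : z = kclass Ez.
  rewrite -[LHS](fclass_repr (F := koethe_fun_space E) z).
  by apply/ae_class_eq; exact: aeW.
have zaE m : z - x m = kclass (koethe_memB Ez (Ea m)).
  by rewrite [X in X - _ = _]zE; apply/esym/fclassB; exact: aeW.
have [m pm] : exists m, 0 < p (z - x m).
  apply: contrapT => /forallNP H.
  have za : {ae mu, forall t, forall m, repr z t <= a m t}.
    apply: ae_foralln => m.
    have : p (z - x m) = 0.
      apply/eqP; rewrite eq_le; apply/andP; split.
        by have := H m => /negP; rewrite -leNgt.
      rewrite /p zaE koethe_pos_norm_fclass; apply: koethe_norm_ge0.
      exact: koethe_mem_pos (koethe_memB Ez (Ea m)).
    rewrite /p zaE koethe_pos_norm_fclass => /koethe_norm_eq0.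
    move=> /(_ (koethe_mem_pos (koethe_memB Ez (Ea m)))); apply: filterS => t /=.
    by rewrite !fctE -subr_le0 => <-; rewrite le_max lexx orbT.
  have : p z = 0.
    rewrite zE /p koethe_pos_norm_fclass; apply: koethe_norm0.
      exact: koethe_mem_pos.
    apply: filterS2 za acvg => t zt at0; apply/eqP.
    rewrite eq_le le_max lexx andbT ge_max lexx/=.
    by apply: (cvgr_to_ge at0); apply: nearW => n.
  by move=> pz; move: ez; rewrite pz leNgt e0.
have [c c0|l [sl lp lz]] := @mazur_orlicz R (koethe E) unit p (fun=> z - x m)
    (fun=> p (z - x m)) sp.
  by rewrite -scaler_suml -mulr_suml sp.2//; exact: weight_sum_ge0.
have [|chi [chiE _]] := exists_dual ler01 sl; first by move=> y; exact: le_trans (p1 y).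
have : chi (z - x m) <= 0.
  rewrite dualB; apply: (@cvgr_to_le _ \oo _ R (fun n => chi (x (k n)) - chi (x m))).
    by apply: cvgB; [exact: xz|exact: cvg_cst].
  near=> n; rewrite -dualB chiE; apply: le_trans (lp _) _.
  have -> : x (k n) - x m = kclass (koethe_memB (Ea (k n)) (Ea m)).
    by apply/esym/fclassB; exact: aeW.
  rewrite /p koethe_pos_norm_fclass koethe_norm0//.
    exact: koethe_mem_pos (koethe_memB _ _).
  apply: aeW => t; apply/eqP; rewrite eq_le le_max lexx andbT ge_max lexx/=.
  rewrite !fctE subr_le0 adec//; apply: leq_trans (kn n).
  by near: n; exact: nbhs_infty_ge.
by rewrite chiE => /(le_trans (lz tt)); rewrite leNgt pm.
Unshelve. all: by end_near. Qed.

(** The suprema of the tails of [b], truncated by [g], decrease to zero. *)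
Lemma koethe_dominated_cvg0 (b : nat -> T -> R) (g : T -> R) :
  (forall n, koethe_mem E (b n)) -> koethe_mem E g ->
  (forall n, {ae mu, forall t, `|b n t| <= g t}) ->
  {ae mu, forall t, b n t @[n --> \oo] --> (0 : R)} ->
  koethe_norm E (b n) @[n --> \oo] --> (0 : R).
Proof.
move=> Eb Eg bg b0.
(* The truncation makes the suprema finite everywhere, not only almost everywhere. *)
pose w n t := Num.min `|b n t| `|g t|.
have wub t : has_ubound (range (fun n => w n t)).
  by exists `|g t| => _ [n _ <-]; rewrite ge_min lexx orbT.
pose a n t := sups (fun m => w m t) n.
have wa m n t : (n <= m)%N -> w m t <= a n t.
  move=> nm; apply: ub_le_sup; last by exists m.
  by apply: has_ubound_sdrop; exact: wub.
have ag n t : a n t <= `|g t|.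
  apply: ge_sup; first by exists (w n t), n => //=.
  by move=> _ [m /= nm <-]; rewrite ge_min lexx orbT.
have a0 n t : 0 <= a n t.
  by apply: le_trans (wa n n t (leqnn n)); rewrite le_min !normr_ge0.
have mw n : measurable_fun setT (w n).
  apply: measurable_minr; apply: measurableT_comp => //.
    exact: koethe_measurable (Eb n).
  exact: koethe_measurable Eg.
have Ea n : koethe_mem E (a n).
  apply: (koethe_ideal Eg _ _).1; last by apply: aeW => t; rewrite ger0_norm.
  exact: (@measurable_fun_sups _ _ _ setT w n).
have := koethe_decreasing_cvg0 Ea a0 _ _.
have bwE : {ae mu, forall t, forall n, w n t = `|b n t|}.
  apply: ae_foralln => n; apply: filterS (bg n) => t bgt.
  by apply/min_idPl; apply: le_trans bgt _; exact: ler_norm.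
move=> H; apply: (squeeze_cvgr _ (cvg_cst 0) (H _ _)).
- apply: nearW => n; rewrite koethe_norm_ge0//=.
  apply: (koethe_ideal (Ea n) (koethe_measurable (Eb n)) _).2.
  by apply: filterS bwE => t bt; rewrite -bt ger0_norm// wa.
- move=> t; exact: nonincreasing_sups.
- apply: filterS2 bwE b0 => t bt bt0.
  apply: (@cvg_sups R (fun m => w m t) 0).
  rewrite (_ : (fun m => w m t) = fun m => `|b m t|); last exact/funext.
  by rewrite -(@normr0 _ R); exact: cvg_norm.
Qed.

End koethe_order_continuity.

(** * Simple functions and countably additive set functions *)

Section simple_functions.
Context d (T : measurableType d) (R : realType).
Import HBSimple.

Lemma simple_function_sfun (s : {sfun T >-> R}) : simple_function (s : T -> R).
Proof.
split; first exact: fimfunP.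
by move=> z; rewrite -[_ @^-1` _]setTI; exact: measurable_funP.
Qed.

Lemma measurable_simple_cvg (r : T -> R) : measurable_fun setT r ->
  exists s : nat -> T -> R, (forall n, simple_function (s n)) /\
    forall t, s n t @[n --> \oo] --> r t.
Proof.
move=> mr; have mr' : measurable_fun setT (EFin \o r) by exact/measurable_EFinP.
have [s sr] := approximation_sfun measurableT mr'.
exists (fun n => s n); split; first by move=> n; exact: simple_function_sfun.
by move=> t; have /fine_cvg := sr t I.
Qed.

Lemma simple_function_sum (Z : lmodType R) (s : T -> Z) : simple_function s ->
  exists l : seq (set T * Z), (forall az, az \in l -> measurable az.1 /\ range s az.2) /\
    forall t, s t = \sum_(az <- l) \1_(az.1) t *: az.2.
Proof.
move=> [/finite_seqP[r rs] ms].
exists [seq (s @^-1` [set z], z) | z <- undup r]; split.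
  move=> az /mapP[z]; rewrite mem_undup => zr ->; split; first exact: ms.
  by have : [set` r] z by []; rewrite -rs.
move=> t; rewrite big_map /=.
have str : s t \in undup r by rewrite mem_undup; have : range s (s t) by []; rewrite rs.
rewrite (bigD1_seq (s t)) ?undup_uniq//= indicE mem_set// scale1r.
rewrite big1 ?addr0// => z zst; rewrite indicE memNset ?scale0r//=.
by apply/eqP; rewrite eq_sym.
Qed.

End simple_functions.

Section bochner_scaling.
Context d (T : measurableType d) (R : realType) (mu : {measure set T -> \bar R}).
Context (X : normedModType R).

Lemma bochner_measurable_scale (r : T -> R) (f : T -> X) :
  measurable_fun setT r -> bochner_measurable mu f ->
  bochner_measurable mu (fun t => r t *: f t).
Proof.
move=> /measurable_simple_cvg[p [sp pr]] [s [ss sf]].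
exists (fun n t => p n t *: s n t); split.
  by move=> n; exact: (simple_function_comp2 (fun a x => a *: x)).
by apply: filterS sf => t st; exact: cvgZ.
Qed.

Lemma bochner_measurable_cst (x : X) : bochner_measurable mu (fun=> x).
Proof. exact/simple_bochner_measurable/simple_function_cst. Qed.

End bochner_scaling.

Section koethe_set_functions.
Context d (T : measurableType d) (R : realType) (mu : {measure set T -> \bar R}).
Context (cmu : measure_is_complete mu) (E : koethe_space cmu).
Context (E_reflexive : reflexive_space (koethe E)).
Context (u : T -> R) (Eu : koethe_mem E u) (u0 : forall t, 0 < u t).

(** The values of [s] on the tails of a disjoint union are bounded by the norms
    of [u] restricted to these tails, which tend to zero by order continuity. *)
Lemma koethe_bounded_sigma_additive (s : set T -> R) (C : R) :
  (forall A B, measurable A -> measurable B -> A `&` B = set0 ->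
    s (A `|` B) = s A + s B) ->
  (forall A, measurable A -> `|s A| <= C * koethe_norm E (fun t => u t * \1_A t)) ->
  semi_sigma_additive (fun A => (s A)%:E).
Proof.
move=> sU sC F mF tF mUF; pose B n := \big[setU/set0]_(i < n) F i.
have mB n : measurable (B n) by apply: bigsetU_measurable.
have s0 : s set0 = 0.
  by have := sU set0 set0 measurable0 measurable0 (setI0 _); rewrite setU0; lra.
have sB n : (\sum_(0 <= i < n) (s (F i))%:E)%E = (s (B n))%:E.
  elim: n => [|n IH]; first by rewrite big_nil /B big_ord0 s0.
  rewrite big_nat_recr//= IH /B big_ord_recr/= sU//; first exact: mB.
  rewrite -bigcup_mkord setI_bigcupl; apply: bigcup0 => i /= ni.
  by move/trivIsetP : tF => /(_ i n I I); apply; rewrite ltn_eqF.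
rewrite (_ : (fun n => _) = fun n => (s (B n))%:E); last exact/funext.
have BF n : B n `<=` \bigcup_n F n.
  by rewrite /B -bigcup_mkord; exact: bigcup_subset.
pose D n := \bigcup_n F n `\` B n.
have mD n : measurable (D n) by exact: measurableD.
have sD n : s (\bigcup_n F n) = s (B n) + s (D n).
  by rewrite -sU ?setDIK// setDUK.
have D0 : koethe_norm E (fun t => u t * \1_(D n) t) @[n --> \oo] --> (0 : R).
  apply: (koethe_dominated_cvg0 E_reflexive _ Eu).
  - by move=> n; exact: koethe_mem_indic.
  - move=> n; apply: aeW => t; rewrite normrM gtr0_norm// -[leRHS]mulr1.
    apply: ler_wpM2l; first exact: ltW.
    by rewrite indicE; case: (_ \in _); rewrite ?normr1 ?normr0.
  - apply: aeW => t; rewrite -[X in _ --> X](mulr0 (u t)); apply: cvgMr.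
    apply: cvg_near_cst; have [[i _ Fit]|nFt] := pselect ((\bigcup_n F n) t).
      near=> n; rewrite indicE memNset// => -[_]; apply.
      by rewrite /B -bigcup_mkord; exists i => //=; near: n; exact: nbhs_infty_gt.
    by apply: nearW => n; rewrite indicE memNset// => -[].
apply: cvg_EFin; first exact: nearW.
apply/cvgrPdist_le => e e0 /=.
have /cvgrPdist_le/(_ e e0) :
    C * koethe_norm E (fun t => u t * \1_(D n) t) @[n --> \oo] --> (C * 0 : R).
  exact: cvgMr.
apply: filterS => n; rewrite mulr0 sub0r normrN (sD n) addrAC subrr add0r => Ce.
by apply: le_trans (sC _ (mD n)) (le_trans (ler_norm _) Ce).
Unshelve. all: by end_near. Qed.

End koethe_set_functions.

(** * The variation of a functional on the Koethe-Bochner space *)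

Section variation.
Context d (T : measurableType d) (R : realType) (mu : {measure set T -> \bar R}).
Context (cmu : measure_is_complete mu) (E : koethe_space cmu).
Context (E_reflexive : reflexive_space (koethe E)).
Context (u : T -> R) (Eu : koethe_mem E u) (u0 : forall t, 0 < u t).
Context (X : normedModType R) (L : (T -> X) -> R).
Context (Llin : forall a f g, kb_mem E f -> kb_mem E g -> L (a *: f + g) = a * L f + L g).
Context (LM : forall f, kb_mem E f -> L f <= kb_norm E f).
Implicit Types (f g : T -> X) (A B : set T).

Lemma kb_functionalD f g : kb_mem E f -> kb_mem E g -> L (f + g) = L f + L g.
Proof. by move=> Ef Eg; rewrite -[f]scale1r Llin// scale1r mul1r. Qed.

Lemma kb_functional0 : L 0 = 0.
Proof.
by have := kb_functionalD (kb_mem0 E X) (kb_mem0 E X); rewrite addr0; lra.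
Qed.

Lemma kb_functionalZ a f : kb_mem E f -> L (a *: f) = a * L f.
Proof.
move=> Ef; rewrite -[a *: f]addr0 Llin ?kb_functional0 ?addr0//.
exact: kb_mem0.
Qed.

Lemma kb_memZ a f : kb_mem E f -> kb_mem E (a *: f).
Proof. by move=> Ef; rewrite -[_ *: _]addr0; exact: kb_memL Ef (kb_mem0 E X). Qed.

Lemma kb_memD f g : kb_mem E f -> kb_mem E g -> kb_mem E (f + g).
Proof. by move=> Ef Eg; rewrite -[f]scale1r; exact: kb_memL. Qed.

Lemma kb_memB f g : kb_mem E f -> kb_mem E g -> kb_mem E (f - g).
Proof. by move=> Ef Eg; rewrite addrC -scaleN1r; exact: kb_memL. Qed.

Lemma kb_functionalB f g : kb_mem E f -> kb_mem E g -> L (f - g) = L f - L g.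
Proof. by move=> Ef Eg; rewrite addrC -scaleN1r Llin// mulN1r addrC. Qed.

Lemma kb_functional_norm f : kb_mem E f -> `|L f| <= kb_norm E f.
Proof.
move=> Ef; rewrite ler_norml LM// andbT lerNl -mulN1r -kb_functionalZ//.
apply: le_trans (LM (kb_memZ _ Ef)) _.
by rewrite kb_normZ// normrN1 mul1r.
Qed.

Lemma kb_mem_indic f A : kb_mem E f -> measurable A -> kb_mem E (fun t => \1_A t *: f t).
Proof.
move=> [bf Ef] mA; apply: (kb_dominated _ Ef _).1.
  exact: bochner_measurable_scale.
apply: aeW => t; rewrite normrZ indicE.
by case: (_ \in _); rewrite ?normr1 ?mul1r ?normr0 ?mul0r.
Qed.

Lemma koethe_mem_scaled_indic A : measurable A -> koethe_mem E (fun t => u t * \1_A t).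
Proof. exact: koethe_mem_indic. Qed.

(** The total variation over [A] of the measure with values in the dual of [X]
    that sends a set [B] to the functional [x |-> L (1_B u x)]. *)
Definition dual_variation A : R :=
  sup [set L f | f in [set f | kb_mem E f /\ forall t, `|f t| <= u t * \1_A t]].

Lemma indic_ge0 A t : 0 <= \1_A t :> R.
Proof. by rewrite indicE. Qed.

Lemma indic_le1 A t : \1_A t <= 1 :> R.
Proof. by rewrite indicE; case: (_ \in _). Qed.

Lemma scaled_indic_le A t : u t * \1_A t <= u t.
Proof. by apply: ler_piMr; rewrite ?indic_le1// ltW. Qed.

Lemma kb_functional_dominated f (g : T -> R) : kb_mem E f -> koethe_mem E g ->
  (forall t, `|f t| <= g t) -> L f <= koethe_norm E g.
Proof.
move=> Ef Eg fg; apply: le_trans (LM Ef) _.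
by apply: (kb_dominated Ef.1 Eg _).2; exact: aeW.
Qed.

Lemma variation_ubound A :
  has_ubound [set L f | f in [set f | kb_mem E f /\ forall t, `|f t| <= u t * \1_A t]].
Proof.
exists (koethe_norm E u) => _ [f [Ef fA] <-].
apply: kb_functional_dominated => // t.
exact: le_trans (fA t) (scaled_indic_le A t).
Qed.

Lemma variation_nonempty A :
  [set L f | f in [set f | kb_mem E f /\ forall t, `|f t| <= u t * \1_A t]] !=set0.
Proof.
exists (L 0), 0 => //; split; first exact: kb_mem0.
by move=> t; rewrite normr0 mulr_ge0 ?indic_ge0// ltW.
Qed.

Lemma variation_ge A f : kb_mem E f -> (forall t, `|f t| <= u t * \1_A t) ->
  L f <= dual_variation A.
Proof. by move=> Ef fA; apply: ub_le_sup; [exact: variation_ubound|exists f]. Qed.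

Lemma variation_ge0 A : 0 <= dual_variation A.
Proof.
rewrite -kb_functional0; apply: variation_ge; first exact: kb_mem0.
by move=> t; rewrite normr0 mulr_ge0 ?indic_ge0// ltW.
Qed.

Lemma variation_le A M :
  (forall f, kb_mem E f -> (forall t, `|f t| <= u t * \1_A t) -> L f <= M) ->
  dual_variation A <= M.
Proof.
move=> H; apply: ge_sup; first exact: variation_nonempty.
by move=> _ [f [Ef fA] <-]; exact: H.
Qed.

Lemma variation_le_norm A : measurable A ->
  dual_variation A <= koethe_norm E (fun t => u t * \1_A t).
Proof.
move=> mA; apply: variation_le => f Ef fA.
exact: kb_functional_dominated (koethe_mem_scaled_indic mA) fA.
Qed.

Lemma variation_approx A (e : R) : 0 < e -> exists f, [/\ kb_mem E f,
  forall t, `|f t| <= u t * \1_A t & dual_variation A - e <= L f].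
Proof.
move=> e0.
have [_ [f [Ef fA] <-] vf] :=
  sup_adherent e0 (conj (variation_nonempty A) (variation_ubound A)).
by exists f; split => //; exact: ltW.
Qed.

Lemma variationU A B : measurable A -> measurable B -> A `&` B = set0 ->
  dual_variation (A `|` B) = dual_variation A + dual_variation B.
Proof.
move=> mA mB AB0; have indU t : \1_(A `|` B) t = \1_A t + \1_B t :> R.
  rewrite !indicE in_setU; have [tA|] := boolP (t \in A); last by rewrite add0r.
  have [tB|] := boolP (t \in B); last by rewrite addr0.
  have : (A `&` B) t by split; exact: set_mem.
  by rewrite AB0.
apply/eqP; rewrite eq_le; apply/andP; split.
  apply: variation_le => f Ef fAB.
  have bnd C t : C `<=` A `|` B -> `|\1_C t *: f t| <= u t * \1_C t.
    move=> CAB; rewrite normrZ (@ger0_norm _ (\1_C t)) ?indic_ge0// mulrC.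
    apply: ler_wpM2r; rewrite ?indic_ge0//.
    exact: le_trans (fAB t) (scaled_indic_le _ t).
  rewrite (_ : f = (fun t => \1_A t *: f t) + (fun t => \1_B t *: f t)); last first.
    apply/funext => t; rewrite fctE -scalerDl -indU indicE.
    case: (boolP (t \in _)) => [_|tAB]; first by rewrite scale1r.
    have := fAB t; rewrite indicE (negbTE tAB) mulr0 normr_le0 => /eqP ->.
    by rewrite scaler0.
  rewrite kb_functionalD; [|exact: kb_mem_indic..].
  apply: lerD; apply: variation_ge; try exact: kb_mem_indic.
    by move=> t; apply: bnd; exact: subsetUl.
  by move=> t; apply: bnd; exact: subsetUr.
rewrite -lerBrDr; apply: variation_le => f Ef fA.
rewrite lerBrDr -lerBrDl; apply: variation_le => g Eg gB.
rewrite lerBrDl -kb_functionalD//; apply: variation_ge; first exact: kb_memD.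
by move=> t; rewrite indU mulrDr; apply: le_trans (ler_normD _ _) _; exact: lerD.
Qed.

Lemma exists_variation_measure : exists lam : {finite_measure set T -> \bar R},
  forall A, lam A = (dual_variation A)%:E.
Proof.
pose v A := (dual_variation A)%:E.
have v0 : v set0 = 0%E.
  by have := variationU measurable0 measurable0 (setI0 _); rewrite setU0 /v => ?; congr EFin; lra.
have vge0 A : (0 <= v A)%E by rewrite lee_fin variation_ge0.
have vadd : semi_sigma_additive v.
  apply: (@koethe_bounded_sigma_additive _ _ _ _ _ _ E_reflexive u Eu u0 dual_variation 1).
    exact: variationU.
  by move=> A mA; rewrite mul1r ger0_norm ?variation_ge0// variation_le_norm.
have vfin : fin_num_fun v by move=> A _.
pose M := isMeasure.Build d T R v v0 vge0 vadd.
pose m : {measure set T -> \bar R} := HB.pack v M.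
pose F := Measure_isFinite.Build d T R m vfin.
by exists (HB.pack_for {finite_measure set T -> \bar R} v M F).
Qed.

(** The scalar measures whose densities with respect to the variation become the
    values at [x] of a field of functionals. *)
Definition section_charge (x : X) A : R := L (fun t => (u t * \1_A t) *: x).

Lemma section_charge_mem x A : measurable A -> kb_mem E (fun t => (u t * \1_A t) *: x : X).
Proof.
move=> mA; apply: (kb_dominated _ (koethe_memZ `|x| Eu) _).1.
  apply: bochner_measurable_scale; last exact: bochner_measurable_cst.
  exact: koethe_measurable (koethe_mem_scaled_indic mA).
apply: aeW => t; rewrite normrZ fctE mulrC; apply: ler_wpM2l => //.
by rewrite ger0_norm ?scaled_indic_le// mulr_ge0 ?indic_ge0// ltW.
Qed.

Lemma section_charge_le x A : measurable A -> `|section_charge x A| <= `|x| * dual_variation A.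
Proof.
move=> mA; have [->|x0] := eqVneq x 0.
  rewrite normr0 mul0r /section_charge (_ : (fun _ => _) = 0) ?kb_functional0 ?normr0//.
  by apply/funext => t; rewrite scaler0.
have nx : 0 < `|x| by rewrite normr_gt0.
have H (a : R) : `|a| = `|x|^-1 -> a * section_charge x A <= dual_variation A.
  move=> ax; rewrite /section_charge -kb_functionalZ; last exact: section_charge_mem.
  apply: variation_ge; first exact/kb_memZ/section_charge_mem.
  move=> t; rewrite !fctE normrZ ax normrZ mulrCA mulVf ?gt_eqF// mulr1.
  by rewrite ger0_norm// mulr_ge0 ?indic_ge0// ltW.
rewrite -ler_pdivrMl// -[X in X * _](ger0_norm (_ : 0 <= `|x|^-1)) ?invr_ge0//.
rewrite -normrM ler_norml lerNl -mulNr !H ?normrN ?normfV ?normr_id//.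
Qed.

Lemma section_chargeU x A B : measurable A -> measurable B -> A `&` B = set0 ->
  section_charge x (A `|` B) = section_charge x A + section_charge x B.
Proof.
move=> mA mB AB0; rewrite /section_charge -kb_functionalD; try exact: section_charge_mem.
congr L; apply/funext => t; rewrite fctE -scalerDl -mulrDr; congr (_ * _ *: _).
rewrite !indicE in_setU; have [tA|] := boolP (t \in A); last by rewrite add0r.
have [tB|] := boolP (t \in B); last by rewrite addr0.
have : (A `&` B) t by split; exact: set_mem.
by rewrite AB0.
Qed.

Lemma section_charge_combination (I : Type) (x : I -> X) A (c : seq (R * I)) : measurable A ->
  \sum_(ai <- c) ai.1 * section_charge (x ai.2) A =
  section_charge (\sum_(ai <- c) ai.1 *: x ai.2) A.
Proof.
move=> mA; elim: c => [|ai c IH].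
  rewrite !big_nil /section_charge (_ : (fun _ => _) = 0) ?kb_functional0//.
  by apply/funext => t; rewrite scaler0.
rewrite !big_cons IH /section_charge -Llin; try exact: section_charge_mem.
by congr L; apply/funext => t; rewrite !fctE scalerDr !scalerA [ai.1 * _]mulrC.
Qed.

Lemma exists_section_density (lam : {finite_measure set T -> \bar R}) (x : X) :
  (forall A, lam A = (dual_variation A)%:E) ->
  exists r : T -> R, lam.-integrable setT (EFin \o r) /\
    forall A, measurable A -> (\int[lam]_(t in A) (r t)%:E = (section_charge x A)%:E)%E.
Proof.
move=> lamE; pose v A := (section_charge x A)%:E.
have v0 : v set0 = 0%E.
  have := section_chargeU x measurable0 measurable0 (setI0 _).
  by rewrite setU0 /v => ?; congr EFin; lra.
have vfin A : measurable A -> v A \is a fin_num by move=> _.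
have vadd : semi_sigma_additive v.
  apply: (@koethe_bounded_sigma_additive _ _ _ _ _ _ E_reflexive u Eu u0 (section_charge x) `|x|).
    exact: section_chargeU.
  move=> A mA; apply: le_trans (section_charge_le x mA) _.
  by rewrite ler_wpM2l// variation_le_norm.
pose nu : {charge set T -> \bar R} := HB.pack v (isCharge.Build d T R v v0 vfin vadd).
have nulam : nu `<< lam.
  move=> A lamA B mB BA; apply/eqP; rewrite eqe -normr_le0.
  apply: le_trans (section_charge_le x mB) _.
  have : (dual_variation B)%:E = 0%E by rewrite -lamE; exact: lamA.
  by move=> [->]; rewrite mulr0.
exists (fine \o Radon_Nikodym nu lam).
have rE : EFin \o (fine \o Radon_Nikodym nu lam) = Radon_Nikodym nu lam.
  by apply/funext => t /=; rewrite fineK// Radon_Nikodym_fin_num.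
split; first by rewrite rE; exact: Radon_Nikodym_integrable.
move=> A mA; rewrite -[RHS](_ : nu A = _)// (Radon_Nikodym_integral nulam mA).
by apply: eq_integral => t _; rewrite -[in RHS]rE.
Qed.
End variation.

(** * Integration against the variation *)

Section variation_integral.
Import HBNNSimple.
Context d (T : measurableType d) (R : realType) (mu : {measure set T -> \bar R}).
Context (cmu : measure_is_complete mu) (E : koethe_space cmu).
Context (u : T -> R) (Eu : koethe_mem E u) (u0 : forall t, 0 < u t).
Context (X : normedModType R) (L : (T -> X) -> R).
Context (Llin : forall a f g, kb_mem E f -> kb_mem E g -> L (a *: f + g) = a * L f + L g).
Context (LM : forall f, kb_mem E f -> L f <= kb_norm E f).
Context (lam : {finite_measure set T -> \bar R}).
Context (lamE : forall A, lam A = (dual_variation E u L A)%:E).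

(** The norm of [u] restricted to a null set is zero. *)
Lemma ae_variation (P : T -> Prop) : {ae mu, forall t, P t} -> {ae lam, forall t, P t}.
Proof.
move=> [N [mN N0 PN]]; exists N; split => //.
apply/eqP; rewrite eq_le measure_ge0 andbT lamE lee_fin.
apply: le_trans (variation_le_norm Eu u0 LM mN) _.
rewrite koethe_norm0//; first exact: koethe_mem_indic.
exists N; split => // t /= nt; apply: contrapT => Nt; apply: nt.
by rewrite indicE memNset// mulr0.
Qed.

(** Functions that are almost optimal for the variation of each [ac.1]
    combine into a single function whose norm obeys the pointwise bound. *)
Lemma variation_sum_approx (l : seq (set T * R)) (e : R) :
  all (fun ac => 0 <= ac.2) l -> 0 < e ->
  exists f : T -> X, [/\ kb_mem E f,
    forall t, `|f t| <= u t * \sum_(ac <- l) \1_(ac.1) t * ac.2 &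
    \sum_(ac <- l) ac.2 * dual_variation E u L ac.1 - e <= L f].
Proof.
elim: l e => [|[A c] l IH] e /= => [_ e0|/andP[c0 l0] e0].
  exists 0; split; first exact: kb_mem0.
    by move=> t; rewrite big_nil mulr0 normr0.
  by rewrite big_nil (kb_functional0 Llin) sub0r oppr_le0 ltW.
have e2 : 0 < e / 2 by rewrite divr_gt0.
have c1 : 0 < c + 1 by rewrite ltr_wpDl.
have [f [Ef fl Lf]] := IH _ l0 e2.
have [g [Eg gA Lg]] := variation_approx Eu u0 LM A (divr_gt0 e2 c1).
exists (c *: g + f); split; first exact: kb_memL.
  move=> t; rewrite big_cons/= mulrDr !fctE; apply: le_trans (ler_normD _ _) _.
  apply: lerD => //; rewrite normrZ ger0_norm// mulrA mulrC.
  exact: ler_wpM2r.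
rewrite big_cons/= Llin//.
have : c * (dual_variation E u L A - e / 2 / (c + 1)) <= c * L g by exact: ler_wpM2l.
have : c * (e / 2 / (c + 1)) <= e / 2.
  rewrite mulrCA -[leRHS]mulr1; apply: ler_wpM2l; first exact: ltW.
  by rewrite ler_pdivrMr// mul1r lerDl.
by rewrite mulrBr; lra.
Qed.

Lemma measurable_indic_sum (l : seq (set T * R)) :
  (forall ac, ac \in l -> measurable ac.1) ->
  measurable_fun setT (fun t => \sum_(ac <- l) \1_(ac.1) t * ac.2).
Proof.
elim: l => [|[A c] l IH] ml.
  by under eq_fun do rewrite big_nil; exact: measurable_cst.
under eq_fun do rewrite big_cons; apply: measurable_funD.
  apply: measurable_funM => //; apply: measurable_indic.
  by apply: (ml (A, c)); rewrite mem_head.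
by apply: IH => ac h; apply: ml; rewrite in_cons h orbT.
Qed.

Lemma integral_variation_sum (l : seq (set T * R)) :
  all (fun ac => 0 <= ac.2) l -> (forall ac, ac \in l -> measurable ac.1) ->
  (\int[lam]_t (\sum_(ac <- l) \1_(ac.1) t * ac.2)%:E =
   (\sum_(ac <- l) ac.2 * dual_variation E u L ac.1)%:E)%E.
Proof.
elim: l => [|[A c] l IH] /=.
  by move=> _ _; under eq_integral do rewrite big_nil; rewrite integral0 big_nil.
move=> /andP[c0 l0] ml.
have mA : measurable A by apply: (ml (A, c)); rewrite mem_head.
have ml' ac : ac \in l -> measurable ac.1 by move=> h; apply: ml; rewrite in_cons h orbT.
have sge0 t : 0 <= \sum_(ac <- l) \1_(ac.1) t * ac.2.
  elim: (l) l0 => [|ac l' IH'] /=; rewrite ?big_nil// big_cons => /andP[h1 /IH' h2].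
  by rewrite addr_ge0// mulr_ge0// indic_ge0.
have ms : measurable_fun setT (fun t => (\sum_(ac <- l) \1_(ac.1) t * ac.2)%:E).
  exact/measurable_EFinP/measurable_indic_sum.
under eq_integral do rewrite big_cons/= EFinD.
rewrite ge0_integralD//=; last 3 first.
- by move=> t _; rewrite lee_fin mulr_ge0// indic_ge0.
- by apply/measurable_EFinP; exact: measurable_funM.
- by move=> t _; rewrite lee_fin.
rewrite IH// big_cons EFinD/=; congr (_ + _)%E.
under eq_integral do rewrite EFinM.
rewrite ge0_integralZr//; last exact/measurable_EFinP.
by rewrite integral_indic// setIT [X in (X * _)%E]lamE muleC.
Qed.

(** For simple functions this follows from [variation_sum_approx], since a value
    of [L] is at most a norm; monotone convergence does the rest. *)
Lemma integral_variation_le (b : T -> R) : measurable_fun setT b ->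
  (forall t, 0 <= b t) -> koethe_mem E (fun t => u t * b t) ->
  (\int[lam]_t (b t)%:E <= (koethe_norm E (fun t => u t * b t))%:E)%E.
Proof.
move=> mb b0 Eub; have mb' : measurable_fun setT (EFin \o b) by exact/measurable_EFinP.
pose s := nnsfun_approx measurableT mb'.
have sb t : EFin \o s^~ t @ \oo --> (b t)%:E.
  by apply: (cvg_nnsfun_approx measurableT mb') => // x _; rewrite lee_fin.
have snd : nondecreasing_seq (s : (T -> R)^nat) := nd_nnsfun_approx measurableT mb'.
have sle n t : s n t <= b t.
  have /fine_cvg st := sb t; apply: (cvgr_to_ge st); near=> m.
  by apply/lefP/snd; near: m; exact: nbhs_infty_ge.
have := @cvg_monotone_convergence _ _ _ lam setT measurableT (fun n t => (s n t)%:E).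
have -> : (fun t => limn (fun n => (s n t)%:E)) = EFin \o b.
  by apply/funext => t; apply/cvg_lim => //; exact: sb.
move=> /(_ _ _ _)H; apply: (cvge_to_le (H _ _ _)).
- by move=> n; exact/measurable_EFinP.
- by move=> n t _; rewrite lee_fin.
- by move=> t _ m n mn; rewrite lee_fin; apply/lefP/snd.
apply: nearW => n.
have [l [ml sE]] := simple_function_sum (Z := R^o) (simple_function_sfun (s n)).
have l0 : all (fun ac => 0 <= ac.2) l.
  by apply/allP => ac /ml[_ [t _ <-]].
have {}sE t : s n t = \sum_(ac <- l) \1_(ac.1) t * ac.2 by exact: sE.
under eq_integral do rewrite sE.
rewrite integral_variation_sum//; last by move=> ac /ml[].
rewrite lee_fin; apply/ler_addgt0Pr => e e0.
have [f [Ef fl Lf]] := variation_sum_approx l0 e0.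
rewrite -lerBlDr; apply: le_trans Lf _.
apply: kb_functional_dominated => // t; apply: le_trans (fl t) _.
by rewrite -sE; apply: ler_wpM2l => //; exact: ltW.
Unshelve. all: by end_near. Qed.

Lemma measurable_inv_pos : measurable_fun setT (fun t => (u t)^-1).
Proof.
rewrite (_ : (fun t => _) = fun t => u t `^ (- 1)).
  exact: measurableT_comp (measurable_powR _) (koethe_measurable Eu).
by apply/funext => t; rewrite powR_inv1// ltW.
Qed.

(** It follows that [a |-> \int a / u] is a functional of norm at most one on
    [E]; it plays the role of the modulus of [L]. *)
Lemma koethe_integrable_variation (a : T -> R) : koethe_mem E a ->
  lam.-integrable setT (fun t => (a t / u t)%:E) /\
  (\int[lam]_t (`|a t| / u t)%:E <= (koethe_norm E a)%:E)%E.
Proof.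
move=> Ea; have ma : measurable_fun setT a := koethe_measurable Ea.
have uK t : u t * (`|a t| / u t) = `|a t| by rewrite mulrCA mulfV ?gt_eqF// mulr1.
have Eua : koethe_mem E (fun t => u t * (`|a t| / u t)).
  by under eq_fun do rewrite uK; exact: koethe_mem_norm.
have le : (\int[lam]_t (`|a t| / u t)%:E <= (koethe_norm E a)%:E)%E.
  apply: le_trans (integral_variation_le _ _ Eua) _.
  - by apply: measurable_funM measurable_inv_pos; exact: measurableT_comp.
  - by move=> t; rewrite divr_ge0// ltW.
  - under eq_fun do rewrite uK; rewrite lee_fin.
    apply: (koethe_ideal Ea _ _).2; first exact: measurableT_comp.
    by apply: aeW => t; rewrite normr_id.
split => //; apply/integrableP; split.
  apply/measurable_EFinP; exact: measurable_funM measurable_inv_pos.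
apply: le_lt_trans (ltry (koethe_norm E a)); apply: le_trans le.
rewrite le_eqVlt; apply/orP; left; apply/eqP; apply: eq_integral => t _.
by rewrite abse_EFin normrM (@gtr0_norm _ (_^-1)) ?invr_gt0.
Qed.

End variation_integral.

(** * Fields of functionals *)

Section functional_field.
Context d (T : measurableType d) (R : realType) (mu : {measure set T -> \bar R}).
Context (cmu : measure_is_complete mu) (E : koethe_space cmu).
Context (E_reflexive : reflexive_space (koethe E)).
Context (u : T -> R) (Eu : koethe_mem E u) (u0 : forall t, 0 < u t).
Context (X : normedModType R) (L : (T -> X) -> R).
Context (Llin : forall a f g, kb_mem E f -> kb_mem E g -> L (a *: f + g) = a * L f + L g).
Context (LM : forall f, kb_mem E f -> L f <= kb_norm E f).
Context (lam : {finite_measure set T -> \bar R}).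
Context (lamE : forall A, lam A = (dual_variation E u L A)%:E).

Lemma ae_le_integral (g : T -> R) (K : R) : lam.-integrable setT (EFin \o g) ->
  (forall A, measurable A -> (\int[lam]_(t in A) (g t)%:E <= K%:E * lam A)%E) ->
  {ae lam, forall t, g t <= K}.
Proof.
move=> ig gK; pose A := [set t | K < g t].
have mg : measurable_fun setT g by apply/measurable_EFinP; exact: measurable_int ig.
have mA : measurable A by rewrite -[A]setTI; exact: measurable_fun_ltr.
have igA : lam.-integrable A (EFin \o g) by exact: integrableS ig.
have iK : lam.-integrable A (EFin \o cst K).
  by apply: (integrableS measurableT) => //; exact: finite_measure_integrable_cst.
(* [g - K] is positive on [A] and has a nonpositive integral there. *)
have h0 : (\int[lam]_(t in A) `|(g t)%:E - K%:E| = 0)%E.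
  apply/eqP; rewrite eq_le integral_ge0// andbT.
  rewrite (eq_integral (fun t => (g t)%:E - K%:E)%E); last first.
    move=> t /set_mem At; rewrite gee0_abs// -EFinB lee_fin subr_ge0 ltW//.
  by rewrite integralB// integral_cst// sube_le0 ?gK.
have mh : measurable_fun A (fun t => (g t)%:E - K%:E)%E.
  by apply/measurable_EFinP; apply: measurable_funB => //; exact: measurable_funS mg.
have := (ae_eq_integral_abs lam mA mh).1 h0.
apply: filterS => t /= H; rewrite leNgt; apply/negP => At.
by have := H At; rewrite -EFinB => -[]; lra.
Qed.

Lemma ae_forall_count (I : countType) (P : I -> T -> Prop) :
  (forall i, {ae lam, forall t, P i t}) -> {ae lam, forall t, forall i, P i t}.
Proof.
move=> H; have : {ae lam, forall t, forall n, if unpickle n is Some i then P i t else True}.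
  apply: ae_foralln => n; case: (unpickle n) => [i|]; first exact: H.
  exact: aeW.
by apply: filterS => t Ht i; have := Ht (pickle i); rewrite pickleK.
Qed.

(** Integrated over [A], the combination of the densities gives the value of a
    section charge, which is at most the norm of the combined vector times the
    variation of [A]. *)
Lemma density_combination (I : Type) (x : I -> X) (r : I -> T -> R) (c : seq (R * I)) :
  (forall i, lam.-integrable setT (EFin \o r i) /\
    forall A, measurable A ->
      (\int[lam]_(t in A) (r i t)%:E = (section_charge u L (x i) A)%:E)%E) ->
  {ae lam, forall t, \sum_(ai <- c) ai.1 * r ai.2 t <= `|\sum_(ai <- c) ai.1 *: x ai.2|}.
Proof.
move=> rP.
have [ig gE] : lam.-integrable setT (fun t => (\sum_(ai <- c) ai.1 * r ai.2 t)%:E) /\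
    forall A, measurable A -> (\int[lam]_(t in A) (\sum_(ai <- c) ai.1 * r ai.2 t)%:E =
      (\sum_(ai <- c) ai.1 * section_charge u L (x ai.2) A)%:E)%E.
  elim: c => [|[a i] c [IH1 IH2]].
    split; first by under eq_fun do rewrite big_nil; exact: integrable0.
    move=> A mA; rewrite big_nil; under eq_integral do rewrite big_nil.
    exact: integral0.
  have [ri riE] := rP i.
  have iar : lam.-integrable setT (fun t => (a%:E * (r i t)%:E)%E) by exact: integrableZl.
  split.
    by under eq_fun do rewrite big_cons EFinD EFinM; exact: integrableD.
  move=> A mA; under eq_integral do rewrite big_cons EFinD EFinM.
  rewrite integralD//=; [|exact: integrableS iar|exact: integrableS IH1].
  rewrite integralZl//; last exact: integrableS ri.
  by rewrite IH2// riE// big_cons.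
apply: ae_le_integral => // A mA; rewrite gE// (section_charge_combination Eu u0 Llin)//.
rewrite lamE -EFinM lee_fin; apply: le_trans (ler_norm _) _.
exact: section_charge_le.
Qed.

(** [rational_combination] in the product [X * R] approximates the vector and
    the scalar combination by the same rational coefficients. *)
Lemma interpolation_of_rational (I : Type) (x : I -> X) (r : I -> R) :
  (forall q : seq (rat * I), \sum_(ai <- q) ratr ai.1 * r ai.2 <=
    `|\sum_(ai <- q) ratr ai.1 *: x ai.2|) ->
  forall c : seq (R * I),
    \sum_(ai <- c) ai.1 * r ai.2 <= `|\sum_(ai <- c) ai.1 *: x ai.2|.
Proof.
move=> H c; apply/ler_addgt0Pr => e e0; have e2 : 0 < e / 2 by rewrite divr_gt0.
have [q] := @rational_combination R (X * R^o)%type I (fun i => (x i, r i)) c _ e2.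
have pairE (K : Type) (k : K -> R) (c' : seq (K * I)) :
    \sum_(ai <- c') k ai.1 *: ((x ai.2, r ai.2) : X * R^o) =
    (\sum_(ai <- c') k ai.1 *: x ai.2, \sum_(ai <- c') k ai.1 * r ai.2).
  elim: c' => [|ai c' IH]; first by rewrite !big_nil.
  by rewrite !big_cons IH.
rewrite (pairE _ id) (pairE _ ratr) prod_normE gt_max => /andP[/= qx qr].
have := H q; have := le_lt_trans (ler_norm _) qr.
have := ler_normB (\sum_(ai <- c) ai.1 *: x ai.2)
  (\sum_(ai <- c) ai.1 *: x ai.2 - \sum_(ai <- q) ratr ai.1 *: x ai.2).
by rewrite subKr; lra.
Qed.

(** Outside a null set the Radon-Nikodym densities of the section charges of
    all the [x i] satisfy Helly's condition for rational, hence for real,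
    combinations, so at each such point a functional interpolates them. Countability
    of [I] leaves a single exceptional set; taking the zero functional there keeps
    the functions [t |-> F t (x i)] measurable. *)
Lemma exists_functional_field (I : countType) (x : I -> X) :
  exists F : T -> dual_space X, (forall t, `|F t| <= 1) /\
    forall i, lam.-integrable setT (fun t => (F t (x i))%:E) /\
      forall A, measurable A ->
        (\int[lam]_(t in A) (F t (x i))%:E = (section_charge u L (x i) A)%:E)%E.
Proof.
have /choice[r rP] (i : I) := exists_section_density E_reflexive Eu u0 Llin LM (x i) lamE.
have [N [mN N0 rN]] : {ae lam, forall t, forall q : seq (rat * I),
    \sum_(ai <- q) ratr ai.1 * r ai.2 t <= `|\sum_(ai <- q) ratr ai.1 *: x ai.2|}.
  apply: ae_forall_count => q.
  have := density_combination [seq (ratr ai.1 : R, ai.2) | ai <- q] rP.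
  by apply: filterS => t; rewrite !big_map.
have /choice[F FP] (t : T) : exists phi : dual_space X,
    `|phi| <= 1 /\ forall i, phi (x i) = r i t * \1_(~` N) t.
  have [Nt|nNt] := pselect (N t).
    exists 0; rewrite normr0; split => // i.
    by rewrite indicE memNset ?mulr0//; apply.
  have [|phi [phi1 phiE]] := @exists_dual_interpolation R X I x (fun i => r i t).
    apply: (@interpolation_of_rational _ x (fun i => r i t)).
    by apply: contrapT => nt; apply: nNt; exact: rN.
  by exists phi; split => // i; rewrite phiE indicE mem_set// mulr1.
exists F; split; first by move=> t; have [] := FP t.
move=> i; have [ri rE] := rP i.
have Fr : ae_eq lam setT (fun t => (F t (x i))%:E) (EFin \o r i).
  exists N; split => // t /= /not_implyP[_ nt]; apply: contrapT => Nt; apply: nt.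
  by rewrite (FP t).2 indicE mem_set ?mulr1.
have mr : measurable_fun setT (r i) by apply/measurable_EFinP; exact: measurable_int ri.
have mF : measurable_fun setT (fun t => (F t (x i))%:E).
  apply/measurable_EFinP; rewrite (_ : (fun t => _) = fun t => r i t * \1_(~` N) t).
    by apply: measurable_funM => //; apply: measurable_indic; exact: measurableC.
  by apply/funext => t; rewrite (FP t).2.
split.
  have ix : lam.-integrable setT (EFin \o cst `|x i|) by exact: finite_measure_integrable_cst.
  apply: (le_integrable measurableT mF _ ix).
  by move=> t _ /=; rewrite lee_fin normr_id; apply: dual_ler1; have [] := FP t.
move=> A mA; rewrite -rE//; apply: ae_eq_integral => //.
- exact: measurable_funS mF.
- by apply/measurable_EFinP; exact: measurable_funS mr.
- exact: ae_eq_subset Fr.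
Qed.

End functional_field.

(** * Integral representation of functionals *)

Section representation.
Context d (T : measurableType d) (R : realType) (mu : {measure set T -> \bar R}).
Context (cmu : measure_is_complete mu) (E : koethe_space cmu).
Context (E_reflexive : reflexive_space (koethe E)).
Context (u : T -> R) (Eu : koethe_mem E u) (u0 : forall t, 0 < u t).
Context (X : normedModType R) (L : (T -> X) -> R).
Context (Llin : forall a f g, kb_mem E f -> kb_mem E g -> L (a *: f + g) = a * L f + L g).
Context (LM : forall f, kb_mem E f -> L f <= kb_norm E f).
Context (lam : {finite_measure set T -> \bar R}).
Context (lamE : forall A, lam A = (dual_variation E u L A)%:E).

Lemma functional_field_simple (I : eqType) (x : I -> X) (F : T -> dual_space X)
    (l : seq (set T * I)) (S : T -> X) :
  (forall i, lam.-integrable setT (fun t => (F t (x i))%:E) /\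
    forall A, measurable A ->
      (\int[lam]_(t in A) (F t (x i))%:E = (section_charge u L (x i) A)%:E)%E) ->
  (forall Ai, Ai \in l -> measurable Ai.1) ->
  (forall t, S t = \sum_(Ai <- l) \1_(Ai.1) t *: x Ai.2) ->
  [/\ kb_mem E (fun t => u t *: S t), lam.-integrable setT (fun t => (F t (S t))%:E) &
    (\int[lam]_t (F t (S t))%:E = (L (fun t => u t *: S t))%:E)%E].
Proof.
move=> FP; elim: l S => [|[A i] l IH] S ml SE.
  have S0 t : S t = 0 by rewrite SE big_nil.
  have uS0 : (fun t => u t *: S t) = 0 by apply/funext => t; rewrite S0 scaler0.
  rewrite uS0 (kb_functional0 Llin); split; first exact: kb_mem0.
    by under eq_fun do rewrite S0 dual0; exact: integrable0.
  by under eq_integral do rewrite S0 dual0; exact: integral0.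
have mA : measurable A by apply: (ml (A, i)); rewrite mem_head.
pose S' t := \sum_(Ai <- l) \1_(Ai.1) t *: x Ai.2.
have [||ES iS LS] := IH S' => //.
  by move=> Ai h; apply: ml; rewrite in_cons h orbT.
have {}SE t : S t = \1_A t *: x i + S' t by rewrite SE big_cons.
have uSE : (fun t => u t *: S t) = (fun t => (u t * \1_A t) *: x i) + (fun t => u t *: S' t).
  by apply/funext => t; rewrite fctE SE scalerDr scalerA.
have EA := section_charge_mem Eu u0 (x i) mA.
have [Fi FiE] := FP i.
have FSE t : (F t (S t))%:E = ((F t (x i) * \1_A t)%:E + (F t (S' t))%:E)%E.
  by rewrite SE dualD dualZ EFinD mulrC.
have iA : lam.-integrable setT (fun t => (F t (x i) * \1_A t)%:E).
  apply: (le_integrable measurableT _ _ Fi).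
    apply/measurable_EFinP; apply: measurable_funM => //.
    by apply/measurable_EFinP; exact: measurable_int Fi.
  move=> t _; rewrite lee_fin normrM; apply: ler_piMr => //.
  by rewrite ger0_norm ?indic_ge0 ?indic_le1.
split; first by rewrite uSE; exact: kb_memD.
  by under eq_fun do rewrite FSE; exact: integrableD.
under eq_integral do rewrite FSE.
rewrite integralD// LS uSE (kb_functionalD Llin)// EFinD; congr (_ + _)%E.
rewrite -[RHS]FiE// [RHS]integral_mkcond; apply: eq_integral => t _.
by rewrite patchE indicE; case: ifP => _; rewrite ?mulr1 ?mulr0.
Qed.

(** Truncating approximating simple functions where they exceed twice the norm
    of their limit makes them dominated without affecting the limit. *)
Lemma kb_simple_approx (f : T -> X) : kb_mem E f ->
  exists l : nat -> seq (set T * X),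
  [/\ forall k Ax, Ax \in l k -> measurable Ax.1,
    forall k t, `|\sum_(Ax <- l k) \1_(Ax.1) t *: Ax.2| <= 2 * (`|f t| / u t) &
    {ae mu, forall t, \sum_(Ax <- l k) \1_(Ax.1) t *: Ax.2 @[k --> \oo] --> (u t)^-1 *: f t}].
Proof.
move=> [bf Ef]; pose h t := (u t)^-1 *: f t.
have hn t : `|h t| = `|f t| / u t.
  by rewrite normrZ gtr0_norm ?invr_gt0// mulrC.
have bh : bochner_measurable mu h.
  exact: bochner_measurable_scale (measurable_inv_pos Eu u0) bf.
have [s [ss sh]] := bh.
pose B k := [set t | `|s k t| <= 2 * `|h t|].
have mB k : measurable (B k).
  rewrite -[B k]setTI; apply: measurable_fun_ler => //.
    exact: (bochner_measurable_norm cmu (simple_bochner_measurable mu (ss k))).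
  by apply: measurable_funM => //; exact: (bochner_measurable_norm cmu bh).
have /choice[l lP] (k : nat) := simple_function_sum (ss k).
pose l' k := [seq (Ax.1 `&` B k, Ax.2) | Ax <- l k].
have lE k t : \sum_(Ax <- l' k) \1_(Ax.1) t *: Ax.2 = \1_(B k) t *: s k t.
  rewrite (lP k).2 scaler_sumr big_map; apply: eq_bigr => Ax _ /=.
  by rewrite indicI scalerA mulrC.
exists l'; split.
- move=> k _ /mapP[Ax /(lP k).1[mA _] ->] /=; exact: measurableI.
- move=> k t; rewrite lE -hn indicE.
  have [/set_mem tB|tB] := boolP (t \in B k); first by rewrite scale1r.
  by rewrite scale0r normr0 mulr_ge0.
- apply: filterS sh => t st; under eq_fun do rewrite lE.
  have [h0|h0] := eqVneq (h t) 0.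
    rewrite -/(h t) h0; apply: cvg_near_cst; apply: nearW => k.
    rewrite indicE; have [/set_mem|_] := boolP (t \in B k); last by rewrite scale0r.
    by rewrite /B/= h0 normr0 mulr0 normr_le0 scale1r => /eqP.
  have stn : `|s k t| @[k --> \oo] --> `|h t| by exact: cvg_norm.
  apply: cvg_trans st; apply: near_eq_cvg.
  have hlt : `|h t| < 2 * `|h t| by rewrite ltr_pMl ?normr_gt0// ltr1n.
  have H : \forall k \near \oo, `|s k t| < 2 * `|h t| by exact: (cvgr_lt _ stn _ hlt).
  apply: filterS H => k sk; rewrite indicE mem_set ?scale1r//.
  exact: ltW.
Qed.

(** The simple functions approximating the [f j] take countably many values in
    total, so one field of functionals represents [L] on all of them. The limit is
    taken by dominated convergence in the norm of [E] for [L], and for the measure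
    [lam] in the integral. *)
Lemma kb_functional_representation (J : countType) (f : J -> T -> X) :
  (forall j, kb_mem E (f j)) ->
  exists F : T -> dual_space X, (forall t, `|F t| <= 1) /\
    forall j, measurable_fun setT (fun t => F t (f j t)) /\
      (\int[lam]_t (F t (f j t) / u t)%:E = (L (f j))%:E)%E.
Proof.
move=> Ef; have /choice[l lP] (j : J) := kb_simple_approx (Ef j).
(* The [i]-th value of the [k]-th simple function approximating [f j]. *)
pose x (jki : J * nat * nat) : X := (nth (set0, 0) (l jki.1.1 jki.1.2) jki.2).2.
have [F [F1 FP]] := exists_functional_field E_reflexive Eu u0 Llin LM lamE x.
exists F; split => // j; have [ml lle lcvg] := lP j.
pose S k t := \sum_(Ax <- l j k) \1_(Ax.1) t *: Ax.2.
pose l2 k := [seq ((nth (set0, 0) (l j k) i).1, (j, k, i)) | i <- index_iota 0 (size (l j k))].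
have SE k t : S k t = \sum_(Ai <- l2 k) \1_(Ai.1) t *: x Ai.2.
  by rewrite big_map /S [LHS](big_nth (set0, 0)).
have ml2 k Ai : Ai \in l2 k -> measurable Ai.1.
  move=> /mapP[i]; rewrite mem_index_iota => /andP[_ il] -> /=.
  by apply: (ml k); exact: mem_nth.
have fs k := functional_field_simple FP (@ml2 k) (SE k).
have ES k : kb_mem E (fun t => u t *: S k t).
  by have [] := fs k.
have mFS k : measurable_fun setT (fun t => F t (S k t)).
  have [_ iS _] := fs k.
  by apply/measurable_EFinP; exact: measurable_int iS.
have LS k : (\int[lam]_t (F t (S k t))%:E = (L (fun t => u t *: S k t))%:E)%E.
  by have [] := fs k.
have FV t : F t ((u t)^-1 *: f j t) = F t (f j t) / u t by rewrite dualZ mulrC.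
have Fcvg : {ae mu, forall t, F t (S k t) @[k --> \oo] --> F t (f j t) / u t}.
  apply: filterS lcvg => t lt; rewrite -FV.
  exact: (continuous_cvg _ (@dual_continuous _ _ (F t) _) lt).
have mFu : measurable_fun setT (fun t => F t (f j t) / u t).
  exact: (ae_cvg_measurable cmu mFS Fcvg).
have uS0 : kb_norm E ((fun k t => u t *: S k t) k - f j) @[k --> \oo] --> (0 : R).
  apply: (koethe_dominated_cvg0 E_reflexive (g := 3 *: (fun t => `|f j t|))).
  - by move=> k; have [] := kb_memB (ES k) (Ef j).
  - by apply: koethe_memZ; have [] := Ef j.
  - move=> k; apply: aeW => t; rewrite normr_id !fctE.
    apply: le_trans (ler_normB _ _) _.
    rewrite normrZ gtr0_norm// /GRing.scale/=.
    have ufE : u t * (2 * (`|f j t| / u t)) = 2 * `|f j t|.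
      by rewrite mulrCA; congr (2 * _); rewrite mulrCA mulfV ?gt_eqF// mulr1.
    have := ler_wpM2l (ltW (u0 t)) (lle k t); rewrite ufE -/(S k t).
    by have := normr_ge0 (f j t); lra.
  - apply: filterS lcvg => t lt; rewrite -(@normr0 _ X) -(subrr (f j t)).
    apply: cvg_norm; apply: cvgB; last exact: cvg_cst.
    rewrite -[X in _ --> X](_ : u t *: ((u t)^-1 *: f j t) = _); last first.
      by rewrite scalerA mulfV ?gt_eqF// scale1r.
    by apply: cvgZr.
have LScvg : L (fun t => u t *: S k t) @[k --> \oo] --> L (f j).
  apply/cvgrPdistC_le => e e0; move/cvgrPdist_le : uS0 => /(_ e e0).
  apply: filterS => k /=; rewrite sub0r normrN => Ne.
  rewrite -(kb_functionalB Llin (ES k) (Ef j)).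
  apply: le_trans (kb_functional_norm Llin LM (kb_memB (ES k) (Ef j))) _.
  exact: le_trans (ler_norm _) Ne.
split.
  rewrite (_ : (fun t => _) = fun t => F t (f j t) / u t * u t).
    exact: measurable_funM mFu (koethe_measurable Eu).
  by apply/funext => t; rewrite divfK ?gt_eqF.
have [_ Efn] := Ef j.
have [if2 _] := koethe_integrable_variation Eu u0 Llin LM lamE Efn.
have if3 : lam.-integrable setT (fun t => (2%:E * (`|f j t| / u t)%:E)%E) by exact: integrableZl.
have mFS' k : measurable_fun setT (fun t => (F t (S k t))%:E) by exact/measurable_EFinP.
have mFu' : measurable_fun setT (fun t => (F t (f j t) / u t)%:E) by exact/measurable_EFinP.
have [||_ _ IS] := dominated_convergence measurableT mFS' mFu' _ if3.
- apply: filterS (ae_variation Eu u0 LM lamE Fcvg) => t Ft _.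
  by apply: cvg_EFin => //; exact: nearW.
- apply: aeW => t k _; rewrite -EFinM lee_fin.
  exact: le_trans (dual_ler1 _ (F1 t)) (lle k t).
rewrite (_ : [sequence _]_ _ = fun k => (L (fun t => u t *: S k t))%:E) in IS; last first.
  by apply/funext => k; exact: LS.
have IL : (L (fun t => u t *: S k t))%:E @[k --> \oo] --> (L (f j))%:E.
  by apply: cvg_EFin => //; exact: nearW.
exact: (cvg_unique (@ereal_hausdorff R) IS IL).
Qed.

End representation.

(** * Convergence in mean *)

Section mean_convergence.
Context d (T : measurableType d) (R : realType) (lam : {measure set T -> \bar R}).

(** Along a subsequence with summable integrals the sum of the series has a
    finite integral, hence is finite almost everywhere. *)
Lemma mean_cvg0_ae_subseq (q : nat -> T -> R) :
  (forall n, measurable_fun setT (q n)) -> (forall n t, 0 <= q n t) ->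
  (\int[lam]_t (q n t)%:E)%E @[n --> \oo] --> 0%E ->
  exists2 j : nat -> nat, (forall n, (n <= j n)%N) &
    {ae lam, forall t, q (j n) t @[n --> \oo] --> (0 : R)}.
Proof.
move=> mq q0 qcvg; pose e n : R := 1 / (2 ^ n.+1)%:R.
have e0 n : 0 < e n by rewrite divr_gt0// ltr0n expn_gt0.
have /choice[j /all_and2[jn jq]] (n : nat) : exists m, (n <= m)%N /\
    (\int[lam]_t (q m t)%:E <= (e n)%:E)%E.
  have H : \forall m \near \oo, (\int[lam]_t (q m t)%:E <= (e n)%:E)%E.
    have /fine_cvgP[qfin /cvgrPdist_le/(_ _ (e0 n)) qe] := qcvg.
    apply: filterS2 qfin qe => m fm; rewrite sub0r normrN => /(le_trans (ler_norm _)) /=.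
    by rewrite -lee_fin fineK.
  have [m [nm Hm]] := filter_ex (filterI (nbhs_infty_ge n) H).
  by exists m.
exists j => //.
have mqE n : measurable_fun setT (fun t => (q (j n) t)%:E) by exact/measurable_EFinP.
have q0E n t : setT t -> (0 <= (q (j n) t)%:E)%E by rewrite lee_fin.
pose Q t := (\sum_(n <oo) (q (j n) t)%:E)%E.
have mQ : measurable_fun setT Q.
  by apply: ge0_emeasurable_sum => // n t _ _; rewrite lee_fin.
have Q0 t : (0 <= Q t)%E by apply: nneseries_ge0 => n _ _; rewrite lee_fin.
have fin : (\int[lam]_t Q t < +oo)%E.
  rewrite integral_nneseries//.
  apply: (@le_lt_trans _ _ (\sum_(n <oo) (e n)%:E)%E).
    by apply: lee_nneseries => // n _ _; apply: integral_ge0 => t _; rewrite lee_fin.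
  exact: le_lt_trans (epsilon_trick0 xpredT ler01) (ltry _).
have iQ : lam.-integrable setT Q.
  apply/integrableP; split => //.
  by under eq_integral do rewrite gee0_abs//.
apply: filterS (integrable_ae measurableT iQ) => t /(_ I) Qt.
have Qoo : (Q t < +oo)%E by rewrite ltey_eq Qt.
have := nneseries_tail_cvg Qoo (fun n _ => q0E n t I).
move=> tail; suff /fine_cvg : (q (j n) t)%:E @[n --> \oo] --> (0 : R)%:E by [].
apply: (squeeze_cvge _ (cvg_cst 0%E) tail); apply: nearW => n.
rewrite lee_fin q0/=.
have := @nneseries_lim_ge R (fun n => (q (j n) t)%:E) xpredT n n.+1 (fun m _ _ => q0E m t I).
by rewrite big_nat1.
Qed.

(** The minimum of [r n] and [c] is dominated by [c], and [r n] exceeds it by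
    at most [q n]. *)
Lemma mean_dominated_cvg0 (r q : nat -> T -> R) (c : T -> R) :
  (forall n, measurable_fun setT (r n)) -> (forall n, measurable_fun setT (q n)) ->
  (forall n t, 0 <= q n t) -> (forall n t, 0 <= r n t) -> (forall t, 0 <= c t) ->
  lam.-integrable setT (EFin \o c) ->
  (forall n t, r n t <= c t + q n t) ->
  (\int[lam]_t (q n t)%:E)%E @[n --> \oo] --> 0%E ->
  {ae lam, forall t, r n t @[n --> \oo] --> (0 : R)} ->
  (\int[lam]_t (r n t)%:E)%E @[n --> \oo] --> 0%E.
Proof.
move=> mr mq q0 r0 c0 ic rcq qcvg rcvg.
have mc : measurable_fun setT c by apply/measurable_EFinP; exact: measurable_int ic.
pose m n t := Num.min (r n t) (c t).
have mm n : measurable_fun setT (m n) by exact: measurable_minr.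
have m0 n t : 0 <= m n t by rewrite le_min r0 c0.
have mcvg : (\int[lam]_t (m n t)%:E)%E @[n --> \oo] --> 0%E.
  have mmE n : measurable_fun setT (fun t => (m n t)%:E) by exact/measurable_EFinP.
  have [| |_ _] := @dominated_convergence _ _ _ lam setT measurableT _ (cst 0%E) _
      mmE (measurable_cst _) _ ic.
  - apply: filterS rcvg => t rt _; apply: cvg_EFin; first exact: nearW.
    apply: (squeeze_cvgr _ (cvg_cst 0) rt); apply: nearW => n /=.
    by rewrite m0 ge_min lexx.
  - apply: aeW => t n _ /=; rewrite lee_fin ger0_norm//.
    by rewrite ge_min lexx orbT.
  - by rewrite integral0.
have sumcvg : (\int[lam]_t (m n t)%:E + \int[lam]_t (q n t)%:E)%E @[n --> \oo] --> 0%E.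
  by rewrite -[X in _ --> X]adde0; apply: cvgeD.
apply: (squeeze_cvge _ (cvg_cst 0%E) sumcvg); apply: nearW => n.
rewrite integral_ge0/=; last by move=> t _; rewrite lee_fin.
rewrite -ge0_integralD//; try by [move=> t _; rewrite lee_fin|exact/measurable_EFinP].
apply: ge0_le_integral => //; try by [move=> t _; rewrite lee_fin|exact/measurable_EFinP].
- by apply: emeasurable_funD; exact/measurable_EFinP.
- move=> t _; rewrite -EFinD lee_fin /m.
  have [rc|cr] := leP (r n t) (c t); first by rewrite lerDl.
  exact: rcq.
Qed.

Lemma mean_cvg0D (p q : nat -> T -> R) :
  (forall n, measurable_fun setT (p n)) -> (forall n, measurable_fun setT (q n)) ->
  (forall n t, 0 <= p n t) -> (forall n t, 0 <= q n t) ->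
  (\int[lam]_t (p n t)%:E)%E @[n --> \oo] --> 0%E ->
  (\int[lam]_t (q n t)%:E)%E @[n --> \oo] --> 0%E ->
  (\int[lam]_t (p n t + q n t)%:E)%E @[n --> \oo] --> 0%E.
Proof.
move=> mp mq p0 q0 pcvg qcvg; rewrite -[X in _ --> X]adde0.
rewrite (_ : (fun n => _) =
    fun n => (\int[lam]_t (p n t)%:E + \int[lam]_t (q n t)%:E)%E).
  exact: cvgeD.
apply/funext => n; under eq_integral do rewrite EFinD.
by rewrite ge0_integralD//; try by [move=> t _; rewrite lee_fin|exact/measurable_EFinP].
Qed.

End mean_convergence.

(** * Norming sequences in a Koethe space *)

Section koethe_sequences.
Context d (T : measurableType d) (R : realType) (mu : {measure set T -> \bar R}).
Context (cmu : measure_is_complete mu) (E : koethe_space cmu).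

Notation kclass Ef := (fclass (F := koethe_fun_space E) Ef : koethe E).

Lemma dual_norm_cvg (V : normedModType R) (x : V ^nat) (z : V) (phi : dual_space V) :
  `|x n - z| @[n --> \oo] --> (0 : R) -> phi (x n) @[n --> \oo] --> phi z.
Proof.
move=> xz; apply/cvgrPdistC_le => e e0.
have [M0 /=] : exists M0 : R, 0 < M0 /\ `|phi| <= M0.
  by exists (`|phi| + 1); split; rewrite ?ltr_wpDl// lerDl.
move=> [M00 phiM].
move/cvgrPdist_le : xz => /(_ (e / M0)); rewrite divr_gt0// => /(_ isT).
apply: filterS => n; rewrite sub0r normrN normr_id ler_pdivlMr// => xe.
rewrite -dualB; apply: le_trans (dual_ler _ _) _; apply: le_trans xe.
by rewrite mulrC ler_wpM2l.
Qed.

Lemma koethe_norm_le (f g : T -> R) : koethe_mem E f -> koethe_mem E g ->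
  (forall t, 0 <= f t) -> (forall t, f t <= g t) -> koethe_norm E f <= koethe_norm E g.
Proof.
move=> Ef Eg f0 fg; apply: (koethe_ideal Eg (koethe_measurable Ef) _).2.
by apply: aeW => t; rewrite !ger0_norm// (le_trans (f0 t)).
Qed.

(** The property is used twice: for [a] and [b], and then for [a + b] and [h],
    whose sum is at least [2 h]. *)
Lemma koethe_wuacs_sum (a b h : nat -> T -> R) (Lam : dual_space (koethe E))
    (Ea : forall n, koethe_mem E (a n)) (Eb : forall n, koethe_mem E (b n))
    (Eh : forall n, koethe_mem E (h n)) :
  wuacs (koethe E) -> `|Lam| <= 1 ->
  (forall n t, 0 <= h n t) -> (forall n t, h n t <= a n t + b n t) ->
  (forall n, koethe_norm E (a n) = 1) -> (forall n, koethe_norm E (b n) = 1) ->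
  koethe_norm E (h n) @[n --> \oo] --> (2 : R) ->
  Lam (kclass (Ea n)) @[n --> \oo] --> (1 : R) ->
  [/\ `|kclass (Ea n) + kclass (Eb n)| @[n --> \oo] --> (2 : R),
      Lam (kclass (Eb n)) @[n --> \oo] --> (1 : R) &
      Lam (kclass (Eh n)) @[n --> \oo] --> (2 : R)].
Proof.
move=> EW Lam1 h0 hab a1 b1 h2 La.
pose x n := kclass (Ea n); pose y n := kclass (Eb n); pose z n := kclass (Eh n).
have xyE n : x n + y n = kclass (koethe_memD (Ea n) (Eb n)).
  by apply/esym/fclassD; exact: aeW.
have xyzE n : x n + y n + z n = kclass (koethe_memD (koethe_memD (Ea n) (Eb n)) (Eh n)).
  by rewrite xyE; apply/esym/fclassD; exact: aeW.
have x1 n : `|x n| = 1 by rewrite /x norm_fclass -[RHS](a1 n).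
have y1 n : `|y n| = 1 by rewrite /y norm_fclass -[RHS](b1 n).
have zn n : `|z n| = koethe_norm E (h n) by rewrite /z norm_fclass.
have cst1 (v : nat -> koethe E) : (forall n, `|v n| = 1) -> `|v n| @[n --> \oo] --> (1 : R).
  by move=> v1; rewrite (_ : (fun n => _) = fun=> 1); [exact: cvg_cst|exact/funext].
have xy_ge n : koethe_norm E (h n) <= `|x n + y n|.
  rewrite xyE norm_fclass.
  exact: (koethe_norm_le (Eh n) (koethe_memD (Ea n) (Eb n)) (h0 n) (hab n)).
have xy_le n : `|x n + y n| <= 2.
  by apply: le_trans (ler_normD _ _) _; rewrite x1 y1.
have xy2 : `|x n + y n| @[n --> \oo] --> (2 : R).
  apply: (squeeze_cvgr _ h2 (h := fun=> 2)); last exact: cvg_cst.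
  by apply: nearW => n; rewrite xy_ge xy_le.
have Ly : Lam (y n) @[n --> \oo] --> (1 : R).
  exact: (wuacs_cvg EW ltr01 ler01 Lam1 (cst1 _ x1) (cst1 _ y1) xy2 La).
split => //.
have z2 : `|z n| @[n --> \oo] --> (2 : R) by under eq_fun do rewrite zn.
have xyz4 : `|x n + y n + z n| @[n --> \oo] --> (2 + 2 : R).
  have l4 : 2 * koethe_norm E (h n) @[n --> \oo] --> (2 + 2 : R).
    by rewrite (_ : 2 + 2 = 2 * 2 :> R); [exact: cvgMr|ring].
  have u4 : 2 + koethe_norm E (h n) @[n --> \oo] --> (2 + 2 : R).
    by apply: cvgD => //; exact: cvg_cst.
  apply: (squeeze_cvgr _ l4 u4); apply: nearW => n; apply/andP; split.
    rewrite -[X in X * _](ger0_norm (ler0n R 2)) -koethe_normZ// xyzE norm_fclass.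
    apply: (koethe_norm_le (koethe_memZ 2 (Eh n)) (koethe_memD (koethe_memD (Ea n) (Eb n)) (Eh n))).
      by move=> t; rewrite /GRing.scale/= mulr_ge0.
    by move=> t; have := hab n t; rewrite !fctE /GRing.scale/=; lra.
  by apply: le_trans (ler_normD _ _) _; rewrite -zn lerD.
apply: (wuacs_cvg EW _ _ Lam1 xy2 z2 xyz4) => //.
by under eq_fun do rewrite dualD; apply: cvgD.
Qed.

Lemma koethe_kadets_klee_pair (a b : nat -> T -> R) (Lam : dual_space (koethe E))
    (Ea : forall n, koethe_mem E (a n)) (Eb : forall n, koethe_mem E (b n)) :
  reflexive_space (koethe E) -> kadets_klee (koethe E) -> `|Lam| <= 1 ->
  (forall n, koethe_norm E (a n) = 1) -> (forall n, koethe_norm E (b n) = 1) ->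
  Lam (kclass (Ea n)) @[n --> \oo] --> (1 : R) ->
  Lam (kclass (Eb n)) @[n --> \oo] --> (1 : R) ->
  exists (k : nat -> nat) (z w : koethe E), [/\ forall n, (n <= k n)%N,
    `|kclass (Ea (k n)) - z| @[n --> \oo] --> (0 : R),
    `|kclass (Eb (k n)) - w| @[n --> \oo] --> (0 : R), Lam z = 1 & Lam w = 1].
Proof.
move=> refE kkE Lam1 a1 b1 La Lb.
have [n|k1 [z [k1n az Lz]]] := kadets_klee_subseq refE kkE _ Lam1 La.
  by rewrite norm_fclass -[RHS](a1 n).
have Lb1 : Lam (kclass (Eb (k1 n))) @[n --> \oo] --> (1 : R) := cvg_subseq k1n Lb.
have [n|k2 [w [k2n bw Lw]]] := kadets_klee_subseq refE kkE _ Lam1 Lb1.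
  by rewrite norm_fclass -[RHS](b1 (k1 n)).
exists (k1 \o k2), z, w; split => //.
  by move=> n /=; exact: leq_trans (k2n n) (k1n _).
exact: (cvg_subseq k2n az).
Qed.

End koethe_sequences.

(** * The wuacs property along a subsequence *)

Section kb_wuacs.
Context d (T : measurableType d) (R : realType) (mu : {measure set T -> \bar R}).
Context (cmu : measure_is_complete mu) (E : koethe_space cmu).
Context (E_wuacs : wuacs (koethe E)) (E_reflexive : reflexive_space (koethe E)).
Context (E_kadets_klee : kadets_klee (koethe E)).
Context (lam : {measure set T -> \bar R}).
Context (u : T -> R) (u0 : forall t, 0 < u t) (mu1 : measurable_fun setT (fun t => (u t)^-1)).
Context (lamP : forall a : T -> R, koethe_mem E a ->
  lam.-integrable setT (fun t => (a t / u t)%:E) /\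
  (\int[lam]_t (`|a t| / u t)%:E <= (koethe_norm E a)%:E)%E).

Notation kclass Ef := (fclass (F := koethe_fun_space E) Ef : koethe E).

(** With the weight [1] this is the modulus of the represented functional; a
    weight with values [1] and [-1] reverses it on a chosen set. *)
Lemma exists_weighted_dual (w : T -> R) : measurable_fun setT w ->
  (forall t, `|w t| <= 1) ->
  exists psi : dual_space (koethe E), `|psi| <= 1 /\
    forall a (Ea : koethe_mem E a), lam.-integrable setT (fun t => (w t * (a t / u t))%:E) /\
      (\int[lam]_t (w t * (a t / u t))%:E = (psi (kclass Ea))%:E)%E.
Proof.
move=> mw w1.
have iw a : koethe_mem E a -> lam.-integrable setT (fun t => (w t * (a t / u t))%:E).
  move=> Ea; have [ia _] := lamP Ea.
  have ma : measurable_fun setT (fun t => a t / u t).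
    by apply/measurable_EFinP; exact: measurable_int ia.
  apply: (le_integrable measurableT _ _ ia).
    by apply/measurable_EFinP; exact: measurable_funM.
  by move=> t _; rewrite lee_fin normrM ler_piMl.
pose L (a : T -> R) : R := fine (\int[lam]_t (w t * (a t / u t))%:E)%E.
have LE a : koethe_mem E a -> (\int[lam]_t (w t * (a t / u t))%:E = (L a)%:E)%E.
  by move=> Ea; rewrite /L fineK// integrable_fin_num//; exact: iw.
have Llin c a b : fs_mem (koethe_fun_space E) a -> fs_mem (koethe_fun_space E) b ->
    L (c *: a + b) = c * L a + L b.
  move=> Ea Eb; apply: EFin_inj; rewrite EFinD EFinM -!LE//; last exact: koethe_memL.
  rewrite -integralZl//; last exact: iw.
  rewrite -integralD//; [|by apply: integrableZl => //; exact: iw|exact: iw].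
  apply: eq_integral => t _; rewrite -EFinM -EFinD; congr EFin.
  by rewrite !fctE /GRing.scale/=; ring.
have LM a : fs_mem (koethe_fun_space E) a -> L a <= 1 * fs_norm (koethe_fun_space E) a.
  move=> Ea; rewrite mul1r -lee_fin -LE//; have [ia iaN] := lamP Ea.
  apply: le_trans iaN; apply: le_trans (lee_abs _) _.
  have mi := measurable_int _ (iw _ Ea).
  apply: le_trans (le_abse_integral _ measurableT mi) _.
  apply: ge0_le_integral => //.
  - exact: measurableT_comp.
  - apply/measurable_EFinP; apply: measurable_funM => //.
    by apply: measurableT_comp => //; exact: koethe_measurable Ea.
  - move=> t _; rewrite lee_fin !normrM (@gtr0_norm _ (_^-1)) ?invr_gt0//.
    by apply: ler_piMl => //; rewrite mulr_ge0// invr_ge0 ltW.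
have [psi [psi1 psiE]] := exists_fun_space_dual ler01 Llin LM.
by exists psi; split => // a Ea; rewrite LE// psiE; split => //; exact: iw.
Qed.

(** Along a subsequence, the four limits [|f_n| -> A], [|g_n| -> B],
    [|f_n + g_n| -> A + B] and [F (f_n) -> A] hold almost everywhere. Where [A > 0],
    the property of [X] applies to the functional [F t]; where [A <= 0], the
    function [B] vanishes because [E] has the property. Hence [F (g_n) -> B]
    almost everywhere, and the integrals converge by domination. *)
Lemma kb_wuacs_subseq (X : normedModType R) (F : T -> dual_space X)
    (f g : nat -> T -> X) (p s : nat -> R) :
  wuacs X -> (forall t, `|F t| <= 1) ->
  (forall n, kb_mem E (f n)) -> (forall n, kb_mem E (g n)) ->
  (forall n, measurable_fun setT (fun t => F t (f n t))) ->
  (forall n, measurable_fun setT (fun t => F t (g n t))) ->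
  (forall n, (\int[lam]_t (F t (f n t) / u t)%:E = (p n)%:E)%E) ->
  (forall n, (\int[lam]_t (F t (g n t) / u t)%:E = (s n)%:E)%E) ->
  (forall n, kb_norm E (f n) = 1) -> (forall n, kb_norm E (g n) = 1) ->
  kb_norm E (f n + g n) @[n --> \oo] --> (2 : R) ->
  p n @[n --> \oo] --> (1 : R) ->
  exists2 k : nat -> nat, (forall n, (n <= k n)%N) & s (k n) @[n --> \oo] --> (1 : R).
Proof.
move=> X_wuacs F1 Ef Eg mFf mFg pE sE f1 g1 fg2 p1.
pose a n t := `|f n t|; pose b n t := `|g n t|; pose h n t := `|f n t + g n t|.
have Ea n : koethe_mem E (a n) := (Ef n).2.
have Eb n : koethe_mem E (b n) := (Eg n).2.
have Eh n : koethe_mem E (h n) := (kb_memD (Ef n) (Eg n)).2.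
have mquo (v : T -> R) : measurable_fun setT v -> measurable_fun setT (fun t => v t / u t).
  by move=> mv; exact: measurable_funM.
have Vu0 t : 0 <= (u t)^-1 by rewrite invr_ge0 ltW.
have iF (v : T -> X) : kb_mem E v -> measurable_fun setT (fun t => F t (v t)) ->
    lam.-integrable setT (fun t => (F t (v t) / u t)%:E).
  move=> [_ Ev] mFv; have [iv _] := lamP Ev.
  apply: (le_integrable measurableT _ _ iv); first exact/measurable_EFinP/mquo.
  by move=> t _; rewrite lee_fin !normrM normr_id ler_wpM2r// dual_ler1.
have [|t|Lam [Lam1 LamE0]] := @exists_weighted_dual (cst 1).
- exact: measurable_cst.
- by rewrite /= normr1.
have LamE v (Ev : koethe_mem E v) : (\int[lam]_t (v t / u t)%:E = (Lam (kclass Ev))%:E)%E.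
  by rewrite -(LamE0 v Ev).2; apply: eq_integral => t _; rewrite /= mul1r.
have La : Lam (kclass (Ea n)) @[n --> \oo] --> (1 : R).
  apply: (squeeze_cvgr _ p1 (h := fun=> 1)); last exact: cvg_cst.
  apply: nearW => n; apply/andP; split.
    rewrite -lee_fin -LamE -pE; apply: le_integral => //.
    - exact: iF (Ef n) (mFf n).
    - by have [] := lamP (Ea n).
    - move=> t _; rewrite lee_fin ler_wpM2r//.
      by apply: le_trans (ler_norm _) _; exact: dual_ler1.
  apply: le_trans (ler_norm _) _; apply: le_trans (dual_ler1 _ Lam1) _.
  by rewrite norm_fclass (_ : fs_norm _ _ = 1) ?lexx//; exact: f1.
have [||xy2 Lb Lh] := @koethe_wuacs_sum _ _ _ _ _ _ a b h Lam Ea Eb Eh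
  E_wuacs Lam1 _ _ f1 g1 fg2 La.
- by move=> n t; exact: normr_ge0.
- by move=> n t; exact: ler_normD.
have [k [z [w [kn az bw Lz Lw]]]] :=
  @koethe_kadets_klee_pair _ _ _ _ _ _ a b Lam Ea Eb E_reflexive E_kadets_klee Lam1 f1 g1 La Lb.
pose A : T -> R := repr z; pose B : T -> R := repr w.
have EA : koethe_mem E A := fs_elt_mem (repr z).
have EB : koethe_mem E B := fs_elt_mem (repr w).
have zE : z = kclass EA.
  rewrite -[LHS](fclass_repr (F := koethe_fun_space E) z).
  by apply/ae_class_eq; exact: aeW.
have wE : w = kclass EB.
  rewrite -[LHS](fclass_repr (F := koethe_fun_space E) w).
  by apply/ae_class_eq; exact: aeW.
have mA : measurable_fun setT A := koethe_measurable EA.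
have mB : measurable_fun setT B := koethe_measurable EB.
have ma n : measurable_fun setT (a n) := koethe_measurable (Ea n).
have mb n : measurable_fun setT (b n) := koethe_measurable (Eb n).
have mh n : measurable_fun setT (h n) := koethe_measurable (Eh n).
have mean_diff (v : nat -> T -> R) (C : T -> R) (Ev : forall n, koethe_mem E (v n))
    (EC : koethe_mem E C) : `|kclass (Ev n) - kclass EC| @[n --> \oo] --> (0 : R) ->
    (\int[lam]_t (`|v n t - C t| / u t)%:E)%E @[n --> \oo] --> 0%E.
  have vCE n : kclass (Ev n) - kclass EC = kclass (koethe_memB (Ev n) EC).
    by apply/esym/fclassB; exact: aeW.
  under eq_fun do rewrite vCE norm_fclass.
  move=> vC; have vC' : (koethe_norm E (v n - C))%:E @[n --> \oo] --> 0%E.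
    by apply: cvg_EFin => //; exact: nearW.
  apply: (squeeze_cvge _ (cvg_cst 0%E) vC'); apply: nearW => n.
  rewrite (lamP (koethe_memB (Ev n) EC)).2 andbT; apply: integral_ge0 => t _.
  by rewrite lee_fin mulr_ge0.
have Dh : (\int[lam]_t ((a (k n) t + b (k n) t - h (k n) t) / u t)%:E)%E @[n --> \oo] --> 0%E.
  have E' n : koethe_mem E (a n + b n - h n) by exact: koethe_memB (koethe_memD _ _) _.
  have LE n : Lam (kclass (E' n)) =
      Lam (kclass (Ea n)) + Lam (kclass (Eb n)) - Lam (kclass (Eh n)).
    rewrite -dualD -dualB; congr (Lam _).
    rewrite -(fclassD (F := koethe_fun_space E) (Ea n) (Eb n) (koethe_memD (Ea n) (Eb n))).
      by apply: fclassB; exact: aeW.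
    exact: aeW.
  rewrite (_ : (fun n => _) = fun n => (Lam (kclass (E' (k n))))%:E); last first.
    by apply/funext => n; rewrite -LamE.
  apply: cvg_EFin; first exact: nearW.
  have : Lam (kclass (E' n)) @[n --> \oo] --> (0 : R).
    under eq_fun do rewrite LE.
    by rewrite (_ : 0 = 1 + 1 - 2 :> R); [apply: cvgB => //; exact: cvgD|ring].
  exact: cvg_subseq.
have Df : (\int[lam]_t ((a (k n) t - F t (f (k n) t)) / u t)%:E)%E @[n --> \oo] --> 0%E.
  rewrite (_ : (fun n => _) = fun n => (Lam (kclass (Ea (k n))) - p (k n))%:E); last first.
    apply/funext => n; rewrite EFinB -LamE -pE -integralB//.
    - by apply: eq_integral => t _; rewrite mulrBl.
    - by have [] := lamP (Ea (k n)).
    - exact: iF (Ef _) (mFf _).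
  apply: cvg_EFin; first exact: nearW.
  have : Lam (kclass (Ea n)) - p n @[n --> \oo] --> (0 : R).
    by rewrite -(subrr 1); exact: cvgB.
  exact: cvg_subseq.
(* Since [abh0] and [aF0] make the last two terms nonnegative, this single
   sequence controls the deviations in all four limits. *)
pose q n t := `|a (k n) t - A t| / u t + (`|b (k n) t - B t| / u t +
  ((a (k n) t + b (k n) t - h (k n) t) / u t + (a (k n) t - F t (f (k n) t)) / u t)).
have abh0 n t : 0 <= a n t + b n t - h n t by rewrite subr_ge0 ler_normD.
have aF0 n t : 0 <= a n t - F t (f n t).
  by rewrite subr_ge0; apply: le_trans (ler_norm _) _; exact: dual_ler1.
have mq1 n : measurable_fun setT (fun t => `|a (k n) t - A t| / u t).
  by apply/mquo; apply: measurableT_comp => //; exact: measurable_funB.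
have mq2 n : measurable_fun setT (fun t => `|b (k n) t - B t| / u t).
  by apply/mquo; apply: measurableT_comp => //; exact: measurable_funB.
have mq3 n : measurable_fun setT (fun t => (a (k n) t + b (k n) t - h (k n) t) / u t).
  by apply/mquo; apply: measurable_funB => //; exact: measurable_funD.
have mq4 n : measurable_fun setT (fun t => (a (k n) t - F t (f (k n) t)) / u t).
  by apply/mquo; exact: measurable_funB.
have mq34 n := measurable_funD (mq3 n) (mq4 n).
have mq234 n := measurable_funD (mq2 n) (mq34 n).
have mq n : measurable_fun setT (q n) := measurable_funD (mq1 n) (mq234 n).
have q0 n t : 0 <= q n t by rewrite /q !addr_ge0// mulr_ge0.
have qcvg : (\int[lam]_t (q n t)%:E)%E @[n --> \oo] --> 0%E.
  apply: mean_cvg0D => //; [by move=> n t; rewrite mulr_ge0| |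
    by apply: (mean_diff (a \o k) A (fun n => Ea (k n)) EA); rewrite -zE|].
    by move=> n t; rewrite !addr_ge0// mulr_ge0.
  apply: mean_cvg0D => //; [by move=> n t; rewrite mulr_ge0| |
    by apply: (mean_diff (b \o k) B (fun n => Eb (k n)) EB); rewrite -wE|].
    by move=> n t; rewrite !addr_ge0// mulr_ge0.
  by apply: mean_cvg0D => // n t; rewrite mulr_ge0.
have [j jn jq] := mean_cvg0_ae_subseq mq q0 qcvg.
pose K n := k (j n).
have uqE n t : u t * q n t = `|a (k n) t - A t| + (`|b (k n) t - B t| +
    ((a (k n) t + b (k n) t - h (k n) t) + (a (k n) t - F t (f (k n) t)))).
  by rewrite /q -!mulrDl mulrC divfK ?gt_eqF.
have cvg_of t (v : nat -> R) l : q (j n) t @[n --> \oo] --> (0 : R) ->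
    (forall n, `|v n - l| <= u t * q (j n) t) -> v n @[n --> \oo] --> l.
  move=> qt vq; apply/subr_cvg0/norm_cvg0P.
  have uq : u t * q (j n) t @[n --> \oo] --> (0 : R).
    by rewrite -(mulr0 (u t)); exact: cvgMr.
  apply: (squeeze_cvgr _ (cvg_cst 0) uq); apply: nearW => n.
  by rewrite normr_ge0 vq.
have acvg t : q (j n) t @[n --> \oo] --> (0 : R) -> a (K n) t @[n --> \oo] --> A t.
  move=> qt; apply: cvg_of qt _ => n; rewrite uqE lerDl.
  exact: addr_ge0 (normr_ge0 _) (addr_ge0 (abh0 _ _) (aF0 _ _)).
have bcvg t : q (j n) t @[n --> \oo] --> (0 : R) -> b (K n) t @[n --> \oo] --> B t.
  move=> qt; apply: cvg_of qt _ => n; rewrite uqE addrCA lerDl.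
  exact: addr_ge0 (normr_ge0 _) (addr_ge0 (abh0 _ _) (aF0 _ _)).
have hcvg t : q (j n) t @[n --> \oo] --> (0 : R) -> h (K n) t @[n --> \oo] --> A t + B t.
  move=> qt; apply: cvg_of qt _ => n; rewrite uqE -/(K n).
  have := abh0 (K n) t; have := aF0 (K n) t.
  have := ler_norm (a (K n) t - A t); have := ler_norm (A t - a (K n) t).
  have := ler_norm (b (K n) t - B t); have := ler_norm (B t - b (K n) t).
  rewrite (distrC (A t)) (distrC (B t)) ler_norml => *; apply/andP; split; lra.
have Fcvg t : q (j n) t @[n --> \oo] --> (0 : R) -> F t (f (K n) t) @[n --> \oo] --> A t.
  move=> qt; apply: cvg_of qt _ => n; rewrite uqE -/(K n).
  have := abh0 (K n) t; have := aF0 (K n) t; have := normr_ge0 (b (K n) t - B t).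
  have := ler_norm (a (K n) t - A t); have := ler_norm (A t - a (K n) t).
  rewrite (distrC (A t)) ler_norml => *; apply/andP; split; lra.
have B0 : {ae lam, forall t, A t <= 0 -> B t = 0}.
  (* Reversing the sign of the functional where [A <= 0] does not decrease its value
     at [A]; the property of [E] then gives it the value 1 at [B] as well. *)
  pose sg t : R := if 0 < A t then 1 else -1.
  have msg : measurable_fun setT sg.
    apply: measurable_fun_ifT => //; first exact: measurable_fun_ltr.
  have [|psi [psi1 psiE]] := exists_weighted_dual msg.
    by move=> t; rewrite /sg; case: ifP; rewrite ?normrN normr1.
  have psiz : psi (kclass (Ea (k n))) @[n --> \oo] --> psi z := dual_norm_cvg (phi := psi) az.
  have z1 : psi z = 1.
    apply/eqP; rewrite eq_le; apply/andP; split.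
      apply: (cvgr_to_le psiz); apply: nearW => n.
      apply: le_trans (ler_norm _) _; apply: le_trans (dual_ler1 _ psi1) _.
      by rewrite norm_fclass (_ : fs_norm _ _ = 1) ?lexx//; exact: f1.
    rewrite -lee_fin -Lz zE -LamE -(psiE _ EA).2; apply: le_integral => //.
    - by have [] := lamP EA.
    - by have [] := psiE _ EA.
    - move=> t _; rewrite lee_fin mulrA ler_wpM2r// /sg.
      by case: ltP => A0; rewrite ?mul1r ?mulN1r//; lra.
  have w1 : psi w = 1.
    have k2 := cvg_subseq kn xy2.
    apply: (cvg_unique (@Rhausdorff R) (dual_norm_cvg (phi := psi) bw)).
    apply: (wuacs_cvg (x := fun n => kclass (Ea (k n))) E_wuacs ltr01 ler01 psi1 _ _ k2) => //.
    - rewrite (_ : (fun n => _) = fun=> 1); first exact: cvg_cst.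
      by apply/funext => n; rewrite norm_fclass; exact: f1.
    - rewrite (_ : (fun n => _) = fun=> 1); first exact: cvg_cst.
      by apply/funext => n; rewrite norm_fclass; exact: g1.
    - by rewrite -z1.
  have BG : {ae lam, forall t, 0 <= B t}.
    apply: filterS jq => t /bcvg bB.
    by apply: (cvgr_to_ge bB); apply: nearW => n; exact: normr_ge0.
  have [iB _] := lamP EB; have [isB sBE] := psiE _ EB.
  have mD : measurable_fun setT (fun t => (B t / u t)%:E - (sg t * (B t / u t))%:E)%E.
    exact: emeasurable_funB (measurable_int _ iB) (measurable_int _ isB).
  have D0 : (\int[lam]_t `|(B t / u t)%:E - (sg t * (B t / u t))%:E| = 0)%E.
    transitivity (\int[lam]_t ((B t / u t)%:E - (sg t * (B t / u t))%:E))%E.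
      apply: ae_eq_integral => //; first exact: measurableT_comp.
      apply: filterS BG => t Bt _; rewrite gee0_abs// -EFinB lee_fin subr_ge0.
      apply: ler_piMl; first exact: mulr_ge0.
      by rewrite /sg; case: ifP => _; lra.
    by rewrite integralB// sBE (LamE _ EB) -wE Lw w1 subee.
  have := (ae_eq_integral_abs lam measurableT mD).1 D0.
  apply: filterS => t /(_ I); rewrite -EFinB /sg => -[+ At].
  rewrite ltNge At/= mulN1r opprK => /eqP.
  rewrite -mulr2n mulrn_eq0/= mulf_eq0 invr_eq0 => /orP[/eqP//|].
  by rewrite gt_eqF.
have Fg : {ae lam, forall t, F t (g (K n) t) @[n --> \oo] --> B t}.
  apply: filterS2 jq B0 => t qt B0t.
  have bB := bcvg t qt; have BG : 0 <= B t.
    by apply: (cvgr_to_ge bB); apply: nearW => n; exact: normr_ge0.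
  have [A0|/B0t Bt] := ltP 0 (A t).
    exact: (wuacs_cvg X_wuacs A0 BG (F1 t) (acvg t qt) bB (hcvg t qt) (Fcvg t qt)).
  rewrite Bt; apply/norm_cvg0P; rewrite Bt in bB.
  apply: (squeeze_cvgr _ (cvg_cst 0) bB); apply: nearW => n.
  by rewrite normr_ge0 dual_ler1.
exists K; first by move=> n; exact: leq_trans (jn n) (kn _).
pose r n t := `|F t (g (K n) t) - B t| / u t.
have mr n : measurable_fun setT (r n).
  by apply/mquo; apply: measurableT_comp => //; exact: measurable_funB.
have iB2 : lam.-integrable setT (EFin \o (fun t => 2 * (`|B t| / u t))).
  rewrite (_ : _ \o _ = fun t => (2%:E * (`|B t| / u t)%:E)%E)//.
  by apply: integrableZl => //; have [] := lamP (koethe_mem_norm EB).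
have rcvg : (\int[lam]_t (r n t)%:E)%E @[n --> \oo] --> 0%E.
  apply: (mean_dominated_cvg0 mr (fun n => mq (j n)) _ _ _ iB2) => //.
  - by move=> n t; rewrite mulr_ge0.
  - by move=> t; rewrite !mulr_ge0.
  - move=> n t; rewrite /r ler_pdivrMr// mulrDl [q _ _ * _]mulrC uqE -/(K n).
    rewrite -mulrA divfK ?gt_eqF//.
    have := dual_ler1 (g (K n) t) (F1 t); rewrite -/(b (K n) t).
    have := ler_normB (F t (g (K n) t)) (B t).
    have := abh0 (K n) t; have := aF0 (K n) t; have := normr_ge0 (a (K n) t - A t).
    have := ler_norm (b (K n) t - B t); have := ler_norm (B t); lra.
  - exact: cvg_subseq jn qcvg.
  - apply: filterS Fg => t Ft; rewrite -(mul0r (u t)^-1); apply: cvgMl.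
    exact/norm_cvg0P/subr_cvg0.
have sr n : (`|s (K n) - 1|%:E <= \int[lam]_t (r n t)%:E)%E.
  have sE' : (s (K n) - 1)%:E = (\int[lam]_t ((F t (g (K n) t) - B t) / u t)%:E)%E.
    rewrite EFinB -sE -Lw wE -LamE -integralB//.
    - by apply: eq_integral => t _; rewrite mulrBl.
    - exact: iF (Eg _) (mFg _).
    - by have [] := lamP EB.
  rewrite -abse_EFin sE'; apply: le_trans (le_abse_integral _ measurableT _) _.
    by apply/measurable_EFinP/mquo; exact: measurable_funB.
  rewrite le_eqVlt; apply/orP; left; apply/eqP; apply: eq_integral => t _.
  by rewrite abse_EFin normrM (@ger0_norm _ (_^-1)).
have sr0 : `|s (K n) - 1|%:E @[n --> \oo] --> 0%E.
  apply: (squeeze_cvge _ (cvg_cst 0%E) rcvg); apply: nearW => n.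
  by rewrite lee_fin normr_ge0 sr.
by apply/subr_cvg0/norm_cvg0P; have /fine_cvg := sr0.
Qed.

End kb_wuacs.

Theorem theorem3p8 (R : realType) (d : measure_display) (T : measurableType d)
    (mu : {measure set T -> \bar R}) (cmu : measure_is_complete mu)
    (E : koethe_space cmu) (X : completeNormedModType R)
    (smu : sigma_finite [set: T] mu)
    (E_wuacs : wuacs (koethe E))
    (E_reflexive : reflexive_space (koethe E))
    (E_kadets_klee : kadets_klee (koethe E))
    (X_wuacs : wuacs X) :
  wuacs (koethe_bochner E X).
Proof.
move=> x y phi x1 y1 phi1 xy2 phix.
have [u Eu u0] := exists_koethe_pos E smu.
pose KB := kb_fun_space E X.
pose L (f : T -> X) : R := if pselect (kb_mem E f) is left Ef
  then phi (fclass (F := KB) Ef : koethe_bochner E X) else 0.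
have LE f (Ef : kb_mem E f) : L f = phi (fclass (F := KB) Ef : koethe_bochner E X).
  rewrite /L; case: pselect => // Ef'; congr (phi _).
  by apply/ae_class_eq; exact: aeW.
have Llin a f g : kb_mem E f -> kb_mem E g -> L (a *: f + g) = a * L f + L g.
  move=> Ef Eg; rewrite !LE; first exact: kb_memL.
  move=> Efg; rewrite -dual_linear; congr (phi _).
  by apply: fclass_lin; exact: aeW.
have LM f : kb_mem E f -> L f <= kb_norm E f.
  move=> Ef; rewrite LE; apply: le_trans (ler_norm _) _.
  apply: le_trans (dual_ler1 _ _) _; first by rewrite phi1.
  by rewrite norm_fclass.
have [lam lamE] := exists_variation_measure E_reflexive Eu u0 Llin LM.
pose fg (bn : bool * nat) : T -> X := repr (if bn.1 then x bn.2 else y bn.2).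
have Efg bn : kb_mem E (fg bn) := fs_elt_mem (F := KB) (repr (if bn.1 then x bn.2 else y bn.2)).
have Lrepr (v : koethe_bochner E X) : L (repr v) = phi v.
  rewrite (LE _ (fs_elt_mem (repr v))); congr (phi _).
  exact: (fclass_repr (F := KB) v).
have [F [F1 FP]] := kb_functional_representation E_reflexive Eu u0 Llin LM lamE Efg.
apply: cvg_subseqP => k kn.
have normD_repr (v w : koethe_bochner E X) : kb_norm E (repr v + repr w) = `|v + w|.
  pose Ev : kb_mem E (repr v) := fs_elt_mem (F := KB) (repr v).
  pose Ew : kb_mem E (repr w) := fs_elt_mem (F := KB) (repr w).
  rewrite -[v in RHS](fclass_repr (F := KB)) -[w in RHS](fclass_repr (F := KB)).
  rewrite -(fclassD (F := KB) Ev Ew (kb_memD Ev Ew)) ?norm_fclass//.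
  exact: aeW.
have [||||||||||j jn sj] := @kb_wuacs_subseq _ _ _ _ _ E E_wuacs E_reflexive E_kadets_klee
  lam u u0 (measurable_inv_pos Eu u0) (koethe_integrable_variation Eu u0 Llin LM lamE)
  X F (fun n => fg (true, k n)) (fun n => fg (false, k n))
  (fun n => phi (x (k n))) (fun n => phi (y (k n))) X_wuacs F1.
- by move=> n; exact: Efg.
- by move=> n; exact: Efg.
- by move=> n; have [] := FP (true, k n).
- by move=> n; have [] := FP (false, k n).
- by move=> n; have [_ ->] := FP (true, k n); rewrite Lrepr.
- by move=> n; have [_ ->] := FP (false, k n); rewrite Lrepr.
- by move=> n; exact: x1.
- by move=> n; exact: y1.
- by under eq_fun do rewrite normD_repr; exact: (cvg_subseq kn xy2).
- exact: (cvg_subseq kn phix).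
by exists j.
Qed.
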